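(* Suppose the sequence of grids satisfies $h_n\to0$ and $\max_{x\in\mathbb S_n^-}\delta^+x\,/\,\min_{x\in\mathbb S_n^-}\delta^+x\le C_0$ for all $n$, with $C_0$ independent of $n$. For either scheme, there exist a sufficiently small $\delta_0>0$ and a constant $C>0$ independent of $k$ and $n$ such that, whenever $h_n\in(0,\delta_0)$, for every integer $1\le k\le h_n^{-1/4}$, $$|\lambda_k^n-\lambda_k|\le Ck^4h_n^\gamma,$$ where $\gamma=1$ for Scheme 1 and $\gamma=2$ for Scheme 2.
   Context: Let $-\infty<l<r<\infty$, $\rho\in(0,\infty)$, $\mu\in C^3([l,r])$, $\sigma^2\in C^4([l,r])$ with $\sigma^2>0$, and $\kappa\in C^2([l,r])$ with $\kappa\ge0$. It is also assumed that the reflected SDE $dX_t=\mu(X_t)I(X_t>l)dt+\sigma(X_t)I(X_t>l)dB_t+\frac12dL^l_t(X)$, $I(X_t=l)dt=0$ has a unique weak solution ($L^l$ is the right local time at $l$). Continuous problem. Let $(\lambda_k,\varphi_k)$, $k\ge1$, $\lambda_1<\lambda_2<\cdots$, be the eigenpairs of the Sturm–Liouville problem $\mu\varphi'+\frac12\sigma^2\varphi''-\kappa\varphi=-\lambda\varphi$ on $(l,r)$, $\rho\varphi'(l)-(\kappa(l)-\lambda)\varphi(l)=0$, $\varphi(r)=0$ (its spectrum is purely discrete and simple). Grid. $\mathbb S_n=\{x_0<x_1<\dots<x_{n+1}\}$, $x_0=l$, $x_{n+1}=r$, $\mathbb S_n^\circ=\{x_1,\dots,x_n\}$, $\mathbb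 S_n^-=\{x_0,\dots,x_n\}$. For $x=x_i$, $x^\pm=x_{i\pm1}$, $\delta^+x=x^+-x$, $\delta^-x=x-x^-$, $\delta x=\frac12(\delta^+x+\delta^-x)$, $h_n=\max_{x\in\mathbb S_n^-}\delta^+x$. Put $\nabla^+g(x)=\frac{g(x^+)-g(x)}{\delta^+x}$, $\nabla^-g(x)=\frac{g(x)-g(x^-)}{\delta^-x}$, $\nabla g(x)=\frac{\delta^-x}{2\delta x}\nabla^+g(x)+\frac{\delta^+x}{2\delta x}\nabla^-g(x)$, $\Delta g(x)=\frac1{\delta x}(\nabla^+g(x)-\nabla^-g(x))$. Discrete problem. For $g:\mathbb S_n\to\mathbb R$, $G_ng(x)=\mu(x)\nabla g(x)+\frac12\sigma^2(x)\Delta g(x)-\kappa(x)g(x)$ for $x\in\mathbb S_n^\circ$, and $G_ng(x_0)=\rho\beta\nabla^+g(x_0)-\kappa(x_0)g(x_0)$, with $\beta=1$ in Scheme 1 and $\beta=\bigl(1+\frac{\rho-\mu(x_0)}{\sigma^2(x_0)}\delta^+x_0\bigr)^{-1}$ in Scheme 2. $\lambda_1^n<\lambda_2^n<\dots<\lambda_{n+1}^n$ are the (real, simple) eigenvalues of: $G_n\varphi(x)=-\lambda\varphi(x)$ for $x=x_0,\dots,x_n$, $\varphi(x_{n+1})=0$. *)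

(* Defs.v *)
From Stdlib Require Import Reals RList List.
Open Scope R_scope.

(** * Smooth functions on a closed interval *)

Definition segment (l r : R) : R -> Prop := fun y => l <= y <= r.

(* [f] restricted to [[l, r]] is of class C^m: derivatives at the endpoints
   are one-sided, and the values of [f] outside [[l, r]] are irrelevant. *)
Fixpoint C_on (l r : R) (m : nat) (f : R -> R) : Prop :=
  match m with
  | O => forall y, segment l r y -> continue_in f (segment l r) y
  | S m' => exists df : R -> R,
      (forall y, segment l r y -> D_in f df (segment l r) y) /\ C_on l r m' df
  end.

(** * The Sturm-Liouville problem *)

(* The eigenparameter also occurs in the boundary condition at [l];
   [dphi l] is the right derivative there. *)
Definition sl_eigenpair (l r rho : R) (mu sigma kappa : R -> R)
    (lambda : R) (phi : R -> R) : Prop :=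
  (exists y, l <= y <= r /\ phi y <> 0) /\
  exists dphi ddphi : R -> R,
    (forall y, segment l r y -> D_in phi dphi (segment l r) y) /\
    (forall y, segment l r y -> D_in dphi ddphi (segment l r) y) /\
    (forall y, segment l r y -> continue_in ddphi (segment l r) y) /\
    (forall y, l < y < r ->
       mu y * dphi y + / 2 * sigma y ^ 2 * ddphi y - kappa y * phi y
       = - lambda * phi y) /\
    rho * dphi l - (kappa l - lambda) * phi l = 0 /\
    phi r = 0.

(* [lam 1 < lam 2 < ...] are exactly the eigenvalues; [lam 0] is unused. *)
Definition sl_spectrum (l r rho : R) (mu sigma kappa : R -> R)
    (lam : nat -> R) : Prop :=
  (forall k, (1 <= k)%nat -> lam k < lam (S k)) /\
  (forall lambda,
     (exists phi, sl_eigenpair l r rho mu sigma kappa lambda phi) <->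
     (exists k, (1 <= k)%nat /\ lambda = lam k)).

(** * Grids and difference operators *)

(* A grid with [n] interior points is given by its points
   [x 0 < ... < x (n + 1)], and a function on it by its values
   [g 0, ..., g (n + 1)]; values at larger indices are irrelevant. *)
Definition is_grid (l r : R) (n : nat) (x : nat -> R) : Prop :=
  x 0%nat = l /\ x (S n) = r /\ forall i, (i <= n)%nat -> x i < x (S i).

(* [delta_minus], [nabla_minus], [nabla] and [Laplace] are meant for
   [1 <= i <= n]. *)
Definition delta_plus (x : nat -> R) (i : nat) : R := x (S i) - x i.
Definition delta_minus (x : nat -> R) (i : nat) : R := x i - x (pred i).
Definition delta (x : nat -> R) (i : nat) : R :=
  / 2 * (delta_plus x i + delta_minus x i).

Definition max_step (n : nat) (x : nat -> R) : R :=
  MaxRlist (map (delta_plus x) (seq 0 (S n))).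
Definition min_step (n : nat) (x : nat -> R) : R :=
  MinRlist (map (delta_plus x) (seq 0 (S n))).

Definition nabla_plus (x g : nat -> R) (i : nat) : R :=
  (g (S i) - g i) / delta_plus x i.
Definition nabla_minus (x g : nat -> R) (i : nat) : R :=
  (g i - g (pred i)) / delta_minus x i.
Definition nabla (x g : nat -> R) (i : nat) : R :=
  delta_minus x i / (2 * delta x i) * nabla_plus x g i
  + delta_plus x i / (2 * delta x i) * nabla_minus x g i.
Definition Laplace (x g : nat -> R) (i : nat) : R :=
  / delta x i * (nabla_plus x g i - nabla_minus x g i).

(** * The discrete eigenvalue problem *)

Inductive scheme : Set := Scheme1 | Scheme2.

Definition beta (s : scheme) (rho : R) (mu sigma : R -> R) (x : nat -> R) : R :=
  match s with
  | Scheme1 => 1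
  | Scheme2 =>
      / (1 + (rho - mu (x 0%nat)) / sigma (x 0%nat) ^ 2 * delta_plus x 0)
  end.

Definition convergence_order (s : scheme) : nat :=
  match s with Scheme1 => 1%nat | Scheme2 => 2%nat end.

Definition G (s : scheme) (rho : R) (mu sigma kappa : R -> R)
    (x g : nat -> R) (i : nat) : R :=
  match i with
  | O => rho * beta s rho mu sigma x * nabla_plus x g 0
         - kappa (x 0%nat) * g 0%nat
  | S _ => mu (x i) * nabla x g i + / 2 * sigma (x i) ^ 2 * Laplace x g i
           - kappa (x i) * g i
  end.

Definition discrete_eigenpair (s : scheme) (rho : R) (mu sigma kappa : R -> R)
    (n : nat) (x : nat -> R) (lambda : R) (g : nat -> R) : Prop :=
  (exists i, (i <= S n)%nat /\ g i <> 0) /\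
  (forall i, (i <= n)%nat -> G s rho mu sigma kappa x g i = - lambda * g i) /\
  g (S n) = 0.

(* [lam 1 < ... < lam (n + 1)] are exactly the eigenvalues.  The problem has
   dimension [n + 1], so they are then all real and simple. *)
Definition discrete_spectrum (s : scheme) (rho : R) (mu sigma kappa : R -> R)
    (n : nat) (x : nat -> R) (lam : nat -> R) : Prop :=
  (forall k, (1 <= k <= n)%nat -> lam k < lam (S k)) /\
  (forall lambda,
     (exists g, discrete_eigenpair s rho mu sigma kappa n x lambda g) <->
     (exists k, (1 <= k <= S n)%nat /\ lambda = lam k)).

(* Main.v *)
Require Import Defs.
From Stdlib Require Import Reals RList List Lra Lia Psatz ClassicalChoice.
From Coquelicot Require Import Coquelicot.
Open Scope R_scope.

(** Both eigenvalue problems are solved by shooting from [l], and the end values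
    of the two shooting solutions are compared.

    Divided by [sigma ^ 2 / 2] the equation becomes
    [u'' = b u' + (c - lambda m) u].  Write [lambda = S ^ 2 - 1] with [S >= 1].
    In modified Pruefer coordinates [S sqrt m u = A sin t], [u' = A cos t] the
    angle satisfies [t' = S sqrt m + O(1)] with a bounded, Lipschitz remainder
    that at a fixed angle increases with [S], and the amplitude varies by a bounded factor,
    uniformly in [S].  Since the initial angle increases with [S] as well, the
    final angle [Theta S] satisfies
    [c0 (S2 - S1) <= Theta S2 - Theta S1 <= Lp (S2 - S1)] ([angle_growth]).
    The eigenvalues are the [S ^ 2 - 1] with [Theta S] a multiple of [PI], and by
    the lower bound they are met one multiple after the other
    ([spectrum_by_angle]); in particular [S_k <= 1 + k PI / c0].

    The three-term difference scheme is a leapfrog recursion: with [d] the values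
    of [nabla] and [f] those of the discrete second derivative, it advances
    [(g, d)] by half a kick [d + h/2 f], a drift of [g], and half a kick
    ([leapfrog_G]).  In this one-step form the local error is of third order on
    unequally spaced grids as well: the first-order truncation error of the
    three-point formula there never shows.  Relative to the
    amplitude the local error is [O((S h) ^ 3)], and a step changes the energy
    [S ^ 2 m g ^ 2 + d ^ 2] by a factor [1 + O(h)] as long as [S ^ 3 h ^ 2 <= 1]
    ([energy_step]).  So the discrete end point [(g, d)] points, up to
    [eta = O(S ^ 3 h ^ 2)], in the direction [Theta S] ([leapfrog_angle]); in
    Scheme 1 the starting slope contributes another [O(h)], while the factor
    [beta] of Scheme 2 makes it exact.

    Hence the discrete eigenvalues, the zeros of the last value [g], can only lie
    where [Theta S] is within [3 eta] of a multiple of [PI], and there is one near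
    every such multiple by a change of sign.  It is unique: the discrete Wronskian
    of [g] and its derivative in [lambda] has a fixed sign
    ([leapfrog_wronskian]), so all the zeros near one multiple are crossed in the
    same direction.  The two enumerations therefore agree, with an error [O(eta)]
    in [S] and [O(S eta)] in [lambda], which is at most of order
    [k ^ 4 h ^ 2], respectively [k h + k ^ 4 h ^ 2], because [S = O(k)].  The
    condition [k <= h ^ (-1/4)] keeps [eta] small. *)

(** * Differentiation and continuity of real functions *)

(** The rules are restated with the operations of [R], so that [der] and [cont]
    below can select them by the head symbol of the function. *)
Lemma is_derive_value (f : R -> R) (x a b : R) :
  is_derive f x a -> a = b -> is_derive f x b.
Proof. intros H E; rewrite <- E; exact H. Qed.

Lemma is_derive_const_R (c x : R) : is_derive (fun _ : R => c) x 0.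
Proof. apply (is_derive_const (K := R_AbsRing) c x). Qed.

Lemma is_derive_id_R (x : R) : is_derive (fun t : R => t) x 1.
Proof. apply (is_derive_id (K := R_AbsRing) x). Qed.

Lemma is_derive_plus_R (f g : R -> R) (x a b : R) :
  is_derive f x a -> is_derive g x b -> is_derive (fun t => f t + g t) x (a + b).
Proof. intros; apply (is_derive_plus (K := R_AbsRing) f g x a b); assumption. Qed.

Lemma is_derive_minus_R (f g : R -> R) (x a b : R) :
  is_derive f x a -> is_derive g x b -> is_derive (fun t => f t - g t) x (a - b).
Proof. intros; apply (is_derive_minus (K := R_AbsRing) f g x a b); assumption. Qed.

Lemma is_derive_opp_R (f : R -> R) (x a : R) :
  is_derive f x a -> is_derive (fun t => - f t) x (- a).
Proof. intros; apply (is_derive_opp (K := R_AbsRing) f x a); assumption. Qed.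

Lemma is_derive_mult_R (f g : R -> R) (x a b : R) :
  is_derive f x a -> is_derive g x b ->
  is_derive (fun t => f t * g t) x (a * g x + f x * b).
Proof.
intros; apply (is_derive_mult (K := R_AbsRing) f g x a b); try assumption.
intros; apply Rmult_comm.
Qed.

Lemma is_derive_comp_R (f g : R -> R) (x a b : R) :
  is_derive f (g x) a -> is_derive g x b -> is_derive (fun t => f (g t)) x (b * a).
Proof. intros; apply (is_derive_comp (K := R_AbsRing) f g x a b); assumption. Qed.

Lemma is_derive_inv_R (f : R -> R) (x a : R) :
  f x <> 0 -> is_derive f x a -> is_derive (fun t => / f t) x (- a / f x ^ 2).
Proof. intros; apply is_derive_inv; assumption. Qed.

Lemma is_derive_div_R (f g : R -> R) (x a b : R) :
  g x <> 0 -> is_derive f x a -> is_derive g x b ->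
  is_derive (fun t => f t / g t) x ((a * g x - f x * b) / g x ^ 2).
Proof. intros; apply is_derive_div; assumption. Qed.

Lemma is_derive_exp_R (f : R -> R) (x a : R) :
  is_derive f x a -> is_derive (fun t => exp (f t)) x (a * exp (f x)).
Proof. intro; apply (is_derive_comp_R exp f); [apply is_derive_exp | assumption]. Qed.

Lemma is_derive_sin_R (f : R -> R) (x a : R) :
  is_derive f x a -> is_derive (fun t => sin (f t)) x (a * cos (f x)).
Proof. intro; apply (is_derive_comp_R sin f); [apply is_derive_sin | assumption]. Qed.

Lemma is_derive_cos_R (f : R -> R) (x a : R) :
  is_derive f x a -> is_derive (fun t => cos (f t)) x (a * - sin (f x)).
Proof. intro; apply (is_derive_comp_R cos f); [apply is_derive_cos | assumption]. Qed.

Ltac eq_R := match goal with |- @eq _ ?a ?b => change (@eq R a b) end.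
Ltac der_side := first [assumption | lra | solve [auto] | idtac].
Ltac der_step :=
  match goal with
  | |- is_derive (fun _ => ?c) _ _ => apply (is_derive_const_R c)
  | |- is_derive (fun t => t) _ _ => apply is_derive_id_R
  | H : is_derive ?f ?x _ |- is_derive ?f ?x _ => exact H
  | H : forall x, is_derive ?f x _ |- is_derive ?f _ _ => apply H
  | H : forall x, _ -> is_derive ?f x _ |- is_derive ?f _ _ => apply H
  | |- is_derive (fun t => @?f t + @?g t) _ _ => eapply (is_derive_plus_R f g)
  | |- is_derive (fun t => @?f t - @?g t) _ _ => eapply (is_derive_minus_R f g)
  | |- is_derive (fun t => - @?f t) _ _ => eapply (is_derive_opp_R f)
  | |- is_derive (fun t => @?f t / @?g t) _ _ => eapply (is_derive_div_R f g)
  | |- is_derive (fun t => @?f t * @?g t) _ _ => eapply (is_derive_mult_R f g)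
  | |- is_derive (fun t => / @?f t) _ _ => eapply (is_derive_inv_R f)
  | |- is_derive (fun t => exp (@?f t)) _ _ => eapply (is_derive_exp_R f)
  | |- is_derive (fun t => sin (@?f t)) _ _ => eapply (is_derive_sin_R f)
  | |- is_derive (fun t => cos (@?f t)) _ _ => eapply (is_derive_cos_R f)
  end.
(* [der] differentiates an expression built from functions whose derivatives
   are in the context, leaving the comparison of derivatives last. *)
Ltac der := eapply is_derive_value; [ repeat der_step; der_side | ].

Lemma continuous_of_derive (f : R -> R) (x a : R) : is_derive f x a -> continuous f x.
Proof. intros H; apply (ex_derive_continuous (V := R_NormedModule)); exists a; exact H. Qed.

Lemma continuous_plus_R (f g : R -> R) (x : R) :
  continuous f x -> continuous g x -> continuous (fun t => f t + g t) x.
Proof. intros; apply (continuous_plus (V := R_NormedModule)); assumption. Qed.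

Lemma continuous_minus_R (f g : R -> R) (x : R) :
  continuous f x -> continuous g x -> continuous (fun t => f t - g t) x.
Proof. intros; apply (continuous_minus (V := R_NormedModule)); assumption. Qed.

Lemma continuous_opp_R (f : R -> R) (x : R) :
  continuous f x -> continuous (fun t => - f t) x.
Proof. intros; apply (continuous_opp (V := R_NormedModule)); assumption. Qed.

Lemma continuous_mult_R (f g : R -> R) (x : R) :
  continuous f x -> continuous g x -> continuous (fun t => f t * g t) x.
Proof. intros; apply (continuous_mult (K := R_AbsRing)); assumption. Qed.

Lemma continuous_inv_R (f : R -> R) (x : R) :
  continuous f x -> f x <> 0 -> continuous (fun t => / f t) x.
Proof. intros; apply continuous_Rinv_comp; assumption. Qed.

Lemma continuous_div_R (f g : R -> R) (x : R) :
  continuous f x -> continuous g x -> g x <> 0 -> continuous (fun t => f t / g t) x.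
Proof. intros; apply continuous_mult_R; auto; apply continuous_inv_R; auto. Qed.

Lemma continuous_sin_R (f : R -> R) (x : R) :
  continuous f x -> continuous (fun t => sin (f t)) x.
Proof. intros; apply continuous_sin_comp; assumption. Qed.

Lemma continuous_cos_R (f : R -> R) (x : R) :
  continuous f x -> continuous (fun t => cos (f t)) x.
Proof. intros; apply continuous_cos_comp; assumption. Qed.

Lemma continuous_sqrt_R (f : R -> R) (x : R) :
  continuous f x -> continuous (fun t => sqrt (f t)) x.
Proof. intros; apply continuous_sqrt_comp; assumption. Qed.

Ltac cont_step :=
  match goal with
  | |- continuous (fun _ => ?c) _ => apply continuous_const
  | |- continuous (fun t => t) _ => apply continuous_id
  | H : continuous ?f ?x |- continuous ?f ?x => exact H
  | H : forall x, continuous ?f x |- continuous ?f _ => apply H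
  | H : forall x, _ -> continuous ?f x |- continuous ?f _ => apply H
  | H : is_derive ?f ?x _ |- continuous ?f ?x => exact (continuous_of_derive f x _ H)
  | H : forall x, is_derive ?f x _ |- continuous ?f _ => eapply continuous_of_derive, H
  | H : forall x, _ -> is_derive ?f x _ |- continuous ?f _ => eapply continuous_of_derive, H
  | |- continuous (fun t => @?f t + @?g t) _ => apply (continuous_plus_R f g)
  | |- continuous (fun t => @?f t - @?g t) _ => apply (continuous_minus_R f g)
  | |- continuous (fun t => - @?f t) _ => apply (continuous_opp_R f)
  | |- continuous (fun t => @?f t / @?g t) _ => apply (continuous_div_R f g)
  | |- continuous (fun t => @?f t * @?g t) _ => apply (continuous_mult_R f g)
  | |- continuous (fun t => / @?f t) _ => apply (continuous_inv_R f)
  | |- continuous (fun t => sin (@?f t)) _ => apply (continuous_sin_R f)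
  | |- continuous (fun t => cos (@?f t)) _ => apply (continuous_cos_R f)
  | |- continuous (fun t => sqrt (@?f t)) _ => apply (continuous_sqrt_R f)
  end.
Ltac cont := repeat cont_step; der_side.

(** * Estimates from derivatives *)

Lemma increasing_of_derive (f df : R -> R) (a b : R) :
  a <= b -> (forall x, a <= x <= b -> is_derive f x (df x)) ->
  (forall x, a <= x <= b -> 0 <= df x) -> f a <= f b.
Proof.
intros ab Hd Hp.
destruct (MVT_gen f a b df) as [c [Hc E]].
- intros x; rewrite Rmin_left, Rmax_right by lra; intros; apply Hd; lra.
- intros x; rewrite Rmin_left, Rmax_right by lra; intros.
  apply continuity_pt_filterlim, (ex_derive_continuous (V := R_NormedModule)).
  exists (df x); apply Hd; lra.
- rewrite Rmin_left, Rmax_right in Hc by lra.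
  assert (0 <= df c * (b - a)) by (apply Rmult_le_pos; [apply Hp|]; lra). lra.
Qed.

Lemma increment_le_of_derive_le (f df g dg : R -> R) (a b : R) :
  a <= b -> (forall x, a <= x <= b -> is_derive f x (df x)) ->
  (forall x, a <= x <= b -> is_derive g x (dg x)) ->
  (forall x, a <= x <= b -> df x <= dg x) -> f b - f a <= g b - g a.
Proof.
intros ab Hf Hg H.
enough (g a - f a <= g b - f b) by lra.
apply (increasing_of_derive (fun x => g x - f x) (fun x => dg x - df x)); auto.
- intros; der; reflexivity.
- intros x Hx; specialize (H x Hx); lra.
Qed.

Lemma increment_bound (f df : R -> R) (a b M : R) :
  a <= b -> (forall x, a <= x <= b -> is_derive f x (df x)) ->
  (forall x, a <= x <= b -> Rabs (df x) <= M) -> Rabs (f b - f a) <= M * (b - a).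
Proof.
intros ab Hf H.
assert (H1 : f b - f a <= M * b - M * a).
{ apply (increment_le_of_derive_le f df (fun x => M * x) (fun _ => M)); auto.
  - intros; der; ring.
  - intros x Hx; specialize (H x Hx); apply Rabs_le_between in H; lra. }
assert (H2 : - M * b - - M * a <= f b - f a).
{ apply (increment_le_of_derive_le (fun x => - M * x) (fun _ => - M) f df); auto.
  - intros; der; ring.
  - intros x Hx; specialize (H x Hx); apply Rabs_le_between in H; lra. }
apply Rabs_le; lra.
Qed.

Lemma exp_le_mono (x y : R) : x <= y -> exp x <= exp y.
Proof. intros [H| ->]; [left; apply exp_increasing; exact H | right; reflexivity]. Qed.

Lemma gronwall (y dy : R -> R) (a b C B : R) :
  0 <= C -> 0 <= B -> a <= b ->
  (forall x, a <= x <= b -> is_derive y x (dy x)) ->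
  (forall x, a <= x <= b -> dy x <= C * y x + B) ->
  y b <= (y a + B * (b - a)) * exp (C * (b - a)).
Proof.
intros HC HB ab Hd H.
assert (E : y b * exp (- C * (b - a)) - y a * exp (- C * (a - a)) <= B * b - B * a).
{ apply (increment_le_of_derive_le (fun x => y x * exp (- C * (x - a)))
      (fun x => (dy x - C * y x) * exp (- C * (x - a))) (fun x => B * x) (fun _ => B)); auto.
  - intros; der; ring.
  - intros; der; ring.
  - intros x Hx; specialize (H x Hx).
    assert (0 < exp (- C * (x - a))) by apply exp_pos.
    assert (exp (- C * (x - a)) <= 1).
    { rewrite <- exp_0; apply exp_le_mono; nra. }
    nra. }
replace (- C * (a - a)) with 0 in E by ring; rewrite exp_0 in E.
assert (P : exp (- C * (b - a)) * exp (C * (b - a)) = 1).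
{ rewrite <- exp_plus, <- exp_0; f_equal; ring. }
assert (0 < exp (C * (b - a))) by apply exp_pos.
replace (y b) with (y b * exp (- C * (b - a)) * exp (C * (b - a)))
  by (rewrite Rmult_assoc, P; ring).
apply Rmult_le_compat_r; lra.
Qed.

Lemma gronwall_zero_right (y dy : R -> R) (a b C : R) :
  a <= b ->
  (forall x, a <= x <= b -> is_derive y x (dy x)) ->
  (forall x, a <= x <= b -> dy x <= C * y x) ->
  y a <= 0 -> y b <= 0.
Proof.
intros ab Hd H Ha.
assert (E : - (y a * exp (- C * a)) <= - (y b * exp (- C * b))).
{ apply (increasing_of_derive (fun x => - (y x * exp (- C * x)))
      (fun x => (C * y x - dy x) * exp (- C * x))); auto.
  - intros; der; ring.
  - intros x Hx; specialize (H x Hx); apply Rmult_le_pos; [lra | left; apply exp_pos]. }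
assert (0 < exp (- C * a)) by apply exp_pos.
assert (0 < exp (- C * b)) by apply exp_pos.
nra.
Qed.

Lemma gronwall_zero_left (y dy : R -> R) (a b C : R) :
  a <= b ->
  (forall x, a <= x <= b -> is_derive y x (dy x)) ->
  (forall x, a <= x <= b -> - C * y x <= dy x) ->
  y b <= 0 -> y a <= 0.
Proof.
intros ab Hd H Hb.
assert (E : (y a * exp (C * a)) <= (y b * exp (C * b))).
{ apply (increasing_of_derive (fun x => (y x * exp (C * x)))
      (fun x => (C * y x + dy x) * exp (C * x))); auto.
  - intros; der; ring.
  - intros x Hx; specialize (H x Hx); apply Rmult_le_pos; [lra | left; apply exp_pos]. }
assert (0 < exp (C * a)) by apply exp_pos.
assert (0 < exp (C * b)) by apply exp_pos.
nra.
Qed.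

Lemma is_derive_primitive (f : R -> R) (a x : R) :
  (forall y, continuous f y) -> is_derive (fun y => RInt f a y) x (f x).
Proof.
intros Hc; apply (is_derive_RInt f (RInt f a) a x); [|apply Hc].
apply filter_forall; intros y; apply (RInt_correct (V := R_CompleteNormedModule)).
apply (ex_RInt_continuous (V := R_CompleteNormedModule) f a y); intros; apply Hc.
Qed.

(** * Functions on a segment *)

Lemma continuous_eps (f : R -> R) (x : R) :
  (forall eps, 0 < eps -> exists alp, 0 < alp /\
     forall y, Rabs (y - x) < alp -> Rabs (f y - f x) < eps) -> continuous f x.
Proof.
intros H; apply continuity_pt_filterlim; intros eps Heps.
destruct (H eps Heps) as [alp [Ha Hy]]; exists alp; split; auto.
intros y [_ Hd]; apply Hy, Hd.
Qed.

Lemma continuous_eps_inv (f : R -> R) (x eps : R) :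
  continuous f x -> 0 < eps -> exists alp, 0 < alp /\
     forall y, Rabs (y - x) < alp -> Rabs (f y - f x) < eps.
Proof.
intros H Heps; apply continuity_pt_filterlim in H.
destruct (H eps Heps) as [alp [Ha Hy]]; exists alp; split; auto.
intros y Hd. destruct (Req_dec x y) as [->|N].
- replace (f y - f y) with 0 by ring; rewrite Rabs_R0; exact Heps.
- apply (Hy y); repeat split; auto.
Qed.

(** [fun t => f (clamp l r t)] continues [f] beyond the segment by its end values. *)
Definition clamp (l r x : R) : R := Rmax l (Rmin x r).

Lemma clamp_in (l r x : R) : l <= r -> l <= clamp l r x <= r.
Proof. intros; unfold clamp, Rmax, Rmin; repeat destruct Rle_dec; lra. Qed.

Lemma clamp_id (l r x : R) : l <= x <= r -> clamp l r x = x.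
Proof. intros; unfold clamp, Rmax, Rmin; repeat destruct Rle_dec; lra. Qed.

Lemma clamp_lipschitz (l r x y : R) : l <= r ->
  Rabs (clamp l r x - clamp l r y) <= Rabs (x - y).
Proof.
intros; unfold clamp, Rmax, Rmin, Rabs.
repeat (destruct Rle_dec); repeat (destruct Rcase_abs); lra.
Qed.

Lemma clamp_continuous (l r x : R) : l <= r -> continuous (clamp l r) x.
Proof.
intros H; apply continuous_eps; intros eps He; exists eps; split; auto.
intros y Hy; eapply Rle_lt_trans; [apply clamp_lipschitz; auto | exact Hy].
Qed.

Lemma continuous_comp_clamp (f : R -> R) (l r x : R) : l <= r ->
  (forall y, l <= y <= r -> continuous f y) -> continuous (fun t => f (clamp l r t)) x.
Proof.
intros H Hf; apply (continuous_comp (clamp l r) f).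
- apply clamp_continuous; auto.
- apply Hf, clamp_in; auto.
Qed.

Lemma continue_in_clamp (f : R -> R) (l r x : R) : l <= r ->
  (forall y, segment l r y -> continue_in f (segment l r) y) ->
  continuous (fun t => f (clamp l r t)) x.
Proof.
intros H Hf; apply continuous_eps; intros eps He.
destruct (Hf (clamp l r x) (clamp_in l r x H) eps He) as [alp [Ha Hy]].
exists alp; split; auto; intros y Hxy.
destruct (Req_dec (clamp l r x) (clamp l r y)) as [E|N].
- rewrite E; replace (f _ - f _) with 0 by ring; rewrite Rabs_R0; exact He.
- apply (Hy (clamp l r y)); repeat split; auto; try apply clamp_in; auto.
  simpl; unfold Rdist. eapply Rle_lt_trans; [apply clamp_lipschitz; auto | exact Hxy].
Qed.

Lemma D_in_interior (f df : R -> R) (l r x : R) :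
  l < x < r -> D_in f df (segment l r) x -> is_derive f x (df x).
Proof.
intros Hx H; apply is_derive_Reals; intros eps He.
destruct (H eps He) as [alp [Ha Hy]].
assert (Hp : 0 < Rmin alp (Rmin (x - l) (r - x))) by (repeat apply Rmin_pos; lra).
exists (mkposreal _ Hp); simpl; intros h Hh Hlt.
assert (A1 := Rmin_l alp (Rmin (x - l) (r - x))).
assert (A2 := Rmin_r alp (Rmin (x - l) (r - x))).
assert (A3 := Rmin_l (x - l) (r - x)). assert (A4 := Rmin_r (x - l) (r - x)).
assert (Hb : - Rmin alp (Rmin (x - l) (r - x)) < h < Rmin alp (Rmin (x - l) (r - x)))
  by (apply Rabs_lt_between; exact Hlt).
specialize (Hy (x + h)). simpl in Hy; unfold Rdist in Hy.
replace (x + h - x) with h in Hy by ring.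
apply Hy; repeat split; unfold segment; try lra.
Qed.

Lemma D_in_continuous (f df : R -> R) (l r x : R) :
  D_in f df (segment l r) x -> continue_in f (segment l r) x.
Proof. apply cont_deriv. Qed.

Lemma is_derive_D_in (f df : R -> R) (D : R -> Prop) (x : R) :
  is_derive f x (df x) -> D_in f df D x.
Proof.
intros H; apply is_derive_Reals, derivable_pt_lim_D_in in H.
intros eps He; destruct (H eps He) as [alp [Ha Hy]]; exists alp; split; auto.
intros y [[Hy1 Hy2] Hy3]; apply Hy; repeat split; auto.
Qed.

(** Removes one-sided derivatives for good: integrating the extended derivative
    gives a function with two-sided derivatives, also at the end points. *)
Lemma derive_extension (f df dg : R -> R) (l r : R) : l < r ->
  (forall y, segment l r y -> D_in f df (segment l r) y) ->
  (forall y, continuous dg y) -> (forall y, l <= y <= r -> dg y = df y) ->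
  exists g, (forall y, is_derive g y (dg y)) /\ (forall y, l <= y <= r -> g y = f y).
Proof.
intros lr Hf Hc E.
exists (fun y => f l + RInt dg l y).
assert (Hd : forall y, is_derive (fun y => f l + RInt dg l y) y (dg y)).
{ intros y; der; [apply is_derive_primitive; auto | ring]. }
split; auto.
intros y Hy.
set (h := fun y => (f l + RInt dg l (clamp l r y)) - f (clamp l r y)).
assert (Hh : h y - h l = 0 * (y - l)).
{ destruct (MVT_gen h l y (fun _ => 0)) as [c [_ Ec]]; [| | exact Ec].
  - intros x; rewrite Rmin_left, Rmax_right by lra; intros Hx.
    apply (is_derive_ext_loc (fun y => (f l + RInt dg l y) - f y)).
    + assert (Hp : 0 < Rmin (x - l) (r - x)) by (apply Rmin_pos; lra).
      exists (mkposreal _ Hp); intros z Hz.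
      assert (A3 := Rmin_l (x - l) (r - x)). assert (A4 := Rmin_r (x - l) (r - x)).
      apply Rabs_lt_between in Hz; simpl in Hz; unfold minus, plus, opp in Hz; simpl in Hz.
      unfold h; rewrite clamp_id; auto; lra.
    + eapply is_derive_value; [apply is_derive_minus_R; [apply Hd|]|].
      * apply (D_in_interior f df l r x); [lra | apply Hf; unfold segment; lra].
      * rewrite E by lra; ring.
  - intros x _; apply continuity_pt_filterlim.
    apply (continuous_minus (V := R_NormedModule)).
    + apply (continuous_comp (clamp l r) (fun y => f l + RInt dg l y)).
      * apply clamp_continuous; lra.
      * eapply continuous_of_derive, Hd.
    + apply continue_in_clamp; [lra|]. intros z Hz; eapply D_in_continuous, Hf, Hz. }
unfold h in Hh; rewrite !clamp_id in Hh by lra.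
assert (RInt dg l l = 0) by exact (RInt_point l dg). lra.
Qed.

Fixpoint C_everywhere (m : nat) (f : R -> R) : Prop :=
  match m with
  | O => forall y, continuous f y
  | S m' => exists df, (forall y, is_derive f y (df y)) /\ C_everywhere m' df
  end.

Lemma C_everywhere_continuous (m : nat) (f : R -> R) :
  C_everywhere m f -> forall y, continuous f y.
Proof.
destruct m; simpl; auto.
intros [df [H _]] y; eapply continuous_of_derive, H.
Qed.

Lemma C_on_extension (l r : R) (m : nat) : l < r -> forall f, C_on l r m f ->
  exists g, C_everywhere m g /\ forall y, l <= y <= r -> g y = f y.
Proof.
intros lr; induction m as [|m IH]; intros f; simpl.
- intros H; exists (fun t => f (clamp l r t)); split.
  + intros y; apply continue_in_clamp; [lra | exact H].
  + intros; rewrite clamp_id; auto.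
- intros [df [Hd Hc]]; destruct (IH df Hc) as [dg [Hg Eg]].
  destruct (derive_extension f df dg l r lr Hd (C_everywhere_continuous m dg Hg) Eg)
    as [g [Hg1 Eg1]].
  exists g; split; auto; exists dg; auto.
Qed.

(** * Bounds for continuous and differentiable functions *)

Lemma bounded_on_segment (f : R -> R) (l r : R) : l <= r ->
  (forall y, l <= y <= r -> continuous f y) ->
  exists M, 0 < M /\ forall y, l <= y <= r -> Rabs (f y) <= M.
Proof.
intros lr Hf.
destruct (continuity_ab_maj (fun y => Rabs (f y)) l r lr) as [x [Hx _]].
- intros c Hc; apply continuity_pt_filterlim.
  apply (continuous_comp f Rabs); [apply Hf; auto | apply continuous_Rabs].
- exists (Rabs (f x) + 1); split.
  + assert (A := Rabs_pos (f x)); lra.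
  + intros y Hy; specialize (Hx y Hy); simpl in Hx; lra.
Qed.

Lemma positive_on_segment (f : R -> R) (l r : R) : l <= r ->
  (forall y, l <= y <= r -> continuous f y) -> (forall y, l <= y <= r -> 0 < f y) ->
  exists m, 0 < m /\ forall y, l <= y <= r -> m <= f y.
Proof.
intros lr Hf Hp.
destruct (continuity_ab_min f l r lr) as [x [Hx Hx2]].
- intros c Hc; apply continuity_pt_filterlim, Hf; auto.
- exists (f x); split; auto.
Qed.

Lemma lipschitz_of_derive (f df : R -> R) (M a b : R) :
  (forall x, is_derive f x (df x)) -> (forall x, Rabs (df x) <= M) ->
  Rabs (f a - f b) <= M * Rabs (a - b).
Proof.
intros Hd Hb; destruct (Rle_dec a b) as [H|H].
- rewrite Rabs_minus_sym, (Rabs_minus_sym a), (Rabs_right (b - a)) by lra.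
  apply (increment_bound f df); auto.
- rewrite (Rabs_right (a - b)) by lra. apply (increment_bound f df); auto; lra.
Qed.

Lemma sin_cos_bounds (x : R) : -1 <= sin x <= 1 /\ -1 <= cos x <= 1 /\ sin x * sin x + cos x * cos x = 1.
Proof.
assert (H := sin2_cos2 x); unfold Rsqr in H.
repeat split; try lra; try apply SIN_bound; apply COS_bound.
Qed.

Lemma sin_cos_lipschitz (a b : R) : Rabs (sin a * cos a - sin b * cos b) <= 1 * Rabs (a - b).
Proof.
apply (lipschitz_of_derive (fun x => sin x * cos x) (fun x => cos x * cos x - sin x * sin x)).
- intros; der; ring.
- intros x; destruct (sin_cos_bounds x) as [_ [_ H]]; apply Rabs_le; nra.
Qed.

Lemma sin_sqr_lipschitz (a b : R) : Rabs (sin a * sin a - sin b * sin b) <= 1 * Rabs (a - b).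
Proof.
apply (lipschitz_of_derive (fun x => sin x * sin x) (fun x => 2 * (sin x * cos x))).
- intros; der; ring.
- intros x; destruct (sin_cos_bounds x) as [_ [_ H]]; apply Rabs_le; split; 
  [assert (0 <= (sin x + cos x) * (sin x + cos x)) by apply Rle_0_sqr|
   assert (0 <= (sin x - cos x) * (sin x - cos x)) by apply Rle_0_sqr]; lra.
Qed.

Lemma is_derive_abs_sqr (x : R) : is_derive (fun t => t * Rabs t) x (2 * Rabs x).
Proof.
destruct (Rtotal_order x 0) as [H|[->|H]].
- apply (is_derive_ext_loc (fun t => - (t * t))).
  + exists (mkposreal (- x) ltac:(lra)); intros y Hy; simpl in Hy.
    apply Rabs_lt_between in Hy; unfold minus, plus, opp in Hy; simpl in Hy.
    eq_R; rewrite Rabs_left by lra; ring.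
  + rewrite Rabs_left by lra; der; ring.
- rewrite Rabs_R0; apply is_derive_Reals; intros eps He; exists (mkposreal eps He); simpl.
  intros h Hh Hl. rewrite !Rplus_0_l, Rabs_R0.
  replace ((h * Rabs h - 0 * 0) / h - 2 * 0) with (Rabs h) by (field; auto).
  rewrite Rabs_Rabsolu; exact Hl.
- apply (is_derive_ext_loc (fun t => t * t)).
  + exists (mkposreal x ltac:(lra)); intros y Hy; simpl in Hy.
    apply Rabs_lt_between in Hy; unfold minus, plus, opp in Hy; simpl in Hy.
    eq_R; rewrite Rabs_right by lra; ring.
  + rewrite Rabs_right by lra; der; ring.
Qed.

(** Gronwall's inequality for [y * y - y * Rabs y], a C^1 multiple of the squared
    negative part of [y]. *)
Lemma nonneg_of_derive_ge (y dy : R -> R) (a b C : R) : 0 <= C -> a <= b ->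
  (forall x, a <= x <= b -> is_derive y x (dy x)) ->
  (forall x, a <= x <= b -> - C * Rabs (y x) <= dy x) -> 0 <= y a -> 0 <= y b.
Proof.
intros HC ab Hd H Ha.
assert (E : y b * y b - y b * Rabs (y b) <= 0).
{ apply (gronwall_zero_right (fun x => y x * y x - y x * Rabs (y x))
    (fun x => (2 * y x - 2 * Rabs (y x)) * dy x) a b (2 * C)); auto.
  - intros x Hx.
    assert (K := is_derive_comp_R (fun t => t * Rabs t) y x _ _ (is_derive_abs_sqr (y x)) (Hd x Hx)).
    eapply is_derive_value; [apply is_derive_minus_R; [der | exact K]|].
    + reflexivity.
    + ring.
  - intros x Hx; specialize (H x Hx); unfold Rabs in *; destruct Rcase_abs; nra.
  - rewrite Rabs_right by lra; lra. }
unfold Rabs in E; destruct Rcase_abs; nra.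
Qed.

(** * Picard iteration *)

Lemma half_pow_pos (n : nat) : 0 < (/ 2) ^ n.
Proof. apply pow_lt; lra. Qed.

Lemma half_pow_small (A eps : R) : 0 < eps -> exists N, forall n, (N <= n)%nat -> A * (/ 2) ^ n < eps.
Proof.
intros He.
assert (Hp : 0 < eps / (Rabs A + 1)) by (apply Rdiv_lt_0_compat; [|assert (P := Rabs_pos A)]; lra).
destruct (pow_lt_1_zero (/ 2)) with (y := eps / (Rabs A + 1)) as [N HN]; auto.
{ rewrite Rabs_right; lra. }
exists N; intros n Hn; specialize (HN n Hn).
assert (P := half_pow_pos n); rewrite Rabs_right in HN by lra.
assert (PA := Rabs_pos A); assert (QA := Rle_abs A).
apply Rmult_lt_compat_l with (r := Rabs A + 1) in HN; [|lra].
replace ((Rabs A + 1) * (eps / (Rabs A + 1))) with eps in HN by (field; lra). nra.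
Qed.

Lemma le_half_pow_zero (a A : R) : (forall n, a <= A * (/ 2) ^ n) -> a <= 0.
Proof.
intros H; apply Rnot_lt_le; intros Ha.
destruct (half_pow_small A a Ha) as [N HN]; specialize (H N); specialize (HN N (Nat.le_refl N)). lra.
Qed.

Lemma geometric_limit (u : nat -> R) (A : R) :
  (forall n, Rabs (u (S n) - u n) <= A * (/ 2) ^ n) ->
  exists v, forall n, Rabs (u n - v) <= 2 * A * (/ 2) ^ n.
Proof.
intros H.
assert (HA : 0 <= A).
{ specialize (H 0%nat); simpl in H; assert (P := Rabs_pos (u 1%nat - u 0%nat)); lra. }
assert (B : forall n p, Rabs (u (n + p)%nat - u n) <= 2 * A * ((/ 2) ^ n - (/ 2) ^ (n + p))).
{ intros n p; induction p as [|p IH].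
  - rewrite Nat.add_0_r; replace (u n - u n) with 0 by ring; rewrite Rabs_R0; lra.
  - rewrite Nat.add_succ_r.
    replace (u (S (n + p)) - u n) with ((u (S (n + p)) - u (n + p)%nat) + (u (n + p)%nat - u n)) by ring.
    eapply Rle_trans; [apply Rabs_triang|].
    specialize (H (n + p)%nat); simpl ((/ 2) ^ S (n + p)); lra. }
assert (B' : forall n p, Rabs (u (n + p)%nat - u n) <= 2 * A * (/ 2) ^ n).
{ intros n p; eapply Rle_trans; [apply B|].
  assert (P := half_pow_pos (n + p)); nra. }
assert (C : Cauchy_crit u).
{ intros eps He; destruct (half_pow_small (2 * (2 * A)) eps He) as [N HN].
  exists N; intros n m Hn Hm; unfold Rdist.
  replace n with (N + (n - N))%nat by lia; replace m with (N + (m - N))%nat by lia.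
  assert (B1 := B' N (n - N)%nat); assert (B2 := B' N (m - N)%nat).
  specialize (HN N (Nat.le_refl N)).
  apply Rabs_le_between in B1; apply Rabs_le_between in B2; apply Rabs_lt_between; lra. }
destruct (Rcomplete.R_complete u C) as [v Hv]; exists v; intros n.
apply Rle_plus_epsilon; intros eps He.
destruct (Hv eps He) as [N HN]; specialize (HN (n + N)%nat ltac:(lia)); unfold Rdist in HN.
assert (B1 := B' n N). apply Rabs_le_between in B1; apply Rabs_lt_between in HN.
apply Rabs_le; lra.
Qed.

Fixpoint picard_iterate (F : R -> R -> R) (l t0 : R) (n : nat) : R -> R :=
  match n with
  | O => fun _ => t0
  | S n' => fun x => t0 + RInt (fun t => F t (picard_iterate F l t0 n' t)) l x
  end.

(** The weight [exp (2 * L * (x - l))] makes the integral operator a contraction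
    of ratio one half on the whole segment.  As [F] is bounded, the iterates share
    the Lipschitz constant [M], which the limit inherits. *)
Lemma ode_solution (F : R -> R -> R) (l r L M t0 : R) : l < r -> 0 <= L -> 0 <= M ->
  (forall f : R -> R, (forall x, continuous f x) -> forall x, continuous (fun t => F t (f t)) x) ->
  (forall x a b, Rabs (F x a - F x b) <= L * Rabs (a - b)) ->
  (forall x a, Rabs (F x a) <= M) ->
  exists f, f l = t0 /\ forall x, l <= x <= r -> is_derive f x (F x (f x)).
Proof.
intros lr HL HM Hc Lip Bd.
set (u := picard_iterate F l t0).
assert (Uc : forall n x, continuous (u n) x).
{ intros n; induction n as [|n IH]; intros x.
  - apply continuous_const.
  - eapply continuous_of_derive with (a := F x (u n x)).
    unfold u; simpl; der; [apply is_derive_primitive; apply Hc; exact IH | ring]. }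
assert (Ud : forall n x, is_derive (u (S n)) x (F x (u n x))).
{ intros n x; unfold u; simpl; der; [apply is_derive_primitive; apply Hc; apply Uc | ring]. }
assert (Ul : forall n, u n l = t0).
{ intros [|n]; [reflexivity|]. unfold u; simpl.
  assert (E : RInt (fun t => F t (picard_iterate F l t0 n t)) l l = 0)
    by exact (RInt_point l _). lra. }
set (K := M * (r - l)).
assert (HK : 0 <= K) by (apply Rmult_le_pos; lra).
assert (Step : forall n x, l <= x <= r ->
  Rabs (u (S n) x - u n x) <= K * (/ 2) ^ n * exp (2 * L * (x - l))).
{ induction n as [|n IH]; intros x Hx.
  - assert (E : Rabs (u 1%nat x - u 1%nat l) <= M * (x - l)).
    { apply (increment_bound (u 1%nat) (fun y => F y (u 0%nat y))); intros; auto; lra. }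
    rewrite Ul in E; unfold u at 2; simpl picard_iterate.
    assert (1 <= exp (2 * L * (x - l))) by (rewrite <- exp_0; apply exp_le_mono; nra).
    assert (M * (x - l) <= K) by (unfold K; nra). simpl; nra.
  - set (g := fun y => K * (/ 2) ^ S n * exp (2 * L * (y - l))).
    set (dg := fun y => L * (K * (/ 2) ^ n * exp (2 * L * (y - l)))).
    set (D := fun y => u (S (S n)) y - u (S n) y).
    set (dD := fun y => F y (u (S n) y) - F y (u n y)).
    assert (HD : forall y, is_derive D y (dD y)) by (intros; unfold D, dD; der; reflexivity).
    assert (Hg : forall y, is_derive g y (dg y)).
    { intros; unfold g, dg; der; simpl; field. }
    assert (HB : forall y, l <= y <= x -> Rabs (dD y) <= dg y).
    { intros y Hy; eapply Rle_trans; [apply Lip|]; unfold dg.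
      apply Rmult_le_compat_l; [lra | apply IH; lra]. }
    assert (D0 : D l = 0) by (unfold D; rewrite !Ul; ring).
    assert (g0 : 0 <= g l).
    { unfold g; assert (P := exp_pos (2 * L * (l - l))); assert (Q := half_pow_pos (S n)).
      apply Rmult_le_pos; [apply Rmult_le_pos|]; lra. }
    assert (A1 : D x - D l <= g x - g l).
    { apply (increment_le_of_derive_le D dD g dg); intros; auto; [lra|].
      specialize (HB x0 H); apply Rabs_le_between in HB; lra. }
    assert (A2 : - D x - - D l <= g x - g l).
    { apply (increment_le_of_derive_le (fun y => - D y) (fun y => - dD y) g dg); intros; auto; [lra| |].
      - der; reflexivity.
      - specialize (HB x0 H); apply Rabs_le_between in HB; lra. }
    apply Rabs_le; fold (D x); fold (g x); lra. }
set (A := K * exp (2 * L * (r - l))).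
assert (Lim : forall x, exists v, l <= x <= r -> forall n, Rabs (u n x - v) <= 2 * A * (/ 2) ^ n).
{ intros x; destruct (Rle_dec l x) as [H1|H1]; [|exists 0; lra].
  destruct (Rle_dec x r) as [H2|H2]; [|exists 0; lra].
  destruct (geometric_limit (fun n => u n x) A) as [v Hv].
  - intros n; eapply Rle_trans; [apply Step; lra|].
    assert (exp (2 * L * (x - l)) <= exp (2 * L * (r - l))) by (apply exp_le_mono; nra).
    assert (P := half_pow_pos n); unfold A. 
    rewrite (Rmult_assoc K (exp _)), (Rmult_comm (exp _)), <- Rmult_assoc.
    apply Rmult_le_compat_l; auto; apply Rmult_le_pos; lra.
  - exists v; auto. }
apply ClassicalChoice.choice in Lim; destruct Lim as [v Hv].
assert (HA : 0 <= A) by (apply Rmult_le_pos; [exact HK | left; apply exp_pos]).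
assert (LipU : forall n x y, l <= x <= r -> l <= y <= r -> Rabs (u n x - u n y) <= M * Rabs (x - y)).
{ assert (W : forall n x y, l <= x -> x <= y -> y <= r -> Rabs (u n y - u n x) <= M * (y - x)).
  { intros [|n] x y H1 H2 H3.
    - unfold u; simpl; replace (t0 - t0) with 0 by ring; rewrite Rabs_R0; nra.
    - apply (increment_bound (u (S n)) (fun z => F z (u n z))); intros; auto. }
  intros n x y Hx Hy; destruct (Rle_dec x y) as [H|H].
  - rewrite Rabs_minus_sym, (Rabs_minus_sym x), (Rabs_right (y - x)) by lra; apply W; lra.
  - rewrite (Rabs_right (x - y)) by lra; apply W; lra. }
assert (LipV : forall x y, l <= x <= r -> l <= y <= r -> Rabs (v x - v y) <= M * Rabs (x - y)).
{ intros x y Hx Hy. enough (Rabs (v x - v y) - M * Rabs (x - y) <= 0) by lra.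
  apply le_half_pow_zero with (A := 4 * A); intros n.
  assert (E1 := Hv x Hx n); assert (E2 := Hv y Hy n); assert (E3 := LipU n x y Hx Hy).
  enough (Rabs (v x - v y) <= M * Rabs (x - y) + 4 * A * (/ 2) ^ n) by lra.
  apply Rabs_le_between in E1; apply Rabs_le_between in E2; apply Rabs_le_between in E3.
  apply Rabs_le; lra. }
set (w := fun x => v (clamp l r x)).
assert (Wc : forall x, continuous w x).
{ intros x; apply continuous_eps; intros eps He.
  exists (eps / (M + 1)); split; [apply Rdiv_lt_0_compat; lra|]; intros y Hy.
  assert (E := LipV (clamp l r y) (clamp l r x) (clamp_in l r y ltac:(lra)) (clamp_in l r x ltac:(lra))).
  assert (E2 := clamp_lipschitz l r y x ltac:(lra)).
  unfold w; eapply Rle_lt_trans; [exact E|].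
  apply Rle_lt_trans with ((M + 1) * Rabs (y - x)).
  - assert (Q := Rabs_pos (clamp l r y - clamp l r x)). nra.
  - apply Rmult_lt_compat_l with (r := M + 1) in Hy; [|lra].
    replace ((M + 1) * (eps / (M + 1))) with eps in Hy by (field; lra). exact Hy. }
set (f := fun x => t0 + RInt (fun t => F t (w t)) l x).
assert (Fd : forall x, is_derive f x (F x (w x))).
{ intros x; unfold f; der; [apply is_derive_primitive; apply Hc; exact Wc | ring]. }
assert (Fl : f l = t0).
{ unfold f. assert (E : RInt (fun t => F t (w t)) l l = 0) by exact (RInt_point l _). lra. }
exists f; split; auto.
intros x Hx; eapply is_derive_value; [apply Fd|]. f_equal.
unfold w; rewrite clamp_id by lra; symmetry.
enough (E : Rabs (f x - v x) <= 0).
{ apply Rminus_diag_uniq; destruct (Req_dec (f x - v x) 0) as [|N]; auto.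
  apply Rabs_pos_lt in N; lra. }
apply le_half_pow_zero with (A := L * (2 * A) * (x - l) + A); intros n.
assert (E1 : Rabs ((f x - u (S n) x) - (f l - u (S n) l)) <= L * (2 * A * (/ 2) ^ n) * (x - l)).
{ apply (increment_bound (fun y => f y - u (S n) y) (fun y => F y (w y) - F y (u n y))); [lra| |].
  - intros; der; reflexivity.
  - intros y Hy; eapply Rle_trans; [apply Lip|]; apply Rmult_le_compat_l; auto.
    unfold w; rewrite clamp_id by lra; rewrite Rabs_minus_sym; apply Hv; lra. }
rewrite Fl, Ul in E1; replace (f x - u (S n) x - (t0 - t0)) with (f x - u (S n) x) in E1 by ring.
assert (E2 := Hv x Hx (S n)); simpl ((/ 2) ^ S n) in E2.
apply Rabs_le_between in E1; apply Rabs_le_between in E2; apply Rabs_le; nra.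
Qed.

(** * Normal form and Pruefer angle *)

(** The problem [u'' = cb u' + (cc - lambda * cm) u] on [[lo, hi]] with
    [bc * u' lo = (k0 - lambda) * u lo], together with the first two derivatives of
    its coefficients.  The derivatives are two-sided up to the end points, and
    [cc_lo] is the compatibility that makes [u'' lo] of the size of [u'] although
    [lambda] multiplies [u lo]. *)
Record normal_form := {
  lo : R; hi : R; bc : R; k0 : R;
  cb : R -> R; cb1 : R -> R; cb2 : R -> R;
  cc : R -> R; cc1 : R -> R; cc2 : R -> R;
  cm : R -> R; cm1 : R -> R; cm2 : R -> R;
  lo_hi : lo < hi;
  bc_pos : 0 < bc;
  k0_nonneg : 0 <= k0;
  cb_derive : forall x, lo <= x <= hi -> is_derive cb x (cb1 x);
  cb1_derive : forall x, lo <= x <= hi -> is_derive cb1 x (cb2 x);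
  cb2_cont : forall x, lo <= x <= hi -> continuous cb2 x;
  cc_derive : forall x, lo <= x <= hi -> is_derive cc x (cc1 x);
  cc1_derive : forall x, lo <= x <= hi -> is_derive cc1 x (cc2 x);
  cc2_cont : forall x, lo <= x <= hi -> continuous cc2 x;
  cm_derive : forall x, lo <= x <= hi -> is_derive cm x (cm1 x);
  cm1_derive : forall x, lo <= x <= hi -> is_derive cm1 x (cm2 x);
  cm2_cont : forall x, lo <= x <= hi -> continuous cm2 x;
  cc_nonneg : forall x, lo <= x <= hi -> 0 <= cc x;
  cm_pos : forall x, lo <= x <= hi -> 0 < cm x;
  cc_lo : cc lo = k0 * cm lo
}.

Definition potential (P : normal_form) (lambda y : R) : R := cc P y - lambda * cm P y.

(** [t] is the Pruefer angle at [hi].  The parameter is written [S ^ 2 - 1]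
    because [S] is the frequency of the solution: [K] bounds [S * u] and [u'] and
    is meant to be the same for all [S >= 1]. *)
Definition shooting_solution (P : normal_form) (K S t : R) (u d : R -> R) : Prop :=
  (forall x, lo P <= x <= hi P -> is_derive u x (d x)) /\
  (forall x, lo P <= x <= hi P -> is_derive d x (cb P x * d x + potential P (S * S - 1) x * u x)) /\
  bc P * d (lo P) = (k0 P - (S * S - 1)) * u (lo P) /\
  0 < u (lo P) /\
  (forall x, lo P <= x <= hi P -> S * Rabs (u x) <= K /\ Rabs (d x) <= K) /\
  exists A, / K <= A /\ S * sqrt (cm P (hi P)) * u (hi P) = A * sin t /\ d (hi P) = A * cos t.

Section Pruefer.
Variable P : normal_form.
Notation l := (lo P).
Notation r := (hi P).

(* [pr_b] and [pr_c] are the coefficients of the bounded part of the equation for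
   the Pruefer angle. *)
Definition root_m (x : R) : R := sqrt (cm P x).
Definition pr_b (x : R) : R := cm1 P x / (2 * cm P x) - cb P x.
Definition pr_c (x : R) : R := (cc P x + cm P x) / root_m x.

Lemma root_m_pos (x : R) : l <= x <= r -> 0 < root_m x.
Proof. intros; apply sqrt_lt_R0, cm_pos; auto. Qed.

Lemma root_m_sqr (x : R) : l <= x <= r -> root_m x * root_m x = cm P x.
Proof. intros; apply sqrt_sqrt; left; apply cm_pos; auto. Qed.

Lemma root_m_derive (x : R) : l <= x <= r ->
  is_derive root_m x (cm1 P x / (2 * root_m x)).
Proof. intros; apply is_derive_sqrt; [apply cm_derive | apply cm_pos]; auto. Qed.

Lemma pr_b_cont (x : R) : l <= x <= r -> continuous pr_b x.
Proof.
intros H; assert (A := cm_pos P x H).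
assert (H1 := cm_derive P x H); assert (H2 := cm1_derive P x H); assert (H3 := cb_derive P x H).
unfold pr_b; cont.
Qed.

Lemma pr_c_cont (x : R) : l <= x <= r -> continuous pr_c x.
Proof.
intros H; assert (A := root_m_pos x H).
assert (H1 := cm_derive P x H); assert (H2 := cc_derive P x H); assert (H3 := root_m_derive x H).
unfold pr_c; cont.
Qed.

Lemma pr_c_pos (x : R) : l <= x <= r -> 0 < pr_c x.
Proof.
intros H; assert (A := root_m_pos x H); assert (B := cm_pos P x H); assert (C := cc_nonneg P x H).
apply Rdiv_lt_0_compat; lra.
Qed.

Lemma pruefer_bounds : exists q0 M, 0 < q0 /\ 1 <= M /\ forall x, l <= x <= r ->
  q0 <= root_m x <= M /\ Rabs (pr_b x) <= M /\ 0 <= pr_c x <= M /\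
  Rabs (cm1 P x / (2 * cm P x)) <= M /\ Rabs (cb P x) <= M.
Proof.
assert (lr := lo_hi P); assert (lr' : l <= r) by lra.
destruct (positive_on_segment root_m l r lr') as [q0 [Hq0 Hq]].
{ intros y Hy; eapply continuous_of_derive, root_m_derive, Hy. }
{ apply root_m_pos. }
destruct (bounded_on_segment root_m l r lr') as [M1 [HM1 H1]].
{ intros y Hy; eapply continuous_of_derive, root_m_derive, Hy. }
destruct (bounded_on_segment pr_b l r lr' pr_b_cont) as [M2 [HM2 H2]].
destruct (bounded_on_segment pr_c l r lr' pr_c_cont) as [M3 [HM3 H3]].
destruct (bounded_on_segment (fun x => cm1 P x / (2 * cm P x)) l r lr') as [M4 [HM4 H4]].
{ intros x H; assert (A := cm_pos P x H).
  assert (A1 := cm_derive P x H); assert (A2 := cm1_derive P x H); cont. }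
destruct (bounded_on_segment (cb P) l r lr') as [M5 [HM5 H5]].
{ intros y Hy; eapply continuous_of_derive, cb_derive, Hy. }
exists q0, (1 + M1 + M2 + M3 + M4 + M5); split; [auto|]; split; [lra|].
intros x Hx.
assert (E1 := H1 x Hx); assert (E2 := H2 x Hx); assert (E3 := H3 x Hx); assert (E4 := H4 x Hx).
assert (E5 := H5 x Hx); assert (E0 := Hq x Hx); assert (E6 := pr_c_pos x Hx).
apply Rabs_le_between in E1; apply Rabs_le_between in E3.
repeat split; lra.
Qed.

(** The derivative of the angle [t] defined by [S * root_m * u = A * sin t] and
    [u' = A * cos t].  The scaling by [root_m] leaves the large parameter only in
    the first term, and in the last one, which is increasing in [S] as
    [pr_c] is positive. *)
Definition angle_rhs (S x t : R) : R :=
  S * root_m x + pr_b x * (sin t * cos t) - pr_c x / S * (sin t * sin t).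

(** The angle in [(0, PI)] whose cotangent satisfies the boundary condition. *)
Definition angle_start (S : R) : R :=
  PI / 2 - atan ((k0 P + 1 - S * S) / (bc P * (S * root_m l))).

Definition is_angle (S : R) (t : R -> R) : Prop :=
  t l = angle_start S /\ forall x, l <= x <= r -> is_derive t x (angle_rhs S x (t x)).

Lemma angle_exists (S : R) : 1 <= S -> exists t, is_angle S t.
Proof.
intros HS; assert (lr := lo_hi P).
destruct pruefer_bounds as [q0 [M [Hq0 [HM B]]]].
set (F := fun x t => angle_rhs S (clamp l r x) t).
assert (HcP : forall x, 0 <= pr_c (clamp l r x) / S <= M).
{ intros x; destruct (B (clamp l r x)) as [_ [_ [B3 _]]]; [apply clamp_in; lra|].
  split; [apply Rdiv_le_0_compat; lra|].
  apply Rle_div_l; [lra|]. nra. }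
destruct (ode_solution F l r (2 * M) (S * M + 2 * M) (angle_start S)) as [t [H1 H2]]; auto; try lra.
- nra.
- intros f Hf x; unfold F, angle_rhs.
  assert (C1 := continuous_comp_clamp root_m l r x ltac:(lra)
    ltac:(intros y Hy; eapply continuous_of_derive, root_m_derive, Hy)).
  assert (C2 := continuous_comp_clamp pr_b l r x ltac:(lra) pr_b_cont).
  assert (C3 := continuous_comp_clamp pr_c l r x ltac:(lra) pr_c_cont).
  cbv beta in *. 
  repeat first [exact C1 | exact C2 | exact C3 | cont_step]. lra.
- intros x a b; unfold F, angle_rhs.
  destruct (B (clamp l r x)) as [_ [B2 _]]; [apply clamp_in; lra|].
  specialize (HcP x).
  assert (E1 := sin_cos_lipschitz a b); assert (E2 := sin_sqr_lipschitz a b).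
  assert (N := Rabs_pos (a - b)).
  set (X := sin a * cos a - sin b * cos b) in *.
  set (Y := sin a * sin a - sin b * sin b) in *.
  replace (_ - _) with (pr_b (clamp l r x) * X - pr_c (clamp l r x) / S * Y) by (unfold X, Y; ring).
  eapply Rle_trans; [apply Rabs_triang|]; rewrite Rabs_Ropp, !Rabs_mult.
  rewrite (Rabs_right (pr_c _ / S)) by lra.
  assert (PX := Rabs_pos X); assert (PY := Rabs_pos Y); assert (PB := Rabs_pos (pr_b (clamp l r x))).
  assert (Rabs (pr_b (clamp l r x)) * Rabs X <= M * Rabs (a - b)) by (apply Rmult_le_compat; lra).
  assert (pr_c (clamp l r x) / S * Rabs Y <= M * Rabs (a - b)) by (apply Rmult_le_compat; lra).
  lra.
- intros x a; unfold F, angle_rhs.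
  destruct (B (clamp l r x)) as [B1 [B2 _]]; [apply clamp_in; lra|].
  specialize (HcP x); apply Rabs_le_between in B2.
  destruct (sin_cos_bounds a) as [S1 [S2 S3]].
  assert (-1 <= sin a * cos a <= 1) by nra.
  assert (0 <= sin a * sin a <= 1) by nra.
  apply Rabs_le; nra.
- exists t; split; auto; intros x Hx.
  eapply is_derive_value; [apply H2; auto|]; unfold F; rewrite clamp_id; auto.
Qed.

Lemma atan_lipschitz (a b : R) : Rabs (atan a - atan b) <= 1 * Rabs (a - b).
Proof.
apply (lipschitz_of_derive atan (fun x => / (1 + x * x))).
- intros x; apply (is_derive_atan x).
- intros x; assert (0 <= x * x) by apply Rle_0_sqr.
  rewrite Rabs_right; [rewrite <- Rinv_1; apply Rinv_le_contravar; lra|].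
  left; apply Rinv_0_lt_compat; lra.
Qed.

Lemma angle_start_range (S : R) : 0 < angle_start S < PI.
Proof.
unfold angle_start; set (a := _ / (bc P * _)); assert (H := atan_bound a).
assert (Hp := PI_RGT_0); lra.
Qed.

(** The cotangent [((k0 + 1) / S - S) / (bc * root_m lo)] of the initial angle is
    decreasing in [S], so the eigenparameter in the boundary condition helps. *)
Lemma angle_start_mono : exists N, 0 <= N /\ forall S1 S2, 1 <= S1 -> S1 <= S2 ->
  0 <= angle_start S2 - angle_start S1 <= N * (S2 - S1).
Proof.
assert (lr := lo_hi P); assert (Hk := k0_nonneg P); assert (Hb := bc_pos P).
assert (Hq := root_m_pos l ltac:(lra)).
assert (Hbq : 0 < bc P * root_m l) by (apply Rmult_lt_0_compat; lra).
exists ((k0 P + 2) / (bc P * root_m l)); split; [apply Rdiv_le_0_compat; lra|].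
intros S1 S2 H1 H12; unfold angle_start.
set (a := fun S => (k0 P + 1 - S * S) / (bc P * (S * root_m l))).
fold (a S1); fold (a S2).
assert (E : a S1 - a S2 = ((k0 P + 1) * ((S2 - S1) / (S1 * S2)) + (S2 - S1)) / (bc P * root_m l)).
{ unfold a; field; repeat split; lra. }
assert (F : 0 <= (S2 - S1) / (S1 * S2) <= S2 - S1).
{ assert (1 <= S1 * S2) by nra. split; [apply Rdiv_le_0_compat; nra|].
  apply Rle_div_l; nra. }
assert (E1 : 0 <= a S1 - a S2 <= (k0 P + 2) / (bc P * root_m l) * (S2 - S1)).
{ rewrite E; split.
  - apply Rdiv_le_0_compat; nra.
  - replace ((k0 P + 2) / (bc P * root_m l) * (S2 - S1))
      with ((k0 P + 2) * (S2 - S1) / (bc P * root_m l)) by (field; lra).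
    apply Rmult_le_compat_r; [left; apply Rinv_0_lt_compat; lra | nra]. }
assert (L := atan_lipschitz (a S1) (a S2)).
rewrite (Rabs_right (a S1 - a S2)) in L by lra; apply Rabs_le_between in L.
split; [|lra].
destruct (Req_dec (a S1) (a S2)) as [->|N]; [lra|].
assert (H := atan_increasing (a S2) (a S1) ltac:(lra)); lra.
Qed.

(** The term with [pr_c / S] contributes a nonnegative amount when [S] grows at
    fixed angle, so only the Lipschitz dependence on the angle has to be paid. *)
Lemma angle_rhs_difference (M S1 S2 x t1 t2 : R) : 1 <= S1 -> S1 <= S2 ->
  Rabs (pr_b x) <= M -> 0 <= pr_c x <= M ->
  let D := angle_rhs S2 x t2 - angle_rhs S1 x t1 in
  root_m x * (S2 - S1) - 2 * M * Rabs (t2 - t1) <= D <=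
    (root_m x + M) * (S2 - S1) + 2 * M * Rabs (t2 - t1).
Proof.
intros H1 H12 Hb Hc D.
assert (E1 := sin_cos_lipschitz t2 t1); assert (E2 := sin_sqr_lipschitz t2 t1).
set (X := sin t2 * cos t2 - sin t1 * cos t1) in *.
set (Y := sin t2 * sin t2 - sin t1 * sin t1) in *.
assert (F : 0 <= / S1 - / S2 <= S2 - S1).
{ replace (/ S1 - / S2) with ((S2 - S1) / (S1 * S2)) by (field; lra).
  assert (1 <= S1 * S2) by nra. split; [apply Rdiv_le_0_compat; nra|].
  apply Rle_div_l; nra. }
assert (S20 : 0 < / S2 <= 1).
{ split; [apply Rinv_0_lt_compat; lra|]; rewrite <- Rinv_1; apply Rinv_le_contravar; lra. }
destruct (sin_cos_bounds t1) as [T1 [T2 T3]].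
assert (ED : D = root_m x * (S2 - S1) + (pr_b x * X - pr_c x * / S2 * Y)
  + pr_c x * (/ S1 - / S2) * (sin t1 * sin t1)) by (unfold D, angle_rhs, X, Y; field; lra).
rewrite ED.
assert (Z : 0 <= pr_c x * (/ S1 - / S2) * (sin t1 * sin t1) <= M * (S2 - S1)).
{ assert (0 <= sin t1 * sin t1 <= 1) by nra.
  assert (0 <= pr_c x * (/ S1 - / S2) <= M * (S2 - S1)).
  { split; [apply Rmult_le_pos; lra | apply Rmult_le_compat; lra]. }
  nra. }
assert (W : Rabs (pr_b x * X - pr_c x * / S2 * Y) <= 2 * M * Rabs (t2 - t1)).
{ eapply Rle_trans; [apply Rabs_triang|]; rewrite Rabs_Ropp, !Rabs_mult.
  rewrite (Rabs_right (pr_c x)), (Rabs_right (/ S2)) by lra.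
  assert (PX := Rabs_pos X); assert (PY := Rabs_pos Y); assert (PB := Rabs_pos (pr_b x)).
  assert (Rabs (pr_b x) * Rabs X <= M * Rabs (t2 - t1)) by (apply Rmult_le_compat; lra).
  assert (0 <= pr_c x * / S2 <= M) by nra.
  assert (pr_c x * / S2 * Rabs Y <= M * Rabs (t2 - t1)) by (apply Rmult_le_compat; lra).
  lra. }
apply Rabs_le_between in W; lra.
Qed.

(** The lower bound gives the simplicity, the separation and the growth of the
    eigenvalues at once.  The difference [w] of two angles satisfies
    [w' >= q0 * (S2 - S1) - 2 * M * Rabs w] and starts nonnegative; it therefore
    stays so, and the inequality becomes linear. *)
Lemma angle_growth : exists c0 Lp, 0 < c0 /\ 0 < Lp /\ forall S1 S2 t1 t2,
  1 <= S1 -> S1 <= S2 -> is_angle S1 t1 -> is_angle S2 t2 ->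
  c0 * (S2 - S1) <= t2 r - t1 r <= Lp * (S2 - S1).
Proof.
assert (lr := lo_hi P).
destruct pruefer_bounds as [q0 [M [Hq0 [HM B]]]].
destruct angle_start_mono as [N [HN A]].
set (E := exp (2 * M * (r - l))). assert (HE : 0 < E) by apply exp_pos.
exists (q0 * (r - l) / E), ((N + 2 * M * (r - l)) * E + 1).
split; [apply Rdiv_lt_0_compat; nra|].
split; [assert (0 <= (N + 2 * M * (r - l)) * E) by (apply Rmult_le_pos; nra); lra|].
intros S1 S2 t1 t2 H1 H12 [I1 D1] [I2 D2].
specialize (A S1 S2 H1 H12); rewrite <- I1, <- I2 in A.
set (w := fun x => t2 x - t1 x).
set (dw := fun x => angle_rhs S2 x (t2 x) - angle_rhs S1 x (t1 x)).
assert (Hw : forall x, l <= x <= r -> is_derive w x (dw x)) by (intros; unfold w, dw; der; reflexivity).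
assert (Bw : forall x, l <= x <= r -> q0 * (S2 - S1) - 2 * M * Rabs (w x) <= dw x <=
  2 * M * (S2 - S1) + 2 * M * Rabs (w x)).
{ intros x Hx; destruct (B x Hx) as [B1 [B2 [B3 _]]].
  assert (G := angle_rhs_difference M S1 S2 x (t1 x) (t2 x) H1 H12 B2 B3).
  fold (w x) in G; fold (dw x) in G; cbv zeta in G. nra. }
assert (Pw : forall x, l <= x <= r -> 0 <= w x).
{ intros x Hx; apply (nonneg_of_derive_ge w dw l x (2 * M)); try lra.
  - intros; apply Hw; lra.
  - intros y Hy; specialize (Bw y ltac:(lra)); nra.
  - unfold w; lra. }
change (t2 r - t1 r) with (w r); split.
- assert (G : q0 * (S2 - S1) * r - q0 * (S2 - S1) * l
    <= w r * exp (2 * M * (r - l)) - w l * exp (2 * M * (l - l))).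
  { apply (increment_le_of_derive_le (fun x => q0 * (S2 - S1) * x) (fun _ => q0 * (S2 - S1))
      (fun x => w x * exp (2 * M * (x - l))) (fun x => (dw x + 2 * M * w x) * exp (2 * M * (x - l)))); try lra.
    - intros; der; ring.
    - intros; der; ring.
    - intros x Hx; specialize (Bw x Hx); specialize (Pw x Hx).
      rewrite (Rabs_right (w x)) in Bw by lra.
      assert (1 <= exp (2 * M * (x - l))) by (rewrite <- exp_0; apply exp_le_mono; nra).
      assert (0 <= q0 * (S2 - S1)) by nra. nra. }
  replace (2 * M * (l - l)) with 0 in G by ring; rewrite exp_0 in G; fold E in G.
  assert (W0 := Pw l ltac:(lra)).
  replace (q0 * (r - l) / E * (S2 - S1)) with ((q0 * (S2 - S1) * r - q0 * (S2 - S1) * l) / E) by (field; lra).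
  apply Rle_div_l; lra.
- assert (G := gronwall w dw l r (2 * M) (2 * M * (S2 - S1))).
  eapply Rle_trans; [apply G; try nra|].
  + auto.
  + intros x Hx; specialize (Bw x Hx); rewrite (Rabs_right (w x)) in Bw; [lra|].
    apply Rle_ge, Pw; auto.
  + fold E. change (w l) with (t2 l - t1 l).
    assert (t2 l - t1 l + 2 * M * (S2 - S1) * (r - l) <= (N + 2 * M * (r - l)) * (S2 - S1)) by lra.
    nra.
Qed.

(** The logarithmic derivative of the amplitude [A]; it is bounded in [S]. *)
Definition log_amplitude_rhs (S x t : R) : R :=
  cm1 P x / (2 * cm P x) * (sin t * sin t) + cb P x * (cos t * cos t)
  + pr_c x / S * (sin t * cos t).

(** The polar coordinates are undone: the angle determines the amplitude by a
    quadrature, and the two determine the solution. *)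
Lemma shooting_of_angle : exists K, 1 <= K /\ forall S t, 1 <= S -> is_angle S t ->
  exists u d, shooting_solution P K S (t r) u d.
Proof.
assert (lr := lo_hi P).
destruct pruefer_bounds as [q0 [M [Hq0 [HM B]]]].
set (E := exp (3 * M * (r - l))).
assert (HE : 1 <= E) by (unfold E; rewrite <- exp_0; apply exp_le_mono; nra).
exists (E + E / q0).
assert (HK : 0 < E / q0) by (apply Rdiv_lt_0_compat; lra).
split; [lra|]; intros S t HS [Ht0 Ht].
set (n := fun x => log_amplitude_rhs S (clamp l r x) (t (clamp l r x))).
assert (Cn : forall x, continuous n x).
{ intros x; unfold n.
  apply (continuous_comp_clamp (fun y => log_amplitude_rhs S y (t y)) l r x); [lra|].
  intros y Hy; unfold log_amplitude_rhs.
  assert (A := cm_pos P y Hy).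
  assert (H1 := cm_derive P y Hy); assert (H2 := cm1_derive P y Hy); assert (H3 := cb_derive P y Hy).
  assert (H4 := pr_c_cont y Hy); assert (H5 := Ht y Hy).
  cont. }
set (A := fun x => exp (RInt n l x)).
assert (DA : forall x, is_derive A x (n x * A x)).
{ intros x; apply (is_derive_exp_R (fun y => RInt n l y)); apply is_derive_primitive; auto. }
assert (Nb : forall x, Rabs (n x) <= 3 * M).
{ intros x; unfold n, log_amplitude_rhs; set (y := clamp l r x).
  assert (Hy : l <= y <= r) by (apply clamp_in; lra).
  destruct (B y Hy) as [B1 [_ [B3 [B4 B5]]]].
  assert (0 <= pr_c y / S <= M).
  { split; [apply Rdiv_le_0_compat; lra|]. apply Rle_div_l; [lra|]; nra. }
  destruct (sin_cos_bounds (t y)) as [S1 [S2 S3]].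
  assert (0 <= sin (t y) * sin (t y) <= 1) by nra.
  assert (0 <= cos (t y) * cos (t y) <= 1) by nra.
  assert (-1 <= sin (t y) * cos (t y) <= 1) by nra.
  apply Rabs_le_between in B4; apply Rabs_le_between in B5; apply Rabs_le; nra. }
assert (Ab : forall x, l <= x <= r -> / E <= A x <= E).
{ intros x Hx.
  assert (L : Rabs (RInt n l x - RInt n l l) <= 3 * M * (x - l)).
  { apply (increment_bound (fun y => RInt n l y) n); [lra| |auto]. intros; apply is_derive_primitive; auto. }
  assert (Z : RInt n l l = 0) by exact (RInt_point l n). rewrite Z in L.
  apply Rabs_le_between in L; unfold A, E; rewrite <- exp_Ropp.
  split; apply exp_le_mono; nra. }
set (u := fun x => A x * sin (t x) / (S * root_m x)).
set (d := fun x => A x * cos (t x)).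
assert (Eq : forall x, l <= x <= r -> n x = log_amplitude_rhs S x (t x)) by
  (intros; unfold n; rewrite clamp_id; auto).
assert (SC : forall x, sin x * sin x = 1 - cos x * cos x) by
  (intros x; destruct (sin_cos_bounds x); lra).
exists u, d; split; [|split; [|split; [|split; [|split]]]].
- intros x Hx; assert (Hq := root_m_pos x Hx); assert (Dq := root_m_derive x Hx).
  assert (HSq : S * root_m x <> 0) by nra.
  unfold u; der.
  rewrite (Eq x Hx); unfold log_amplitude_rhs, angle_rhs, d, pr_b.
  rewrite <- (root_m_sqr x Hx); eq_R.
  apply Rminus_diag_uniq.
  transitivity (A x * cm1 P x / (2 * root_m x * root_m x) * sin (t x)
    * (sin (t x) * sin (t x) + cos (t x) * cos (t x) - 1) / (S * root_m x)); [field; lra|].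
  rewrite SC; field; lra.
- intros x Hx; assert (Hq := root_m_pos x Hx).
  unfold d; der.
  rewrite (Eq x Hx); unfold log_amplitude_rhs, angle_rhs, u, pr_b, potential.
  assert (Ec : cc P x = pr_c x * root_m x - root_m x * root_m x).
  { unfold pr_c; rewrite root_m_sqr by auto; field; lra. }
  rewrite Ec, <- (root_m_sqr x Hx); eq_R.
  apply Rminus_diag_uniq.
  transitivity (A x * (cb P x * cos (t x) + pr_c x / S * sin (t x))
    * (sin (t x) * sin (t x) + cos (t x) * cos (t x) - 1)); [field; lra|].
  rewrite SC; ring.
- unfold d, u; rewrite Ht0; unfold angle_start.
  assert (Hq := root_m_pos l ltac:(lra)); assert (Hb := bc_pos P).
  set (a := (k0 P + 1 - S * S) / (bc P * (S * root_m l))).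
  rewrite sin_shift, cos_shift.
  assert (Hc : 0 < cos (atan a)) by (assert (Ha := atan_bound a); apply cos_gt_0; lra).
  assert (Es : sin (atan a) = a * cos (atan a)).
  { rewrite <- (tan_atan a) at 2; unfold tan; field; lra. }
  rewrite Es; unfold a; field; lra.
- unfold u; assert (Hq := root_m_pos l ltac:(lra)).
  apply Rdiv_lt_0_compat; [|nra]; apply Rmult_lt_0_compat; [apply exp_pos|].
  rewrite Ht0; apply sin_gt_0; apply angle_start_range.
- intros x Hx; specialize (Ab x Hx); destruct (B x Hx) as [[B1 _] _].
  assert (HA : 0 < / E) by (apply Rinv_0_lt_compat; lra).
  destruct (sin_cos_bounds (t x)) as [S1 [S2 _]]; split.
  + unfold u, Rdiv; rewrite !Rabs_mult, (Rabs_right (A x)), Rabs_inv, (Rabs_right (S * root_m x)) by nra.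
    replace (S * (A x * Rabs (sin (t x)) * / (S * root_m x))) with (A x * Rabs (sin (t x)) / root_m x)
      by (field; lra).
    assert (Rabs (sin (t x)) <= 1) by (apply Rabs_le; lra).
    assert (A x * Rabs (sin (t x)) / root_m x <= E / q0); [|lra].
    apply Rmult_le_compat; [apply Rmult_le_pos; [lra | apply Rabs_pos] | left; apply Rinv_0_lt_compat; lra | |].
    * assert (N := Rabs_pos (sin (t x))); nra.
    * apply Rinv_le_contravar; lra.
  + unfold d; rewrite Rabs_mult, (Rabs_right (A x)) by lra.
    assert (Rabs (cos (t x)) <= 1) by (apply Rabs_le; lra).
    assert (N := Rabs_pos (cos (t x))). nra.
- exists (A r); specialize (Ab r ltac:(lra)); assert (Hq := root_m_pos r ltac:(lra)).
  split; [|split].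
  + eapply Rle_trans; [|apply Ab]; apply Rinv_le_contravar; lra.
  + change (sqrt (cm P r)) with (root_m r); unfold u; field; lra.
  + reflexivity.
Qed.

Theorem shooting_family : exists (Theta : R -> R) (c0 Lp K : R),
  0 < c0 /\ 0 < Lp /\ 1 <= K /\
  (forall S1 S2, 1 <= S1 -> S1 <= S2 ->
     c0 * (S2 - S1) <= Theta S2 - Theta S1 <= Lp * (S2 - S1)) /\
  forall S, 1 <= S -> exists u d, shooting_solution P K S (Theta S) u d.
Proof.
destruct angle_growth as [c0 [Lp [H1 [H2 H3]]]].
destruct shooting_of_angle as [K [HK H4]].
assert (Ex : forall S, exists t, 1 <= S -> is_angle S t).
{ intros S; destruct (Rle_dec 1 S) as [H|H].
  - destruct (angle_exists S H) as [t Ht]; exists t; auto.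
  - exists (fun _ => 0); lra. }
apply choice in Ex; destruct Ex as [t Ht].
exists (fun S => t S r), c0, Lp, K; repeat split; auto.
- apply H3; auto; apply Ht; lra.
- apply H3; auto; apply Ht; lra.
Qed.

End Pruefer.

(** * Eigenvalues and the angle *)

Record represents (P : normal_form) (l r rho : R) (mu sigma kappa : R -> R) : Prop := {
  rep_lo : lo P = l;
  rep_hi : hi P = r;
  rep_bc : bc P = rho;
  rep_k0 : k0 P = kappa l;
  rep_sigma : forall x, l <= x <= r -> 0 < sigma x ^ 2;
  rep_b : forall x, l <= x <= r -> cb P x = - 2 * mu x / sigma x ^ 2;
  rep_c : forall x, l <= x <= r -> cc P x = 2 * kappa x / sigma x ^ 2;
  rep_m : forall x, l <= x <= r -> cm P x = 2 / sigma x ^ 2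
}.

Lemma C_everywhere_2 (m : nat) (f : R -> R) : (2 <= m)%nat -> C_everywhere m f ->
  exists f1 f2, (forall x, is_derive f x (f1 x)) /\ (forall x, is_derive f1 x (f2 x)) /\
    forall x, continuous f2 x.
Proof.
destruct m as [|[|m]]; try lia; intros _ [f1 [H1 [f2 [H2 H3]]]].
exists f1, f2; split; [auto|split; [auto|]]; intros x; eapply C_everywhere_continuous, H3.
Qed.

Lemma normal_form_exists (l r rho : R) (mu sigma kappa : R -> R) :
  l < r -> 0 < rho -> C_on l r 3 mu -> C_on l r 4 (fun y => sigma y ^ 2) ->
  (forall y, l <= y <= r -> 0 < sigma y ^ 2) -> C_on l r 2 kappa ->
  (forall y, l <= y <= r -> 0 <= kappa y) ->
  exists P, represents P l r rho mu sigma kappa.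
Proof.
intros lr Hrho Hmu Hs Hsp Hk Hkp.
destruct (C_on_extension l r 3 lr mu Hmu) as [f [Cf Ef]].
destruct (C_on_extension l r 4 lr _ Hs) as [s [Cs Es]].
destruct (C_on_extension l r 2 lr kappa Hk) as [k [Ck Ek]].
destruct (C_everywhere_2 3 f ltac:(lia) Cf) as [f1 [f2 [F1 [F2 F3]]]].
destruct (C_everywhere_2 4 s ltac:(lia) Cs) as [s1 [s2 [S1 [S2 S3]]]].
destruct (C_everywhere_2 2 k ltac:(lia) Ck) as [k1 [k2 [K1 [K2 K3]]]].
assert (Sp : forall x, l <= x <= r -> 0 < s x) by (intros; rewrite Es; auto).
(* quotients by [s], their first and second derivatives *)
set (q1 := fun g g1 : R -> R => fun x => (g1 x * s x - g x * s1 x) / (s x * s x)).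
set (q2 := fun g g1 g2 : R -> R => fun x =>
  ((g2 x * s x - g x * s2 x) * (s x * s x) - (g1 x * s x - g x * s1 x) * (2 * s x * s1 x))
   / ((s x * s x) * (s x * s x))).
assert (Q1 : forall g g1 : R -> R, (forall x, is_derive g x (g1 x)) ->
  forall x, l <= x <= r -> is_derive (fun x => g x / s x) x (q1 g g1 x)).
{ intros g g1 G x Hx; assert (Hp := Sp x Hx); unfold q1; der; field; lra. }
assert (Q2 : forall g g1 g2 : R -> R, (forall x, is_derive g x (g1 x)) ->
  (forall x, is_derive g1 x (g2 x)) ->
  forall x, l <= x <= r -> is_derive (q1 g g1) x (q2 g g1 g2 x)).
{ intros g g1 g2 G1 G2 x Hx; assert (Hp := Sp x Hx); unfold q1, q2; der; [nra|]. field; lra. }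
assert (Q3 : forall g g1 g2 : R -> R, (forall x, is_derive g x (g1 x)) ->
  (forall x, is_derive g1 x (g2 x)) -> (forall x, continuous g2 x) ->
  forall x, l <= x <= r -> continuous (q2 g g1 g2) x).
{ intros g g1 g2 G1 G2 G3 x Hx; assert (Hp := Sp x Hx); unfold q2; cont.
  assert (0 < s x * s x) by nra. nra. }
set (b := fun x => - 2 * f x). set (b1 := fun x => - 2 * f1 x). set (b2 := fun x => - 2 * f2 x).
set (c := fun x => 2 * k x). set (c1 := fun x => 2 * k1 x). set (c2 := fun x => 2 * k2 x).
set (m := fun x : R => 2). set (z := fun x : R => 0).
assert (B1 : forall x, is_derive b x (b1 x)) by (intros; unfold b, b1; der; ring).
assert (B2 : forall x, is_derive b1 x (b2 x)) by (intros; unfold b1, b2; der; ring).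
assert (B3 : forall x, continuous b2 x) by (intros; unfold b2; cont).
assert (C1 : forall x, is_derive c x (c1 x)) by (intros; unfold c, c1; der; ring).
assert (C2 : forall x, is_derive c1 x (c2 x)) by (intros; unfold c1, c2; der; ring).
assert (C3 : forall x, continuous c2 x) by (intros; unfold c2; cont).
assert (M1 : forall x, is_derive m x (z x)) by (intros; unfold m, z; der; ring).
assert (M2 : forall x, is_derive z x (z x)) by (intros; unfold z; der; ring).
assert (M3 : forall x, continuous z x) by (intros; unfold z; cont).
unshelve eexists (Build_normal_form l r rho (kappa l)
  (fun x => b x / s x) (q1 b b1) (q2 b b1 b2)
  (fun x => c x / s x) (q1 c c1) (q2 c c1 c2)
  (fun x => m x / s x) (q1 m z) (q2 m z z) lr Hrho _ _ _ _ _ _ _ _ _ _ _ _ _);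
 simpl; auto.
- apply Hkp; lra.
- intros x Hx; assert (Hp := Sp x Hx); assert (Hq := Hkp x Hx); unfold c; rewrite Ek by auto.
  apply Rdiv_le_0_compat; lra.
- intros x Hx; assert (Hp := Sp x Hx); unfold m; apply Rdiv_lt_0_compat; lra.
- assert (Hp := Sp l ltac:(lra)); unfold c, m; rewrite Ek by lra; field; lra.
- constructor; simpl; auto; intros x Hx; unfold b, c, m; rewrite ?Ek, ?Ef, ?Es by auto; reflexivity.
Qed.

Lemma zero_by_continuity (f : R -> R) (l r : R) : l < r ->
  (forall y, l <= y <= r -> continuous f y) -> (forall y, l < y < r -> f y = 0) ->
  forall y, l <= y <= r -> f y = 0.
Proof.
intros lr Hc H0 y Hy; destruct (Req_dec (f y) 0) as [|N]; auto; exfalso.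
destruct (continuous_eps_inv f y (Rabs (f y)) (Hc y Hy) (Rabs_pos_lt _ N)) as [a [Ha Hz]].
set (s := Rmin 1 (a / (r - l)) / 2).
assert (A1 := Rmin_l 1 (a / (r - l))); assert (A2 := Rmin_r 1 (a / (r - l))).
assert (Ap : 0 < a / (r - l)) by (apply Rdiv_lt_0_compat; lra).
assert (A3 : 0 < Rmin 1 (a / (r - l))) by (apply Rmin_pos; lra).
assert (As : s * (r - l) < a).
{ assert (E : a / (r - l) * (r - l) = a) by (field; lra). unfold s; nra. }
assert (Hs : 0 < s <= 1 / 2) by (unfold s; lra).
specialize (Hz (y + s * ((l + r) / 2 - y))).
rewrite H0 in Hz by nra.
replace (0 - f y) with (- f y) in Hz by ring; rewrite Rabs_Ropp in Hz.
assert (Rabs (f y) < Rabs (f y)); [|lra].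
apply Hz. replace (y + s * ((l + r) / 2 - y) - y) with (s * ((l + r) / 2 - y)) by ring.
apply Rabs_lt_between; nra.
Qed.

(** The equation, given in the interior, passes to the end points by continuity of
    the second derivative. *)
Lemma eigenfunction_extension (P : normal_form) (l r rho : R) (mu sigma kappa : R -> R)
    (lambda : R) (phi : R -> R) :
  represents P l r rho mu sigma kappa -> sl_eigenpair l r rho mu sigma kappa lambda phi ->
  exists f df : R -> R,
   (forall x, l <= x <= r -> is_derive f x (df x)) /\
   (forall x, l <= x <= r ->
      is_derive df x (cb P x * df x + (cc P x - lambda * cm P x) * f x)) /\
   rho * df l = (kappa l - lambda) * f l /\ f r = 0 /\ exists y, l <= y <= r /\ f y <> 0.
Proof.
intros H [[y0 [Hy0 Ny0]] [dphi [ddphi [H1 [H2 [H3 [H4 [H5 H6]]]]]]]].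
assert (lr : l < r) by (rewrite <- (rep_lo _ _ _ _ _ _ _ H), <- (rep_hi _ _ _ _ _ _ _ H); apply lo_hi).
set (dd := fun t => ddphi (clamp l r t)).
assert (Cdd : forall y, continuous dd y) by (intros; apply continue_in_clamp; [lra | exact H3]).
destruct (derive_extension dphi ddphi dd l r lr H2 Cdd) as [df [D1 E1]].
{ intros; unfold dd; rewrite clamp_id; auto. }
destruct (derive_extension phi dphi df l r lr H1) as [f [D0 E0]]; auto.
{ intros; eapply continuous_of_derive, D1. }
assert (Cb : forall y, l <= y <= r -> continuous (cb P) y).
{ intros; eapply continuous_of_derive, cb_derive; rewrite (rep_lo _ _ _ _ _ _ _ H), (rep_hi _ _ _ _ _ _ _ H); auto. }
assert (Cc : forall y, l <= y <= r -> continuous (cc P) y).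
{ intros; eapply continuous_of_derive, cc_derive; rewrite (rep_lo _ _ _ _ _ _ _ H), (rep_hi _ _ _ _ _ _ _ H); auto. }
assert (Cm : forall y, l <= y <= r -> continuous (cm P) y).
{ intros; eapply continuous_of_derive, cm_derive; rewrite (rep_lo _ _ _ _ _ _ _ H), (rep_hi _ _ _ _ _ _ _ H); auto. }
exists f, df; split; [auto|split; [|split; [|split]]].
- intros x Hx; eapply is_derive_value; [apply D1|]; apply Rminus_diag_uniq.
  apply (zero_by_continuity
    (fun x => dd x - (cb P x * df x + (cc P x - lambda * cm P x) * f x)) l r lr); auto.
  + intros y Hy; cont.
  + intros y Hy; specialize (H4 y Hy).
    rewrite (rep_b _ _ _ _ _ _ _ H), (rep_c _ _ _ _ _ _ _ H), (rep_m _ _ _ _ _ _ _ H) by lra.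
    assert (Hp := rep_sigma _ _ _ _ _ _ _ H y ltac:(lra)).
    rewrite E0, E1 by lra; unfold dd; rewrite clamp_id by lra.
    replace (ddphi y) with (2 * (/ 2 * sigma y ^ 2 * ddphi y) / sigma y ^ 2) by (field; intros N; rewrite N in Hp; lra).
    replace (/ 2 * sigma y ^ 2 * ddphi y) with (- lambda * phi y - mu y * dphi y + kappa y * phi y) by lra.
    field; intros N; rewrite N in Hp; lra.
- rewrite E0, E1 by lra; lra.
- rewrite E0 by lra; exact H6.
- exists y0; split; auto; rewrite E0; auto.
Qed.

(** For [lambda <= 0] the function [p * (f * f')], with the integrating factor
    [p], is nondecreasing, nonnegative at [l] by the boundary condition and zero
    at [r].  So [f * f'] vanishes, and [f] is constant, hence zero. *)
Lemma eigenvalue_pos (P : normal_form) (l r rho : R) (mu sigma kappa : R -> R)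
    (lambda : R) (phi : R -> R) :
  represents P l r rho mu sigma kappa -> sl_eigenpair l r rho mu sigma kappa lambda phi ->
  0 < lambda.
Proof.
intros H He; apply Rnot_le_lt; intros Hl.
destruct (eigenfunction_extension _ _ _ _ _ _ _ _ _ H He) as [f [df [D0 [D1 [Bl [Br [y0 [Hy0 Ny0]]]]]]]].
assert (lr : l < r) by (rewrite <- (rep_lo _ _ _ _ _ _ _ H), <- (rep_hi _ _ _ _ _ _ _ H); apply lo_hi).
assert (Hrho : 0 < rho) by (rewrite <- (rep_bc _ _ _ _ _ _ _ H); apply bc_pos).
assert (Hk : 0 <= kappa l) by (rewrite <- (rep_k0 _ _ _ _ _ _ _ H); apply k0_nonneg).
assert (InP : forall x, l <= x <= r -> lo P <= x <= hi P)
  by (intros; rewrite (rep_lo _ _ _ _ _ _ _ H), (rep_hi _ _ _ _ _ _ _ H); auto).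
set (B := fun x => - cb P (clamp l r x)).
assert (CB : forall x, continuous B x).
{ intros x; apply continuous_opp_R, (continuous_comp_clamp (cb P)); [lra|].
  intros; eapply continuous_of_derive, cb_derive; auto. }
set (p := fun x => exp (RInt B l x)).
assert (Dp : forall x, is_derive p x (B x * p x)).
{ intros x; apply (is_derive_exp_R (fun y => RInt B l y)); apply is_derive_primitive; auto. }
set (y := fun x => p x * (f x * df x)).
assert (My : forall a b, l <= a -> a <= b -> b <= r -> y a <= y b).
{ intros a b H1 H2 H3.
  apply (increasing_of_derive y
    (fun x => p x * (df x * df x + (cc P x - lambda * cm P x) * (f x * f x)))); auto.
  - intros x Hx; unfold y; der.
    unfold B; rewrite clamp_id by lra; ring.
  - intros x Hx; assert (Hp : 0 < p x) by apply exp_pos.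
    assert (Hc := cc_nonneg P x (InP x ltac:(lra))); assert (Hm := cm_pos P x (InP x ltac:(lra))).
    assert (0 <= df x * df x) by apply Rle_0_sqr; assert (0 <= f x * f x) by apply Rle_0_sqr.
    assert (0 <= cc P x - lambda * cm P x) by nra.
    apply Rmult_le_pos; [lra|]. nra. }
assert (Y0 : 0 <= y l).
{ unfold y; apply Rmult_le_pos; [left; apply exp_pos|].
  replace (df l) with ((kappa l - lambda) * f l / rho) by (rewrite <- Bl; field; lra).
  replace (f l * ((kappa l - lambda) * f l / rho)) with ((kappa l - lambda) / rho * (f l * f l)) by (field; lra).
  apply Rmult_le_pos; [apply Rdiv_le_0_compat; lra | apply Rle_0_sqr]. }
assert (Y1 : y r = 0) by (unfold y; rewrite Br; ring).
assert (Z : forall x, l <= x <= r -> f x * df x = 0).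
{ intros x Hx; assert (A1 := My l x ltac:(lra) ltac:(lra) ltac:(lra)).
  assert (A2 := My x r ltac:(lra) ltac:(lra) ltac:(lra)).
  assert (A3 : p x * (f x * df x) = 0) by (change (y x = 0); lra).
  assert (0 < p x) by apply exp_pos.
  apply Rmult_integral in A3; destruct A3; lra. }
assert (E : f r * f r - f y0 * f y0 <= 0 * r - 0 * y0).
{ apply (increment_le_of_derive_le (fun x => f x * f x) (fun x => 2 * (f x * df x))
    (fun x => 0 * x) (fun _ => 0)); try lra.
  - intros x Hx; assert (D := D0 x ltac:(lra)); der; ring.
  - intros; der; ring.
  - intros x Hx; rewrite Z; lra. }
assert (E2 : - (f r * f r) - - (f y0 * f y0) <= 0 * r - 0 * y0).
{ apply (increment_le_of_derive_le (fun x => - (f x * f x)) (fun x => - 2 * (f x * df x))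
    (fun x => 0 * x) (fun _ => 0)); try lra.
  - intros x Hx; assert (D := D0 x ltac:(lra)); der; ring.
  - intros; der; ring.
  - intros x Hx; rewrite Z; lra. }
rewrite Br in E, E2. apply Ny0.
assert (f y0 * f y0 = 0) by lra. apply Rmult_integral in H0; destruct H0; auto.
Qed.

(** The Wronskian of the eigenfunction and the shooting solution vanishes at [l]
    by the common boundary condition, hence everywhere; at [r] it shows that the
    shooting solution vanishes, as the eigenfunction has a nonzero slope there. *)
Lemma eigenvalue_shooting_zero (P : normal_form) (l r rho : R) (mu sigma kappa : R -> R)
    (S K t : R) (phi u d : R -> R) :
  represents P l r rho mu sigma kappa -> 0 < K -> shooting_solution P K S t u d ->
  sl_eigenpair l r rho mu sigma kappa (S * S - 1) phi -> sin t = 0.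
Proof.
intros H HK [U1 [U2 [U3 [U4 [_ [A [HA [U5 U6]]]]]]]] He.
destruct (eigenfunction_extension _ _ _ _ _ _ _ _ _ H He) as [f [df [D0 [D1 [Bl [Br [y0 [Hy0 Ny0]]]]]]]].
assert (lr : l < r) by (rewrite <- (rep_lo _ _ _ _ _ _ _ H), <- (rep_hi _ _ _ _ _ _ _ H); apply lo_hi).
assert (Hrho : 0 < rho) by (rewrite <- (rep_bc _ _ _ _ _ _ _ H); apply bc_pos).
assert (cbd := cb_derive P). assert (ccd := cc_derive P). assert (cmd := cm_derive P).
rewrite (rep_lo _ _ _ _ _ _ _ H), (rep_hi _ _ _ _ _ _ _ H) in *.
rewrite (rep_bc _ _ _ _ _ _ _ H), (rep_k0 _ _ _ _ _ _ _ H) in *.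
fold (potential P (S * S - 1)) in *.
destruct (bounded_on_segment (cb P) l r ltac:(lra)) as [M1 [HM1 B1]]; [intros; cont|].
destruct (bounded_on_segment (fun x => potential P (S * S - 1) x) l r ltac:(lra)) as [M2 [HM2 B2]];
  [intros; unfold potential; cont|].
assert (HA0 : 0 < A) by (assert (0 < / K) by (apply Rinv_0_lt_compat; lra); lra).
set (W := fun x => f x * d x - df x * u x).
assert (DW : forall x, l <= x <= r -> is_derive W x (cb P x * W x)).
{ intros x Hx; unfold W; der; unfold potential; ring. }
assert (W0 : W l = 0).
{ unfold W; replace (df l) with ((kappa l - (S * S - 1)) * f l / rho) by (rewrite <- Bl; field; lra).
  replace (d l) with ((kappa l - (S * S - 1)) * u l / rho) by (rewrite <- U3; field; lra). field; lra. }
assert (Wr : W r * W r <= 0).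
{ apply (gronwall_zero_right (fun x => W x * W x) (fun x => 2 * cb P x * (W x * W x)) l r (2 * M1)); try lra.
  - intros x Hx; assert (DWx := DW x Hx); der; ring.
  - intros x Hx; specialize (B1 x Hx); apply Rabs_le_between in B1.
    assert (0 <= W x * W x) by apply Rle_0_sqr. nra.
  - rewrite W0; lra. }
assert (Wr0 : df r * u r = 0).
{ assert (0 <= W r * W r) by apply Rle_0_sqr. assert (E : W r * W r = 0) by lra.
  apply Rmult_integral in E; unfold W in E; rewrite Br in E; destruct E; lra. }
apply Rmult_integral in Wr0; destruct Wr0 as [Z|Z].
- exfalso; apply Ny0.
  assert (E : f y0 * f y0 + df y0 * df y0 <= 0).
  { apply (gronwall_zero_left (fun x => f x * f x + df x * df x)
      (fun x => 2 * (f x * df x) + 2 * df x * (cb P x * df x + potential P (S * S - 1) x * f x))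
      y0 r (1 + M2 + 2 * M1)); try lra.
    - intros x Hx; assert (E0 := D0 x ltac:(lra)); assert (E1 := D1 x ltac:(lra)).
      der; unfold potential; ring.
    - intros x Hx; specialize (B1 x ltac:(lra)); specialize (B2 x ltac:(lra)).
      apply Rabs_le_between in B1; apply Rabs_le_between in B2; simpl in B2.
      assert (0 <= (f x + df x) * (f x + df x)) by apply Rle_0_sqr.
      assert (0 <= (f x - df x) * (f x - df x)) by apply Rle_0_sqr.
      assert (Ff : 0 <= f x * f x) by apply Rle_0_sqr. assert (Fd : 0 <= df x * df x) by apply Rle_0_sqr.
      assert (T1 : - (M1 * (df x * df x)) <= cb P x * (df x * df x)) by nra.
      assert (T2 : - (M2 * (f x * f x + df x * df x)) <= 2 * (potential P (S * S - 1) x * (f x * df x))) by nra.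
      nra.
    - rewrite Br, Z; lra. }
  assert (0 <= f y0 * f y0) by apply Rle_0_sqr; assert (0 <= df y0 * df y0) by apply Rle_0_sqr.
  assert (E2 : f y0 * f y0 = 0) by lra. apply Rmult_integral in E2; destruct E2; auto.
- rewrite Z, Rmult_0_r in U5; symmetry in U5; apply Rmult_integral in U5; destruct U5; lra.
Qed.

Lemma shooting_zero_eigenpair (P : normal_form) (l r rho : R) (mu sigma kappa : R -> R)
    (S K t : R) (u d : R -> R) :
  represents P l r rho mu sigma kappa -> 1 <= S -> shooting_solution P K S t u d ->
  sin t = 0 -> sl_eigenpair l r rho mu sigma kappa (S * S - 1) u.
Proof.
intros H HS [U1 [U2 [U3 [U4 [_ [A [HA [U5 U6]]]]]]]] Ht.
assert (lr : l < r) by (rewrite <- (rep_lo _ _ _ _ _ _ _ H), <- (rep_hi _ _ _ _ _ _ _ H); apply lo_hi).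
assert (cbd := cb_derive P). assert (ccd := cc_derive P). assert (cmd := cm_derive P).
assert (cmp := cm_pos P).
rewrite (rep_lo _ _ _ _ _ _ _ H), (rep_hi _ _ _ _ _ _ _ H) in *.
rewrite (rep_bc _ _ _ _ _ _ _ H), (rep_k0 _ _ _ _ _ _ _ H) in *.
split; [exists l; split; [lra|]; lra|].
exists d, (fun x => cb P x * d x + potential P (S * S - 1) x * u x); repeat split.
- intros y Hy; apply is_derive_D_in, U1, Hy.
- intros y Hy; apply is_derive_D_in, U2, Hy.
- intros y Hy; assert (Hy' : l <= y <= r) by exact Hy.
  assert (C : continuous (fun x => cb P x * d x + potential P (S * S - 1) x * u x) y) by (unfold potential; cont).
  intros eps He; destruct (continuous_eps_inv _ _ _ C He) as [a [Ha Hz]].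
  exists a; split; auto; intros z [_ Hd]; apply Hz, Hd.
- intros y Hy; unfold potential.
  rewrite (rep_b _ _ _ _ _ _ _ H), (rep_c _ _ _ _ _ _ _ H), (rep_m _ _ _ _ _ _ _ H) by lra.
  assert (Hp := rep_sigma _ _ _ _ _ _ _ H y ltac:(lra)).
  field; intros N; rewrite N in Hp; lra.
- lra.
- assert (0 < sqrt (cm P r)) by (apply sqrt_lt_R0, cmp; lra).
  rewrite Ht, Rmult_0_r in U5. apply Rmult_integral in U5; destruct U5; auto; nra.
Qed.

Lemma lipschitz_value (f : R -> R) (Lp a b y : R) : 0 < Lp -> a <= b ->
  (forall s t, a <= s -> s <= t -> Rabs (f t - f s) <= Lp * (t - s)) ->
  f a <= y <= f b -> exists s, a <= s <= b /\ f s = y.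
Proof.
intros HL ab Hf Hy.
set (g := fun s => f (Rmax a s)).
assert (G : forall s t, Rabs (g s - g t) <= Lp * Rabs (s - t)).
{ assert (W : forall s t, s <= t -> Rabs (g t - g s) <= Lp * (t - s)).
  { intros s t Hst; unfold g. assert (R1 := Rmax_l a s).
    assert (R2 : Rmax a s <= Rmax a t <= Rmax a s + (t - s)).
    { unfold Rmax; repeat destruct Rle_dec; lra. }
    eapply Rle_trans; [apply Hf; lra|]. apply Rmult_le_compat_l; lra. }
  intros s t; destruct (Rle_dec s t).
  - rewrite Rabs_minus_sym, (Rabs_minus_sym s), (Rabs_right (t - s)) by lra; auto.
  - rewrite (Rabs_right (s - t)) by lra; apply W; lra. }
assert (C : continuity g).
{ intros x; apply continuity_pt_filterlim, continuous_eps; intros eps He.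
  exists (eps / Lp); split; [apply Rdiv_lt_0_compat; lra|]; intros z Hz.
  eapply Rle_lt_trans; [apply G|].
  apply Rmult_lt_compat_l with (r := Lp) in Hz; auto.
  replace (Lp * (eps / Lp)) with eps in Hz by (field; lra); exact Hz. }
assert (Ga : g a = f a) by (unfold g; rewrite Rmax_left; lra).
assert (Gb : g b = f b) by (unfold g; rewrite Rmax_right; lra).
destruct (IVT_gen g a b y C) as [s [Hs Es]].
{ rewrite Ga, Gb, Rmin_left, Rmax_right; lra. }
rewrite Rmin_left, Rmax_right in Hs by lra.
exists s; split; auto; unfold g in Es; rewrite Rmax_right in Es; lra.
Qed.

(** What is kept of the final Pruefer angle as a function of [S]. *)
Definition bi_lipschitz (Theta : R -> R) (c0 Lp : R) : Prop :=
  forall S1 S2, 1 <= S1 -> S1 <= S2 ->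
     c0 * (S2 - S1) <= Theta S2 - Theta S1 <= Lp * (S2 - S1).

Section BiLipschitz.
Variables (Theta : R -> R) (c0 Lp : R).
Hypothesis Hc0 : 0 < c0.
Hypothesis HLp : 0 < Lp.
Hypothesis HTheta : bi_lipschitz Theta c0 Lp.

Lemma bi_lipschitz_lt (S1 S2 : R) : 1 <= S1 -> 1 <= S2 -> Theta S1 < Theta S2 -> S1 < S2.
Proof.
intros H1 H2 H; apply Rnot_le_lt; intros H12; assert (E := HTheta S2 S1 H2 H12); nra.
Qed.

Lemma bi_lipschitz_mono (S1 S2 : R) : 1 <= S1 -> S1 < S2 -> Theta S1 < Theta S2.
Proof. intros H1 H12; assert (E := HTheta S1 S2 H1 ltac:(lra)); nra. Qed.

Lemma bi_lipschitz_le (S1 S2 : R) : 1 <= S1 -> S1 <= S2 -> Theta S1 <= Theta S2.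
Proof. intros H1 H12; assert (E := HTheta S1 S2 H1 H12); nra. Qed.

Lemma bi_lipschitz_dist (S1 S2 : R) : 1 <= S1 -> 1 <= S2 ->
  c0 * Rabs (S2 - S1) <= Rabs (Theta S2 - Theta S1).
Proof.
intros H1 H2; destruct (Rle_dec S1 S2) as [H|H].
- assert (E := HTheta S1 S2 H1 H); rewrite !Rabs_right; nra.
- assert (E := HTheta S2 S1 H2 ltac:(lra)).
  rewrite (Rabs_minus_sym S2), (Rabs_minus_sym (Theta S2)), !Rabs_right; nra.
Qed.

Lemma bi_lipschitz_onto (y : R) : Theta 1 <= y -> exists S, 1 <= S /\ Theta S = y.
Proof.
intros Hy. set (b := 1 + (y - Theta 1) / c0).
assert (Hb : 1 <= b) by (unfold b; assert (0 <= (y - Theta 1) / c0) by (apply Rdiv_le_0_compat; lra); lra).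
destruct (lipschitz_value Theta Lp 1 b y) as [s [Hs Es]]; auto.
- intros s t H1 H2; assert (E := HTheta s t H1 H2); apply Rabs_le; nra.
- split; auto. assert (E := HTheta 1 b ltac:(lra) Hb).
  replace (c0 * (b - 1)) with (y - Theta 1) in E by (unfold b; field; lra). lra.
- exists s; split; [lra|auto].
Qed.

(** Every multiple of [PI] above [Theta 1] is a value of [Theta], taken once, so
    the increasing enumeration [lam] visits these multiples one after the other.
    The offset [j0] is left open: counting the zeros of the eigenfunctions would
    determine it, but it cancels when two spectra are compared. *)
Lemma enumeration_by_angle (lam : nat -> R) :
  (forall k, (1 <= k)%nat -> lam k < lam (S k)) ->
  (forall x, (exists k, (1 <= k)%nat /\ x = lam k) <->
     (exists s, 1 <= s /\ x = s * s - 1 /\ sin (Theta s) = 0)) ->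
  sin (Theta 1) <> 0 ->
  exists (j0 : Z) (sk : nat -> R), IZR j0 * PI < Theta 1 < (IZR j0 + 1) * PI /\
    forall k, (1 <= k)%nat -> 1 <= sk k /\ lam k = sk k * sk k - 1 /\
      Theta (sk k) = (IZR j0 + INR k) * PI.
Proof.
intros Hinc Hiff H1.
assert (Hpi := PI_RGT_0).
set (j0 := (up (Theta 1 / PI) - 1)%Z).
assert (Hj0 : IZR j0 * PI < Theta 1 < (IZR j0 + 1) * PI).
{ assert (U := archimed (Theta 1 / PI)).
  assert (E : IZR j0 = IZR (up (Theta 1 / PI)) - 1) by (unfold j0; rewrite minus_IZR; lra).
  assert (F : Theta 1 / PI * PI = Theta 1) by (field; lra).
  assert (IZR j0 * PI <= Theta 1 < (IZR j0 + 1) * PI) by nra.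
  split; [|lra]. destruct (Req_dec (IZR j0 * PI) (Theta 1)) as [E1|]; [|lra].
  exfalso; apply H1; apply sin_eq_0_1; exists j0; auto. }
assert (Ex : forall k, exists s, (1 <= k)%nat -> 1 <= s /\ lam k = s * s - 1 /\ sin (Theta s) = 0).
{ intros k; destruct (Nat.le_gt_cases 1 k) as [Hk|Hk]; [|exists 0; lia].
  destruct (proj1 (Hiff (lam k))) as [s Hs]; [exists k; auto|]. exists s; auto. }
apply choice in Ex; destruct Ex as [sk Hsk].
assert (ExN : forall k, exists N : Z, (1 <= k)%nat -> Theta (sk k) = IZR N * PI).
{ intros k; destruct (Nat.le_gt_cases 1 k) as [Hk|Hk]; [|exists 0%Z; lia].
  destruct (Hsk k Hk) as [_ [_ E]]; apply sin_eq_0_0 in E; destruct E as [N EN]; exists N; auto. }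
apply choice in ExN; destruct ExN as [N HN].
assert (Lam_mono : forall i k, (1 <= i)%nat -> (i <= k)%nat -> lam i <= lam k).
{ intros i k Hi Hik; induction Hik as [|k Hik IH]; [lra|].
  specialize (Hinc k ltac:(lia)); lra. }
assert (Smono : forall i k, (1 <= i)%nat -> (1 <= k)%nat -> lam i <= lam k -> sk i <= sk k).
{ intros i k Hi Hk H; destruct (Hsk i Hi) as [A1 [A2 _]]; destruct (Hsk k Hk) as [B1 [B2 _]]. nra. }
assert (Nmono : forall i k, (1 <= i)%nat -> (i <= k)%nat -> (N i <= N k)%Z).
{ intros i k Hi Hik; apply le_IZR.
  assert (A := Smono i k Hi ltac:(lia) (Lam_mono i k Hi Hik)).
  assert (B := HN i Hi); assert (C := HN k ltac:(lia)).
  destruct (Hsk i Hi) as [A1 _].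
  assert (Theta (sk i) <= Theta (sk k)).
  { destruct A as [A|A]; [left; apply bi_lipschitz_mono; auto | rewrite A; lra]. }
  nra. }
assert (Nstrict : forall k, (1 <= k)%nat -> (N k + 1 <= N (S k))%Z).
{ intros k Hk; enough (N k < N (S k))%Z by lia; apply lt_IZR.
  assert (B := HN k Hk); assert (C := HN (S k) ltac:(lia)).
  destruct (Hsk k Hk) as [A1 [A2 _]]; destruct (Hsk (S k) ltac:(lia)) as [B1 [B2 _]].
  specialize (Hinc k Hk). assert (sk k < sk (S k)) by nra.
  assert (T := bi_lipschitz_mono (sk k) (sk (S k)) A1 H). nra. }
assert (Nlow : forall k, (1 <= k)%nat -> (j0 + 1 <= N k)%Z).
{ intros k Hk; enough (j0 < N k)%Z by lia; apply lt_IZR.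
  assert (B := HN k Hk); destruct (Hsk k Hk) as [A1 _].
  assert (Theta 1 <= Theta (sk k)).
  { destruct A1 as [A1|A1]; [left; apply bi_lipschitz_mono; lra | rewrite <- A1; lra]. }
  nra. }
assert (Onto : forall j, (j0 + 1 <= j)%Z -> exists i, (1 <= i)%nat /\ N i = j).
{ intros j Hj; apply IZR_le in Hj; rewrite plus_IZR in Hj.
  destruct (bi_lipschitz_onto (IZR j * PI)) as [s [Hs Es]]; [nra|].
  destruct (proj2 (Hiff (s * s - 1))) as [i [Hi Ei]].
  - exists s; repeat split; auto; apply sin_eq_0_1; exists j; auto.
  - exists i; split; auto.
    destruct (Hsk i Hi) as [A1 [A2 _]].
    assert (E : s = sk i) by (apply Rsqr_inj; [lra|lra|unfold Rsqr; lra]).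
    assert (B := HN i Hi); rewrite <- E, Es in B. apply eq_IZR; nra. }
assert (Val : forall k, (1 <= k)%nat -> N k = (j0 + Z.of_nat k)%Z).
{ intros k Hk; induction Hk as [|k Hk IH].
  - destruct (Onto (j0 + 1)%Z ltac:(lia)) as [i [Hi Ei]].
    assert (A := Nmono 1%nat i ltac:(lia) Hi); assert (B := Nlow 1%nat ltac:(lia)). lia.
  - destruct (Onto (j0 + Z.of_nat k + 1)%Z ltac:(lia)) as [i [Hi Ei]].
    assert (B := Nstrict k Hk).
    destruct (Nat.le_gt_cases i k) as [L|L].
    + assert (A := Nmono i k Hi L); lia.
    + assert (A := Nmono (S k) i ltac:(lia) ltac:(lia)); lia. }
exists j0, sk; split; auto.
intros k Hk; destruct (Hsk k Hk) as [A1 [A2 _]]; repeat split; auto.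
rewrite (HN k Hk), (Val k Hk), plus_IZR, <- INR_IZR_INZ; reflexivity.
Qed.

End BiLipschitz.

Theorem spectrum_by_angle (P : normal_form) (l r rho : R) (mu sigma kappa : R -> R) (lam : nat -> R) :
  represents P l r rho mu sigma kappa -> sl_spectrum l r rho mu sigma kappa lam ->
  exists Theta c0 Lp K (j0 : Z) (sk : nat -> R),
    0 < c0 /\ 0 < Lp /\ 1 <= K /\ bi_lipschitz Theta c0 Lp /\
    (forall S, 1 <= S -> exists u d, shooting_solution P K S (Theta S) u d) /\
    IZR j0 * PI < Theta 1 < (IZR j0 + 1) * PI /\
    forall k, (1 <= k)%nat -> 1 <= sk k /\ lam k = sk k * sk k - 1 /\
      Theta (sk k) = (IZR j0 + INR k) * PI.
Proof.
intros H [Hinc Hiff].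
destruct (shooting_family P) as [Theta [c0 [Lp [K [H1 [H2 [H3 [H4 H5]]]]]]]].
destruct (enumeration_by_angle Theta c0 Lp H1 H2 H4 lam Hinc) as [j0 [sk [A B]]].
- intros x; rewrite <- Hiff; split.
  + intros [phi Hphi]; assert (Hp := eigenvalue_pos _ _ _ _ _ _ _ _ _ H Hphi).
    assert (Hs : 1 <= sqrt (x + 1)) by (rewrite <- sqrt_1 at 1; apply sqrt_le_1; lra).
    assert (E : sqrt (x + 1) * sqrt (x + 1) = x + 1) by (apply sqrt_sqrt; lra).
    exists (sqrt (x + 1)); split; auto; split; [lra|].
    destruct (H5 _ Hs) as [u [d Hu]].
    eapply (eigenvalue_shooting_zero P); [exact H | | exact Hu |]; [lra|].
    replace (sqrt (x + 1) * sqrt (x + 1) - 1) with x by lra; exact Hphi.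
  + intros [s [Hs [-> E]]]; destruct (H5 s Hs) as [u [d Hu]]; exists u.
    eapply shooting_zero_eigenpair; eauto.
- intros E; destruct (H5 1 ltac:(lra)) as [u [d Hu]].
  assert (Hu' := shooting_zero_eigenpair _ _ _ _ _ _ _ _ _ _ _ _ H (Rle_refl 1) Hu E).
  assert (Hp := eigenvalue_pos _ _ _ _ _ _ _ _ _ H Hu'). lra.
- exists Theta, c0, Lp, K, j0, sk; repeat split; auto; try (apply H4; auto); try apply A; try (apply B; auto).
Qed.

(** * The difference scheme as a leapfrog recursion *)

Definition half_kick (P : normal_form) (lambda y h g d : R) : R :=
  d + h / 2 * (cb P y * d + potential P lambda y * g).

(** In Scheme 1 the slope at [lo] for which the first difference quotient, one half
    kick later, satisfies the boundary condition; in Scheme 2 the slope satisfies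
    the boundary condition itself, as the half kick amounts to the factor
    [beta]. *)
Definition start_slope (P : normal_form) (s : scheme) (h lambda : R) : R :=
  match s with
  | Scheme1 => ((k0 P - lambda) / bc P - h / 2 * potential P lambda (lo P)) / (1 + h / 2 * cb P (lo P))
  | Scheme2 => (k0 P - lambda) / bc P
  end.

(** Values and slopes with initial value 1.  The friction [cb] acts in both half
    kicks; the second one is implicit in the new slope and solved for it. *)
Fixpoint leapfrog (P : normal_form) (s : scheme) (x : nat -> R) (lambda : R) (i : nat) : R * R :=
  match i with
  | O => (1, start_slope P s (x 1%nat - x 0%nat) lambda)
  | S j =>
      let g := fst (leapfrog P s x lambda j) in
      let d := snd (leapfrog P s x lambda j) in
      let h := x (S j) - x j in
      let w := half_kick P lambda (x j) h g d in
      let g' := g + h * w in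
      (g', (w + h / 2 * (potential P lambda (x (S j)) * g')) / (1 - h / 2 * cb P (x (S j))))
  end.

Section Leapfrog.
Variables (P : normal_form) (s : scheme) (x : nat -> R) (n : nat) (M h : R).
Hypothesis Hb : forall y, lo P <= y <= hi P -> Rabs (cb P y) <= M.
Hypothesis Hm : forall y, lo P <= y <= hi P -> cm P y <= M.
Hypothesis Hh : M * (1 + bc P) * h <= 1.
Hypothesis Hx0 : x 0%nat = lo P.
Hypothesis Hx : forall i, (i <= S n)%nat -> lo P <= x i <= hi P.
Hypothesis Hstep : forall i, (i <= n)%nat -> 0 < x (S i) - x i <= h.

Notation g lambda i := (fst (leapfrog P s x lambda i)).
Notation d lambda i := (snd (leapfrog P s x lambda i)).
Notation w lambda i := (half_kick P lambda (x i) (x (S i) - x i) (g lambda i) (d lambda i)).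

Lemma small_friction (i j : nat) : (i <= n)%nat -> (j <= S n)%nat ->
  - (1 / 2) <= (x (S i) - x i) / 2 * cb P (x j) <= 1 / 2.
Proof.
intros Hi Hj; assert (A := Hstep i Hi); assert (B := Hb _ (Hx j Hj)).
apply Rabs_le_between in B. assert (R1 := bc_pos P).
assert (M * h <= 1) by nra. nra.
Qed.

Lemma small_friction_lo : - (1 / 2) <= (x 1%nat - x 0%nat) / 2 * cb P (lo P) <= 1 / 2.
Proof. assert (A := small_friction 0 0 ltac:(lia) ltac:(lia)); rewrite <- Hx0; exact A. Qed.

Lemma leapfrog_g (lambda : R) (i : nat) :
  g lambda (S i) = g lambda i + (x (S i) - x i) * w lambda i.
Proof. reflexivity. Qed.

Lemma leapfrog_d (lambda : R) (i : nat) : (i <= n)%nat ->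
  d lambda (S i) = w lambda i + (x (S i) - x i) / 2 *
    (cb P (x (S i)) * d lambda (S i) + potential P lambda (x (S i)) * g lambda (S i)).
Proof.
intros Hi; assert (A := small_friction i (S i) Hi ltac:(lia)).
change (d lambda (S i)) with ((w lambda i + (x (S i) - x i) / 2 *
   (potential P lambda (x (S i)) * g lambda (S i))) / (1 - (x (S i) - x i) / 2 * cb P (x (S i)))).
field; lra.
Qed.

(** In Scheme 1 the half kick that is subtracted works against the decrease of
    [(k0 - lambda) / bc]; it is too small to reverse it. *)
Lemma start_slope_derive (lambda : R) : exists e, 0 < e /\
  is_derive (start_slope P s (x 1%nat - x 0%nat)) lambda (- e).
Proof.
assert (A := Hstep 0%nat ltac:(lia)); assert (R1 := bc_pos P).
destruct s; unfold start_slope, potential.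
- assert (B := small_friction_lo).
  set (e := x 1%nat - x 0%nat) in *.
  assert (Hml := Hm (lo P) ltac:(assert (L := lo_hi P); lra)).
  assert (Hmp := cm_pos P (lo P) ltac:(assert (L := lo_hi P); lra)).
  exists ((/ bc P - e / 2 * cm P (lo P)) / (1 + e / 2 * cb P (lo P))); split.
  + apply Rdiv_lt_0_compat; [|lra].
    assert (E : / bc P * bc P = 1) by (field; lra).
    assert (Q : e / 2 * cm P (lo P) * bc P < 1).
    { assert (cm P (lo P) * e <= M * h) by (apply Rmult_le_compat; lra).
      assert (M * h * bc P <= 1) by nra. nra. }
    apply Rlt_0_minus; apply Rmult_lt_reg_r with (bc P); lra.
  + der; field; lra.
- exists (/ bc P); split; [apply Rinv_0_lt_compat; lra|]. der; field; lra.
Qed.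

Lemma start_slope_half_kick (lambda : R) (mu sigma kappa : R -> R) :
  represents P (lo P) (hi P) (bc P) mu sigma kappa ->
  half_kick P lambda (x 0%nat) (x 1%nat - x 0%nat) 1 (start_slope P s (x 1%nat - x 0%nat) lambda)
    * (bc P * beta s (bc P) mu sigma x) = k0 P - lambda /\ 0 < beta s (bc P) mu sigma x.
Proof.
intros H; assert (R1 := bc_pos P); assert (L := lo_hi P).
assert (B := small_friction_lo).
assert (A := Hstep 0%nat ltac:(lia)).
assert (Hs := rep_sigma _ _ _ _ _ _ _ H (lo P) ltac:(lra)).
destruct s; unfold start_slope, half_kick, beta; rewrite Hx0.
- rewrite Hx0 in B; split; [|lra]; field; lra.
- assert (Eb := rep_b _ _ _ _ _ _ _ H (lo P) ltac:(lra)).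
  assert (Em := rep_m _ _ _ _ _ _ _ H (lo P) ltac:(lra)).
  assert (Mp := cm_pos P (lo P) ltac:(lra)).
  unfold delta_plus; rewrite Hx0.
  assert (E : 1 + (bc P - mu (lo P)) / sigma (lo P) ^ 2 * (x 1%nat - lo P) =
    1 + (x 1%nat - lo P) / 2 * (cb P (lo P)) + bc P * cm P (lo P) / 2 * (x 1%nat - lo P)).
  { rewrite Eb, Em; field; intros N; rewrite N in Hs; lra. }
  rewrite E; rewrite Hx0 in A, B.
  assert (0 < bc P * cm P (lo P) / 2 * (x 1%nat - lo P)) by (repeat apply Rmult_lt_0_compat; lra).
  split; [|apply Rinv_0_lt_compat; lra].
  unfold potential; rewrite cc_lo; field; lra.
Qed.

(** A step multiplies the discrete Wronskian of the solution and its derivative in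
    the eigenparameter by a positive factor and subtracts a positive multiple of
    [m0 * g0 ^ 2 + m1 * g1 ^ 2], in analogy with
    [(p (u v' - u' v))' = - p m u ^ 2] for [v] the derivative of [u]. *)
Lemma leapfrog_wronskian (lambda : R) (i : nat) : (i <= S n)%nat -> exists g' d',
  is_derive (fun t => g t i) lambda g' /\ is_derive (fun t => d t i) lambda d' /\
  g lambda i * d' - g' * d lambda i < 0.
Proof.
induction i as [|i IH]; intros Hi.
- destruct (start_slope_derive lambda) as [e [He De]].
  exists 0, (- e); simpl; split; [apply is_derive_const_R | split; [exact De | lra]].
- destruct (IH ltac:(lia)) as [g' [d' [Dg [Dd V]]]]; clear IH.
  assert (B1 := small_friction i i ltac:(lia) ltac:(lia)).
  assert (B2 := small_friction i (S i) ltac:(lia) ltac:(lia)).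
  assert (A := Hstep i ltac:(lia)).
  assert (Mi := cm_pos P (x i) (Hx i ltac:(lia))).
  assert (Mi1 := cm_pos P (x (S i)) (Hx (S i) ltac:(lia))).
  simpl leapfrog; unfold fst at 1, snd at 1 4; fold (g lambda i) (d lambda i).
  set (gi := fun t => g t i) in *; set (di := fun t => d t i) in *.
  change (g lambda i * d' - g' * d lambda i) with (gi lambda * d' - g' * di lambda) in V.
  set (e := x (S i) - x i) in *.
  set (b0 := cb P (x i)) in *; set (b1 := cb P (x (S i))) in *.
  set (m0 := cm P (x i)) in *; set (m1 := cm P (x (S i))) in *.
  set (W := fun t => di t + e / 2 * (b0 * di t + (cc P (x i) - t * m0) * gi t)).
  set (W' := d' + e / 2 * (b0 * d' + (cc P (x i) - lambda * m0) * g' - m0 * gi lambda)).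
  assert (DW : is_derive W lambda W') by (unfold W, W'; der; ring).
  set (G1 := fun t => gi t + e * W t). set (G1' := g' + e * W').
  assert (DG : is_derive G1 lambda G1') by (unfold G1, G1'; der; ring).
  set (D1 := fun t => (W t + e / 2 * ((cc P (x (S i)) - t * m1) * G1 t)) / (1 - e / 2 * b1)).
  set (D1' := (W' + e / 2 * ((cc P (x (S i)) - lambda * m1) * G1' - m1 * G1 lambda)) / (1 - e / 2 * b1)).
  assert (DD : is_derive D1 lambda D1') by (unfold D1, D1'; der; field; lra).
  exists G1', D1'; split; [exact DG | split; [exact DD|]].
  change (G1 lambda * D1' - G1' * D1 lambda < 0).
  assert (E : G1 lambda * D1' - G1' * D1 lambda =
    ((1 + e / 2 * b0) * (gi lambda * d' - g' * di lambda)
     - e / 2 * (m0 * (gi lambda * gi lambda)) - e / 2 * (m1 * (G1 lambda * G1 lambda)))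
     / (1 - e / 2 * b1)).
  { unfold D1, D1', G1, G1', W, W'; field; lra. }
  rewrite E; apply Rmult_lt_reg_r with (1 - e / 2 * b1); [lra|].
  unfold Rdiv; rewrite Rmult_assoc, Rinv_l, Rmult_1_r, Rmult_0_l by lra.
  assert (0 <= gi lambda * gi lambda) by apply Rle_0_sqr.
  assert (0 <= G1 lambda * G1 lambda) by apply Rle_0_sqr.
  assert (0 <= e / 2 * (m0 * (gi lambda * gi lambda))) by (apply Rmult_le_pos; [lra | apply Rmult_le_pos; lra]).
  assert (0 <= e / 2 * (m1 * (G1 lambda * G1 lambda))) by (apply Rmult_le_pos; [lra | apply Rmult_le_pos; lra]).
  assert ((1 + e / 2 * b0) * (gi lambda * d' - g' * di lambda) < 0) by nra.
  unfold Rdiv in *; lra.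
Qed.

(** At a zero of the last value, the Wronskian reduces to minus the product of its
    derivative and the last slope. *)
Lemma leapfrog_crossing (lambda : R) : g lambda (S n) = 0 ->
  exists g', is_derive (fun t => g t (S n)) lambda g' /\ 0 < g' * d lambda (S n).
Proof.
intros Z; destruct (leapfrog_wronskian lambda (S n) (Nat.le_refl _)) as [g' [d' [D [_ V]]]].
exists g'; split; auto; rewrite Z in V; lra.
Qed.

(** For [lambda <= 0] all forces push outwards. *)
Lemma leapfrog_positive (lambda : R) (mu sigma kappa : R -> R) :
  represents P (lo P) (hi P) (bc P) mu sigma kappa -> lambda <= 0 ->
  forall i, (i <= n)%nat -> 1 <= g lambda i /\ 0 <= w lambda i.
Proof.
intros H Hl; assert (R1 := bc_pos P).
assert (Hpot : forall y, lo P <= y <= hi P -> 0 <= potential P lambda y).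
{ intros y Hy; unfold potential; assert (C := cc_nonneg P y Hy); assert (D := cm_pos P y Hy); nra. }
induction i as [|i IH]; intros Hi.
- split; [simpl; lra|]. destruct (start_slope_half_kick lambda mu sigma kappa H) as [E B].
  simpl leapfrog; unfold fst, snd.
  assert (K := k0_nonneg P).
  assert (0 < bc P * beta s (bc P) mu sigma x) by (apply Rmult_lt_0_compat; lra).
  apply Rmult_le_reg_r with (bc P * beta s (bc P) mu sigma x); auto. rewrite E; lra.
- destruct (IH ltac:(lia)) as [G1 W1].
  assert (A := Hstep i ltac:(lia)).
  assert (A1 := Hstep (S i) ltac:(lia)).
  assert (G2 : 1 <= g lambda (S i)) by (rewrite leapfrog_g; nra).
  split; auto.
  assert (Hp := Hpot _ (Hx (S i) ltac:(lia))).
  assert (B := small_friction i (S i) ltac:(lia) ltac:(lia)).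
  assert (B2 := small_friction (S i) (S i) ltac:(lia) ltac:(lia)).
  assert (D := leapfrog_d lambda i ltac:(lia)).
  assert (Pg : 0 <= potential P lambda (x (S i)) * g lambda (S i)) by (apply Rmult_le_pos; lra).
  assert (D2 : 0 <= d lambda (S i)).
  { set (q := potential P lambda (x (S i)) * g lambda (S i)) in *.
    assert (E : d lambda (S i) * (1 - (x (S i) - x i) / 2 * cb P (x (S i))) =
      w lambda i + (x (S i) - x i) / 2 * q) by lra.
    assert (0 <= (x (S i) - x i) / 2 * q) by (apply Rmult_le_pos; lra).
    apply Rmult_le_reg_r with (1 - (x (S i) - x i) / 2 * cb P (x (S i))); lra. }
  unfold half_kick at 1.
  set (q := potential P lambda (x (S i)) * g lambda (S i)) in *.
  assert (0 <= (x (S (S i)) - x (S i)) / 2 * q) by (apply Rmult_le_pos; lra).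
  assert (0 <= d lambda (S i) * (1 + (x (S (S i)) - x (S i)) / 2 * cb P (x (S i)))) by (apply Rmult_le_pos; lra).
  lra.
Qed.

Lemma leapfrog_last_positive (lambda : R) (mu sigma kappa : R -> R) :
  represents P (lo P) (hi P) (bc P) mu sigma kappa -> lambda <= 0 -> 0 < g lambda (S n).
Proof.
intros H Hl; destruct (leapfrog_positive lambda mu sigma kappa H Hl n (Nat.le_refl _)) as [A B].
rewrite leapfrog_g; assert (C := Hstep n (Nat.le_refl _)); nra.
Qed.

Lemma leapfrog_nabla_plus (lambda : R) (i : nat) : (i <= n)%nat ->
  nabla_plus x (fun j => g lambda j) i = w lambda i.
Proof.
intros Hi; assert (A := Hstep i Hi); unfold nabla_plus, delta_plus.
rewrite leapfrog_g; field; lra.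
Qed.

Lemma leapfrog_nabla (lambda : R) (i : nat) : (i < n)%nat ->
  nabla x (fun j => g lambda j) (S i) = d lambda (S i).
Proof.
intros Hi; assert (A := Hstep i ltac:(lia)); assert (A2 := Hstep (S i) ltac:(lia)).
unfold nabla; rewrite leapfrog_nabla_plus by lia.
change (nabla_minus x (fun j => g lambda j) (S i)) with (nabla_plus x (fun j => g lambda j) i).
rewrite leapfrog_nabla_plus by lia.
assert (D := leapfrog_d lambda i ltac:(lia)).
unfold half_kick at 1; unfold delta, delta_plus, delta_minus; simpl pred.
replace (w lambda i) with (d lambda (S i) - (x (S i) - x i) / 2 *
    (cb P (x (S i)) * d lambda (S i) + potential P lambda (x (S i)) * g lambda (S i))) by lra.
field; lra.
Qed.

Lemma leapfrog_Laplace (lambda : R) (i : nat) : (i < n)%nat ->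
  Laplace x (fun j => g lambda j) (S i) =
    cb P (x (S i)) * d lambda (S i) + potential P lambda (x (S i)) * g lambda (S i).
Proof.
intros Hi; assert (A := Hstep i ltac:(lia)); assert (A2 := Hstep (S i) ltac:(lia)).
unfold Laplace; rewrite leapfrog_nabla_plus by lia.
change (nabla_minus x (fun j => g lambda j) (S i)) with (nabla_plus x (fun j => g lambda j) i).
rewrite leapfrog_nabla_plus by lia.
assert (D := leapfrog_d lambda i ltac:(lia)).
unfold half_kick at 1; unfold delta, delta_plus, delta_minus; simpl pred.
replace (w lambda i) with (d lambda (S i) - (x (S i) - x i) / 2 *
    (cb P (x (S i)) * d lambda (S i) + potential P lambda (x (S i)) * g lambda (S i))) by lra.
field; lra.
Qed.

(** The weights in [nabla] are those for which the two half kicks cancel, so that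
    [nabla] returns the slope and [Laplace] the force of the recursion; at the
    left end point [beta] has been absorbed in [start_slope]. *)
Lemma leapfrog_G (lambda : R) (mu sigma kappa : R -> R) (i : nat) :
  represents P (lo P) (hi P) (bc P) mu sigma kappa -> (i <= n)%nat ->
  G s (bc P) mu sigma kappa x (fun j => g lambda j) i = - lambda * g lambda i.
Proof.
intros H Hi; destruct i as [|i].
- simpl G; rewrite leapfrog_nabla_plus by lia.
  destruct (start_slope_half_kick lambda mu sigma kappa H) as [E B].
  simpl leapfrog; unfold fst, snd.
  replace (kappa (x 0%nat)) with (k0 P) by (rewrite Hx0; apply (rep_k0 _ _ _ _ _ _ _ H)).
  rewrite (Rmult_comm (bc P * _)), E; ring.
- unfold G; rewrite leapfrog_nabla, leapfrog_Laplace by lia.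
  assert (Hs := rep_sigma _ _ _ _ _ _ _ H _ (Hx (S i) ltac:(lia))); unfold potential.
  rewrite (rep_b _ _ _ _ _ _ _ H _ (Hx (S i) ltac:(lia))), (rep_c _ _ _ _ _ _ _ H _ (Hx (S i) ltac:(lia))),
   (rep_m _ _ _ _ _ _ _ H _ (Hx (S i) ltac:(lia))).
  field; intros N; rewrite N in Hs; lra.
Qed.

(** The scheme determines each difference quotient from the previous one, since the
    coefficient of [nabla_plus] is positive for small steps.  So eigenvectors are
    multiples of the recursion. *)
Lemma discrete_eigenvalue_iff (lambda : R) (mu sigma kappa : R -> R) :
  represents P (lo P) (hi P) (bc P) mu sigma kappa ->
  (exists f, discrete_eigenpair s (bc P) mu sigma kappa n x lambda f) <-> g lambda (S n) = 0.
Proof.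
intros H; split.
- intros [f [[i0 [Hi0 Ni0]] [HG Hr]]].
  assert (Key : forall i, (i <= n)%nat -> f i = f 0%nat * g lambda i /\
    nabla_plus x f i = f 0%nat * nabla_plus x (fun j => g lambda j) i).
  { induction i as [|i IH]; intros Hi.
    - split; [simpl; ring|].
      assert (E1 := HG 0%nat Hi); assert (E2 := leapfrog_G lambda mu sigma kappa 0 H Hi).
      unfold G in E1, E2; destruct (start_slope_half_kick lambda mu sigma kappa H) as [_ B].
      assert (R1 := bc_pos P).
      change (g lambda 0%nat) with 1 in E2.
      apply Rmult_eq_reg_l with (bc P * beta s (bc P) mu sigma x);
        [|apply Rmult_integral_contrapositive; lra].
      transitivity (f 0%nat * (bc P * beta s (bc P) mu sigma x * nabla_plus x (fun j => g lambda j) 0));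
        [|ring].
      replace (bc P * beta s (bc P) mu sigma x * nabla_plus x (fun j => g lambda j) 0)
        with (- lambda * 1 + kappa (x 0%nat) * 1) by lra. lra.
    - destruct (IH ltac:(lia)) as [F1 F2].
      assert (A := Hstep i ltac:(lia)); assert (A2 := Hstep (S i) ltac:(lia)).
      assert (Fs : f (S i) = f 0%nat * g lambda (S i)).
      { unfold nabla_plus, delta_plus in F2.
        assert (Q : f (S i) - f i = f 0%nat * (g lambda (S i) - g lambda i)).
        { apply Rmult_eq_reg_r with (/ (x (S i) - x i)); [|apply Rinv_neq_0_compat; lra].
          unfold Rdiv in F2; rewrite F2; ring. }
        rewrite F1 in Q; lra. }
      split; auto.
      assert (E1 := HG (S i) Hi); assert (E2 := leapfrog_G lambda mu sigma kappa (S i) H Hi).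
      unfold G, nabla, Laplace in E1, E2.
      change (nabla_minus x f (S i)) with (nabla_plus x f i) in E1.
      change (nabla_minus x (fun j => g lambda j) (S i)) with (nabla_plus x (fun j => g lambda j) i) in E2.
      rewrite F2, Fs in E1.
      set (X := nabla_plus x f (S i)) in *.
      set (Y := nabla_plus x (fun j => g lambda j) (S i)) in *.
      set (Z := nabla_plus x (fun j => g lambda j) i) in *.
      assert (Hs := rep_sigma _ _ _ _ _ _ _ H _ (Hx (S i) ltac:(lia))).
      assert (Bb := small_friction i (S i) ltac:(lia) ltac:(lia)).
      assert (Eb := rep_b _ _ _ _ _ _ _ H _ (Hx (S i) ltac:(lia))).
      set (dm := delta_minus x (S i)) in *; set (dp := delta_plus x (S i)) in *.
      set (dd := delta x (S i)) in *.
      assert (Hdm : dm = x (S i) - x i) by reflexivity.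
      assert (Hdd : 0 < dd) by (unfold dd, delta, delta_plus, delta_minus; simpl pred; lra).
      set (q := sigma (x (S i)) ^ 2) in *.
      assert (Emu : mu (x (S i)) = - cb P (x (S i)) * q / 2) by (rewrite Eb; field; lra).
      rewrite Emu in E1, E2.
      assert (F : (X - f 0%nat * Y) * (q / (2 * dd) * (1 - dm / 2 * cb P (x (S i)))) = 0).
      { apply (f_equal (fun t => f 0%nat * t)) in E2.
        transitivity ((- cb P (x (S i)) * q / 2 * (dm / (2 * dd) * X + dp / (2 * dd) * (f 0%nat * Z))
          + / 2 * q * (/ dd * (X - f 0%nat * Z)) - kappa (x (S i)) * (f 0%nat * g lambda (S i))) -
          f 0%nat * (- cb P (x (S i)) * q / 2 * (dm / (2 * dd) * Y + dp / (2 * dd) * Z)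
          + / 2 * q * (/ dd * (Y - Z)) - kappa (x (S i)) * g lambda (S i))); [field; lra|].
        rewrite E1, E2; ring. }
      apply Rmult_integral in F; destruct F as [F|F]; [lra|exfalso].
      rewrite Hdm in F.
      assert (0 < q / (2 * dd) * (1 - (x (S i) - x i) / 2 * cb P (x (S i)))); [|lra].
      apply Rmult_lt_0_compat; [apply Rdiv_lt_0_compat|]; lra. }
  assert (Last : f (S n) = f 0%nat * g lambda (S n)).
  { destruct (Key n (Nat.le_refl _)) as [F1 F2]; assert (A := Hstep n (Nat.le_refl _)).
    unfold nabla_plus, delta_plus in F2.
    assert (Q : f (S n) - f n = f 0%nat * (g lambda (S n) - g lambda n)).
    { apply Rmult_eq_reg_r with (/ (x (S n) - x n)); [|apply Rinv_neq_0_compat; lra].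
      unfold Rdiv in F2; rewrite F2; ring. }
    rewrite F1 in Q; lra. }
  rewrite Last in Hr; apply Rmult_integral in Hr; destruct Hr as [Z|Z]; auto.
  exfalso; apply Ni0; destruct (Nat.le_gt_cases i0 n) as [L|L].
  + rewrite (proj1 (Key i0 L)), Z; ring.
  + replace i0 with (S n) by lia; rewrite Last, Z; ring.
- intros Z; exists (fun j => g lambda j); split; [|split].
  + exists 0%nat; split; [lia|]; simpl; lra.
  + intros i Hi; apply leapfrog_G; auto.
  + exact Z.
Qed.

End Leapfrog.

(** * Convergence of the recursion *)

Lemma Rabs_plus_le (a b A B : R) : Rabs a <= A -> Rabs b <= B -> Rabs (a + b) <= A + B.
Proof. intros; eapply Rle_trans; [apply Rabs_triang | lra]. Qed.

Lemma Rabs_minus_le (a b A B : R) : Rabs a <= A -> Rabs b <= B -> Rabs (a - b) <= A + B.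
Proof. intros; apply Rabs_plus_le; [|rewrite Rabs_Ropp]; assumption. Qed.

Lemma Rabs_mult_le (a b A B : R) : Rabs a <= A -> Rabs b <= B -> Rabs (a * b) <= A * B.
Proof. intros; rewrite Rabs_mult; apply Rmult_le_compat; auto; apply Rabs_pos. Qed.

Lemma Rabs_nonneg_le (a : R) : 0 <= a -> Rabs a <= a.
Proof. intros; rewrite Rabs_right; lra. Qed.

(* [abs_step] estimates an expression term by term from the bounds on its atoms
   in the context. *)
Ltac abs_step :=
  first [ eassumption
        | match goal with
          | |- Rabs (_ + _) <= _ => apply Rabs_plus_le
          | |- Rabs (_ - _) <= _ => apply Rabs_minus_le
          | |- Rabs (_ * _) <= _ => apply Rabs_mult_le
          end ].
Lemma one_le_mult (a b : R) : 1 <= a -> 1 <= b -> 1 <= a * b.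
Proof. intros; nra. Qed.

Lemma le_sqr_le_cube (a : R) : 1 <= a -> a <= a * a <= a * a * a.
Proof. intros; nra. Qed.

Lemma cube_small (S h : R) : 1 <= S -> 0 < h -> S * S * S * (h * h) <= 1 ->
  S * h <= 1 /\ S * S * S * (h * (h * h)) <= h /\ S * S * S * (h * (h * h)) <= S * h.
Proof.
intros HS Hh HSh.
assert (Sh : S * h <= 1).
{ apply Rnot_lt_le; intros A. assert (1 < (S * h) * (S * h)) by nra. nra. }
assert (PSh : 0 < S * h) by nra.
split; auto; split.
- replace (S * S * S * (h * (h * h))) with (S * S * S * (h * h) * h) by ring; nra.
- replace (S * S * S * (h * (h * h))) with ((S * h) * ((S * h) * (S * h))) by ring; nra.
Qed.

Definition energy (S m g d : R) : R := sqrt (S * S * m * (g * g) + d * d).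

Lemma energy_sqr (S m g d : R) : 0 <= m ->
  energy S m g d * energy S m g d = S * S * m * (g * g) + d * d.
Proof.
intros; apply sqrt_sqrt.
assert (0 <= S * S) by apply Rle_0_sqr; assert (0 <= g * g) by apply Rle_0_sqr.
assert (0 <= d * d) by apply Rle_0_sqr.
assert (0 <= S * S * m * (g * g)) by (apply Rmult_le_pos; [apply Rmult_le_pos|]; auto). lra.
Qed.

Lemma Rabs_le_of_sqr (a b : R) : 0 <= b -> a * a <= b * b -> Rabs a <= b.
Proof.
intros Hb H; apply Rsqr_le_abs_0 in H; rewrite (Rabs_right b) in H; lra.
Qed.

Lemma energy_d (S m g d : R) : 0 <= m -> Rabs d <= energy S m g d.
Proof.
intros Hm; apply Rabs_le_of_sqr; [apply sqrt_pos|]; rewrite energy_sqr by auto.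
assert (0 <= S * S) by apply Rle_0_sqr; assert (0 <= g * g) by apply Rle_0_sqr.
assert (0 <= S * S * m * (g * g)) by (apply Rmult_le_pos; [apply Rmult_le_pos|]; auto). lra.
Qed.

Lemma energy_g (k S m g d : R) : 0 <= k -> 1 <= k * k * m -> 0 <= m ->
  Rabs (S * g) <= k * energy S m g d.
Proof.
intros Hk Hkm Hm; apply Rabs_le_of_sqr; [apply Rmult_le_pos; auto; apply sqrt_pos|].
replace (k * energy S m g d * (k * energy S m g d)) with (k * k * (energy S m g d * energy S m g d)) by ring.
rewrite energy_sqr by auto.
assert (0 <= (S * g) * (S * g)) by apply Rle_0_sqr. assert (0 <= d * d) by apply Rle_0_sqr.
assert (0 <= k * k) by apply Rle_0_sqr.
replace (k * k * (S * S * m * (g * g) + d * d)) with (k * k * m * ((S * g) * (S * g)) + k * k * (d * d)) by ring.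
assert (0 <= k * k * (d * d)) by (apply Rmult_le_pos; lra). nra.
Qed.

(** With constant coefficients and without friction a leapfrog step conserves the
    energy with [m] replaced by [m - (S * h * m / 2) ^ 2]; over a step the
    correction varies by a relative amount [(S h) ^ 3], which is at most [h].  Friction,
    potential and the variation of [m] change the energy by a relative amount
    [O(h)].  The perturbations [t1] and [t2] are to be the local errors, and the
    solution of the perturbed recursion the global error. *)
Lemma energy_step (M k S h b b' c c' m m' g g' d d' t1 t2 : R) :
  1 <= M -> 1 <= k -> 1 <= k * k * m -> 1 <= k * k * m' -> 0 <= m <= M -> 0 <= m' <= M ->
  Rabs b <= M -> Rabs b' <= M -> Rabs c <= M -> Rabs c' <= M -> Rabs (m' - m) <= M * h ->
  1 <= S -> 0 < h -> S * S * S * (h * h) <= 1 ->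
  let f := b * d + (c - (S * S - 1) * m) * g in
  let f' := b' * d' + (c' - (S * S - 1) * m') * g' in
  g' = g + h * (d + h / 2 * f + t1) -> d' = d + h / 2 * (f + f') + t2 ->
  energy S m' g' d' - energy S m g d <= 8 * M * M * M * k * k *
    (h * (energy S m g d + energy S m' g' d') + (S * h * Rabs t1 + Rabs t2)).
Proof.
intros HM Hk Hkm Hkm' Hm Hm' Hb Hb' Hc Hc' Hdm HS Hh HSh f f' Eg Ed.
set (N := energy S m g d). set (N' := energy S m' g' d').
assert (PN : 0 <= N) by apply sqrt_pos. assert (PN' : 0 <= N') by apply sqrt_pos.
set (Z := k * (N + N')).
assert (PZ : 0 <= Z) by (apply Rmult_le_pos; lra).
set (a := S * g). set (a' := S * g').
assert (Ba : Rabs a <= k * N) by (apply energy_g; lra).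
assert (Ba' : Rabs a' <= k * N') by (apply energy_g; lra).
assert (Bd0 : Rabs d <= N) by (apply energy_d; lra).
assert (Bd0' : Rabs d' <= N') by (apply energy_d; lra).
assert (Haa : Rabs (a + a') <= Z) by (eapply Rle_trans; [apply Rabs_plus_le; eassumption | unfold Z; lra]).
assert (Hdd : Rabs (d + d') <= Z) by (eapply Rle_trans; [apply Rabs_plus_le; eassumption | unfold Z; nra]).
assert (Za : Rabs a <= Z) by (unfold Z; nra). assert (Za' : Rabs a' <= Z) by (unfold Z; nra).
assert (Zd : Rabs d <= Z) by (unfold Z; nra). assert (Zd' : Rabs d' <= Z) by (unfold Z; nra).
clear Ba Ba' Bd0 Bd0'.
assert (Zg : Rabs g <= Z).
{ eapply Rle_trans; [|exact Za]; unfold a; rewrite Rabs_mult, (Rabs_right S) by lra.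
  assert (Q := Rabs_pos g); nra. }
assert (Zg' : Rabs g' <= Z).
{ eapply Rle_trans; [|exact Za']; unfold a'; rewrite Rabs_mult, (Rabs_right S) by lra.
  assert (Q := Rabs_pos g'); nra. }
assert (BS : Rabs S <= S) by (apply Rabs_nonneg_le; lra).
assert (Bh : Rabs h <= h) by (apply Rabs_nonneg_le; lra).
assert (Bm : Rabs m <= M) by (rewrite Rabs_right; lra).
assert (Bm' : Rabs m' <= M) by (rewrite Rabs_right; lra).
destruct (cube_small S h HS Hh HSh) as [Sh [S3 S3']].
assert (PSh : 0 < S * h) by (apply Rmult_lt_0_compat; lra).
assert (MZ : 0 <= M * Z) by (apply Rmult_le_pos; lra).
set (w := d + h / 2 * f + t1) in *.
set (r := b * d + b' * d' + (c + m) * g + (c' + m') * g' - S * (m' - m) * a').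
set (r' := b * d - b' * d' + (c + m) * g - (c' + m') * g' + S * (m' - m) * a').
assert (Br : Rabs r <= 7 * (M * Z)).
{ unfold r; eapply Rle_trans; [repeat abs_step|]. 
  assert (S * (M * h) * Z <= M * Z) by (replace (S * (M * h) * Z) with (M * Z * (S * h)) by ring; rewrite <- (Rmult_1_r (M * Z)) at 2; apply Rmult_le_compat_l; lra). lra. }
assert (Br' : Rabs r' <= 7 * (M * Z)).
{ unfold r'; eapply Rle_trans; [repeat abs_step|]. 
  assert (S * (M * h) * Z <= M * Z) by (replace (S * (M * h) * Z) with (M * Z * (S * h)) by ring; rewrite <- (Rmult_1_r (M * Z)) at 2; apply Rmult_le_compat_l; lra). lra. }
assert (Bf : Rabs f <= 4 * (S * (M * Z))).
{ replace f with (b * d + (c + m) * g - S * m * a) by (unfold f, a; ring).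
  eapply Rle_trans; [repeat abs_step|].
  assert (1 * (M * Z) <= S * (M * Z)) by (apply Rmult_le_compat_r; lra). lra. }
assert (Bh2 : Rabs (h / 2) <= h / 2) by (apply Rabs_nonneg_le; lra).
assert (Bt1 := Rle_refl (Rabs t1)). assert (Bt2 := Rle_refl (Rabs t2)).
assert (Pt1 := Rabs_pos t1). assert (Pt2 := Rabs_pos t2).
assert (Bw : Rabs w <= 3 * (M * Z) + Rabs t1).
{ unfold w; eapply Rle_trans; [repeat abs_step|]. 
  replace (h / 2 * (4 * (S * (M * Z)))) with (2 * (S * h * (M * Z))) by field.
  assert (S * h * (M * Z) <= 1 * (M * Z)) by (apply Rmult_le_compat_r; lra).
  assert (1 * Z <= M * Z) by (apply Rmult_le_compat_r; lra). lra. }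
assert (E : N' * N' - N * N = (m' - m) * (a' * a')
  + S * m * h * (a + a') * (h / 2 * / 2 * (S * S * m * h * w + r') + (t1 - t2 * / 2))
  + (d + d') * (h / 2 * r + t2)).
{ unfold N, N'; rewrite !energy_sqr by lra.
  assert (Ew : w = (d + d') * / 2 + h / 2 * / 2 * (S * S * m * h * w + r') + (t1 - t2 * / 2)).
  { replace (S * S * m * h * w) with (S * S * m * (g' - g)) by (rewrite Eg; ring).
    transitivity ((d + (d + h / 2 * (f + f') + t2)) * / 2 + h / 2 * / 2 * (f - f') + (t1 - t2 * / 2)).
    - unfold w; field.
    - rewrite <- Ed; unfold f, f', r', a'; field. }
  replace ((d + d') * (h / 2 * r + t2)) with
    ((d + d') * ((d + h / 2 * (f + f') + t2) - d) + (d + d') * (h / 2) * (S * m * (a + a')))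
    by (unfold f, f', r, a, a'; field).
  rewrite <- Ed.
  replace (S * S * m' * (g' * g') + d' * d' - (S * S * m * (g * g) + d * d)) with
    ((m' - m) * (a' * a') + S * m * (a + a') * (g' - g) + (d + d') * (d' - d)) by (unfold a, a'; ring).
  replace (g' - g) with (h * w) by (rewrite Eg; ring).
  rewrite Ew at 1; field. }
assert (T1 : Rabs ((m' - m) * (a' * a')) <= M * h * (Z * Z)) by (repeat abs_step).
assert (Bi2 : Rabs (/ 2) <= / 2) by (apply Rabs_nonneg_le; lra).
assert (T2 : Rabs (S * m * h * (a + a') * (h / 2 * / 2 * (S * S * m * h * w + r') + (t1 - t2 * / 2)))
   <= h * (M * M * M + 2 * (M * M)) * (Z * Z) + (M * M + M) * Z * (S * h * Rabs t1 + Rabs t2)).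
{ eapply Rle_trans; [repeat abs_step|].
  replace (S * M * h * Z * (h / 2 * / 2 * (S * S * M * h * (3 * (M * Z) + Rabs t1) + 7 * (M * Z)) + (Rabs t1 + Rabs t2 * / 2)))
    with (3 / 4 * (M * M * M) * (Z * Z) * (S * S * S * (h * (h * h)))
       + / 4 * (M * M) * Z * Rabs t1 * (S * S * S * (h * (h * h)))
       + 7 / 4 * (M * M) * (Z * Z) * h * (S * h)
       + M * Z * (S * h * Rabs t1) + M * Z * / 2 * Rabs t2 * (S * h)) by field.
  assert (A1 : 0 <= M * M * M * (Z * Z)) by (repeat apply Rmult_le_pos; lra).
  assert (A2 : 0 <= M * M * Z * Rabs t1) by (repeat apply Rmult_le_pos; lra).
  assert (A3 : 0 <= M * M * (Z * Z) * h) by (repeat apply Rmult_le_pos; lra).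
  assert (A4 : 0 <= M * Z * Rabs t2) by (repeat apply Rmult_le_pos; lra).
  assert (A5 : 0 <= M * M * Z * Rabs t2) by (repeat apply Rmult_le_pos; lra).
  assert (C1 := Rmult_le_compat_l _ _ _ A1 S3).
  assert (C2 := Rmult_le_compat_l _ _ _ A2 S3').
  assert (C3 := Rmult_le_compat_l _ _ _ A3 Sh).
  assert (C4 := Rmult_le_compat_l _ _ _ A4 Sh).
  assert (0 <= M * M * M * (Z * Z) * h) by (apply Rmult_le_pos; lra).
  assert (0 <= M * M * Z * Rabs t1 * (S * h)) by (apply Rmult_le_pos; lra).
  lra. }
assert (T3 : Rabs ((d + d') * (h / 2 * r + t2)) <= 4 * M * h * (Z * Z) + Z * Rabs t2).
{ eapply Rle_trans; [repeat abs_step|]. 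
  assert (0 <= M * h * (Z * Z)) by (repeat apply Rmult_le_pos; lra). lra. }
apply Rabs_le_between in T1; apply Rabs_le_between in T2; apply Rabs_le_between in T3.
set (T := S * h * Rabs t1 + Rabs t2) in *.
assert (PT1 : 0 <= S * h * Rabs t1) by (apply Rmult_le_pos; lra).
assert (PT : 0 <= T) by (unfold T; lra).
assert (TT : Rabs t2 <= T) by (unfold T; lra).
assert (Tot : N' * N' - N * N <= 8 * M * M * M * (h * (Z * Z)) + 3 * M * M * (Z * T)).
{ rewrite E.
  assert (P1 : 0 <= h * (Z * Z)) by (repeat apply Rmult_le_pos; lra).
  assert (P2 : 0 <= Z * T) by (apply Rmult_le_pos; lra).
  assert (P3 : Z * Rabs t2 <= Z * T) by (apply Rmult_le_compat_l; lra).
  destruct (le_sqr_le_cube M HM) as [M2 M3].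
  assert (L1 : (M + (M * M * M + 2 * (M * M)) + 4 * M) * (h * (Z * Z)) <= 8 * M * M * M * (h * (Z * Z)))
    by (apply Rmult_le_compat_r; lra).
  assert (L2 : (M * M + M + 1) * (Z * T) <= 3 * M * M * (Z * T)) by (apply Rmult_le_compat_r; lra).
  lra. }
destruct (Req_dec (N + N') 0) as [Z0|Z0].
{ assert (N = 0) by lra. assert (N' = 0) by lra. rewrite H, H0.
  rewrite Rminus_0_r, Rplus_0_r, Rmult_0_r, Rplus_0_l.
  repeat apply Rmult_le_pos; lra. }
apply Rmult_le_reg_r with (N + N'); [lra|].
replace ((N' - N) * (N + N')) with (N' * N' - N * N) by ring.
eapply Rle_trans; [exact Tot|].
replace (8 * M * M * M * (h * (Z * Z)) + 3 * M * M * (Z * T)) with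
  (8 * M * M * M * k * k * (h * (N + N')) * (N + N') + 3 * M * M * k * T * (N + N')) by (unfold Z; ring).
assert (L : 3 * M * M * k <= 8 * M * M * M * k * k).
{ destruct (le_sqr_le_cube M HM) as [M2 M3].
  assert (A1 : 3 * M * M <= 8 * M * M * M) by lra.
  assert (A2 : k <= k * k) by (apply (le_sqr_le_cube k Hk)).
  replace (8 * M * M * M * k * k) with (8 * M * M * M * (k * k)) by ring.
  apply Rmult_le_compat; try lra; repeat apply Rmult_le_pos; lra. }
assert (P4 : 0 <= T * (N + N')) by (apply Rmult_le_pos; lra).
assert (3 * M * M * k * (T * (N + N')) <= 8 * M * M * M * k * k * (T * (N + N'))) by (apply Rmult_le_compat_r; lra).
lra.
Qed.

Lemma discrete_gronwall (N x : nat -> R) (A B : R) (n : nat) : 0 <= A -> 0 <= B ->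
  (forall i, 0 <= N i) ->
  (forall i, (i <= n)%nat -> 0 <= x (S i) - x i /\ A * (x (S i) - x i) <= 1 / 2) ->
  (forall i, (i <= n)%nat -> N (S i) - N i <=
     A * (x (S i) - x i) * (N i + N (S i)) + B * (x (S i) - x i)) ->
  forall i, (i <= S n)%nat ->
    N i <= exp (3 * A * (x i - x 0%nat)) * (N 0%nat + 2 * B * (x i - x 0%nat)) /\ x 0%nat <= x i.
Proof.
intros HA HB HN Hx Hs; induction i as [|i IH]; intros Hi.
- replace (3 * A * (x 0%nat - x 0%nat)) with 0 by ring; rewrite exp_0; lra.
- destruct (IH ltac:(lia)) as [I1 I2]; clear IH.
  destruct (Hx i ltac:(lia)) as [X1 X2]; specialize (Hs i ltac:(lia)).
  split; [|lra].
  set (y := A * (x (S i) - x i)) in *.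
  assert (Hy : 0 <= y) by (apply Rmult_le_pos; lra).
  assert (E1 : 1 + y <= exp y) by apply exp_ineq1_le.
  assert (E2 : 1 + 2 * y <= exp (2 * y)) by apply exp_ineq1_le.
  assert (E3 : exp y * exp (2 * y) = exp (3 * y)) by (rewrite <- exp_plus; f_equal; ring).
  assert (Ni := HN i). assert (Ni' := HN (S i)).
  set (Bx := B * (x (S i) - x i)) in *.
  assert (HBx : 0 <= Bx) by (apply Rmult_le_pos; lra).
  assert (U : N (S i) <= (1 + 2 * y) * ((1 + y) * N i + Bx)).
  { assert (V : (1 - y) * N (S i) <= (1 + y) * N i + Bx) by lra.
    assert (W : 1 <= (1 + 2 * y) * (1 - y)) by nra.
    assert (V2 : (1 + 2 * y) * ((1 - y) * N (S i)) <= (1 + 2 * y) * ((1 + y) * N i + Bx))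
      by (apply Rmult_le_compat_l; lra). nra. }
  assert (U2 : N (S i) <= exp (3 * y) * N i + 2 * Bx).
  { rewrite <- E3. assert ((1 + 2 * y) * (1 + y) <= exp y * exp (2 * y)) by nra. nra. }
  replace (3 * A * (x (S i) - x 0%nat)) with (3 * y + 3 * A * (x i - x 0%nat)) by (unfold y; ring).
  rewrite exp_plus.
  assert (F : 1 <= exp (3 * y)) by (rewrite <- exp_0; apply exp_le_mono; lra).
  assert (F2 : 1 <= exp (3 * A * (x i - x 0%nat))).
  { rewrite <- exp_0; apply exp_le_mono; apply Rmult_le_pos; lra. }
  replace (2 * B * (x (S i) - x 0%nat)) with (2 * Bx + 2 * B * (x i - x 0%nat)) by (unfold Bx; ring).
  set (Q := N 0%nat + 2 * B * (x i - x 0%nat)) in *.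
  set (e1 := exp (3 * y)) in *. set (e2 := exp (3 * A * (x i - x 0%nat))) in *.
  assert (G1 : e1 * N i <= e1 * (e2 * Q)) by (apply Rmult_le_compat_l; lra).
  assert (G2 : 1 * (2 * Bx) <= e1 * e2 * (2 * Bx)) by (apply Rmult_le_compat_r; [lra | nra]).
  replace (N 0%nat + (2 * Bx + 2 * B * (x i - x 0%nat))) with (Q + 2 * Bx) by (unfold Q; ring).
  lra.
Qed.

(* [d' = f] along an exact solution [u], [d = u'].  The drift has a Taylor
   remainder, the two half kicks that of the trapezoidal rule. *)
Lemma drift_residual (u d f f1 : R -> R) (a b F : R) : a <= b ->
  (forall x, a <= x <= b -> is_derive u x (d x)) ->
  (forall x, a <= x <= b -> is_derive d x (f x)) ->
  (forall x, a <= x <= b -> is_derive f x (f1 x)) ->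
  (forall x, a <= x <= b -> Rabs (f1 x) <= F) ->
  Rabs (u b - u a - (b - a) * (d a + (b - a) / 2 * f a)) <= F * (b - a) * (b - a) * (b - a).
Proof.
intros ab Du Dd Df HF.
assert (F0 : 0 <= F) by (specialize (HF a ltac:(lra)); assert (Q := Rabs_pos (f1 a)); lra).
assert (A1 : forall x, a <= x <= b -> Rabs (f x - f a) <= F * (b - a)).
{ intros x Hx; apply Rle_trans with (F * (x - a)); [|nra].
  apply (increment_bound f f1); [lra| |]; intros; [apply Df | apply HF]; lra. }
assert (A2 : forall x, a <= x <= b -> Rabs (d x - d a - (x - a) * f a) <= F * (b - a) * (b - a)).
{ intros x Hx; apply Rle_trans with (F * (b - a) * (x - a)).
  - replace (d x - d a - (x - a) * f a) with ((d x - x * f a) - (d a - a * f a)) by ring.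
    apply (increment_bound (fun x => d x - x * f a) (fun x => f x - f a)); [lra| |].
    + intros y Hy; assert (D := Dd y ltac:(lra)); der; ring.
    + intros; apply A1; lra.
  - apply Rmult_le_compat_l; [apply Rmult_le_pos|]; lra. }
replace (u b - u a - (b - a) * (d a + (b - a) / 2 * f a)) with
  ((u b - b * d a - (b - a) * (b - a) * (f a / 2)) - (u a - a * d a - (a - a) * (a - a) * (f a / 2))) by field.
apply (increment_bound (fun x => u x - x * d a - (x - a) * (x - a) * (f a / 2))
   (fun x => d x - d a - (x - a) * f a)); auto.
intros y Hy; assert (D := Du y ltac:(lra)); der; field.
Qed.

Lemma kick_residual (d f f1 f2 : R -> R) (a b F : R) : a <= b ->
  (forall x, a <= x <= b -> is_derive d x (f x)) ->
  (forall x, a <= x <= b -> is_derive f x (f1 x)) ->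
  (forall x, a <= x <= b -> is_derive f1 x (f2 x)) ->
  (forall x, a <= x <= b -> Rabs (f2 x) <= F) ->
  Rabs (d b - d a - (b - a) / 2 * (f a + f b)) <= F * (b - a) * (b - a) * (b - a).
Proof.
intros ab Dd Df Df1 HF.
assert (F0 : 0 <= F) by (specialize (HF a ltac:(lra)); assert (Q := Rabs_pos (f2 a)); lra).
assert (A2 : forall x, a <= x <= b -> Rabs ((f x - f a) / 2 - (x - a) / 2 * f1 x) <= F * (b - a) * (b - a)).
{ intros x Hx; apply Rle_trans with (F * (b - a) * (x - a)).
  - replace ((f x - f a) / 2 - (x - a) / 2 * f1 x) with
     (((f x - f a) / 2 - (x - a) / 2 * f1 x) - ((f a - f a) / 2 - (a - a) / 2 * f1 a)) by field.
    apply (increment_bound (fun x => (f x - f a) / 2 - (x - a) / 2 * f1 x) (fun x => - (x - a) / 2 * f2 x)); [lra| |].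
    + intros y Hy; assert (D1 := Df y ltac:(lra)); assert (D2 := Df1 y ltac:(lra)); der; field.
    + intros y Hy; specialize (HF y ltac:(lra)).
      rewrite Rmult_comm; apply Rabs_mult_le; auto; apply Rabs_le; lra.
  - apply Rmult_le_compat_l; [apply Rmult_le_pos|]; lra. }
replace (d b - d a - (b - a) / 2 * (f a + f b)) with
  ((d b - (b - a) / 2 * (f a + f b)) - (d a - (a - a) / 2 * (f a + f a))) by field.
apply (increment_bound (fun x => d x - (x - a) / 2 * (f a + f x))
   (fun x => (f x - f a) / 2 - (x - a) / 2 * f1 x)); auto.
intros y Hy; assert (D1 := Df y ltac:(lra)); assert (D := Dd y ltac:(lra)); der; field.
Qed.

Lemma coefficient_bounds (P : normal_form) : exists M k, 1 <= M /\ 1 <= k /\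
  (forall y, lo P <= y <= hi P ->
    (Rabs (cb P y) <= M /\ Rabs (cb1 P y) <= M /\ Rabs (cb2 P y) <= M) /\
    (Rabs (cc P y) <= M /\ Rabs (cc1 P y) <= M /\ Rabs (cc2 P y) <= M) /\
    (Rabs (cm P y) <= M /\ Rabs (cm1 P y) <= M /\ Rabs (cm2 P y) <= M) /\
    1 <= k * k * cm P y).
Proof.
assert (lr := lo_hi P); assert (lr' : lo P <= hi P) by lra.
assert (b0 := cb_derive P); assert (b1 := cb1_derive P); assert (b2 := cb2_cont P).
assert (c0 := cc_derive P); assert (c1 := cc1_derive P); assert (c2 := cc2_cont P).
assert (m0 := cm_derive P); assert (m1 := cm1_derive P); assert (m2 := cm2_cont P).
destruct (bounded_on_segment (cb P) _ _ lr') as [M1 [P1 H1]]; [intros; cont|].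
destruct (bounded_on_segment (cb1 P) _ _ lr') as [M2 [P2 H2]]; [intros; cont|].
destruct (bounded_on_segment (cb2 P) _ _ lr') as [M3 [P3 H3]]; [intros; cont|].
destruct (bounded_on_segment (cc P) _ _ lr') as [M4 [P4 H4]]; [intros; cont|].
destruct (bounded_on_segment (cc1 P) _ _ lr') as [M5 [P5 H5]]; [intros; cont|].
destruct (bounded_on_segment (cc2 P) _ _ lr') as [M6 [P6 H6]]; [intros; cont|].
destruct (bounded_on_segment (cm P) _ _ lr') as [M7 [P7 H7]]; [intros; cont|].
destruct (bounded_on_segment (cm1 P) _ _ lr') as [M8 [P8 H8]]; [intros; cont|].
destruct (bounded_on_segment (cm2 P) _ _ lr') as [M9 [P9 H9]]; [intros; cont|].
destruct (positive_on_segment (cm P) _ _ lr') as [q [Hq Q]]; [intros; cont | apply cm_pos |].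
assert (Iq : 0 < / q) by (apply Rinv_0_lt_compat; lra).
exists (1 + M1 + M2 + M3 + M4 + M5 + M6 + M7 + M8 + M9), (1 + / q).
split; [lra|split; [lra|]]; intros y Hy.
assert (A1 := H1 y Hy); assert (A2 := H2 y Hy); assert (A3 := H3 y Hy).
assert (A4 := H4 y Hy); assert (A5 := H5 y Hy); assert (A6 := H6 y Hy).
assert (A7 := H7 y Hy); assert (A8 := H8 y Hy); assert (A9 := H9 y Hy).
repeat split; try lra.
specialize (Q y Hy). assert (E : / q * q = 1) by (field; lra).
assert (1 <= (1 + / q) * (1 + / q) * q) by nra.
assert (0 <= (1 + / q) * (1 + / q)) by apply Rle_0_sqr. nra.
Qed.

(** Each differentiation of a shooting solution costs one factor [S]. *)
Lemma shooting_derivatives (P : normal_form) (M K S t : R) (u d : R -> R) :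
  1 <= M -> 1 <= K -> 1 <= S ->
  (forall y, lo P <= y <= hi P ->
    (Rabs (cb P y) <= M /\ Rabs (cb1 P y) <= M /\ Rabs (cb2 P y) <= M) /\
    (Rabs (cc P y) <= M /\ Rabs (cc1 P y) <= M /\ Rabs (cc2 P y) <= M) /\
    (Rabs (cm P y) <= M /\ Rabs (cm1 P y) <= M /\ Rabs (cm2 P y) <= M)) ->
  shooting_solution P K S t u d ->
  let f := fun x => cb P x * d x + potential P (S * S - 1) x * u x in
  exists f1 f2 : R -> R,
    (forall x, lo P <= x <= hi P -> is_derive f x (f1 x)) /\
    (forall x, lo P <= x <= hi P -> is_derive f1 x (f2 x)) /\
    (forall x, lo P <= x <= hi P -> Rabs (f1 x) <= 30 * (M * M * M * K) * (S * S)) /\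
    (forall x, lo P <= x <= hi P -> Rabs (f2 x) <= 30 * (M * M * M * K) * (S * S * S)).
Proof.
intros HM HK HS HB [U1 [U2 [_ [_ [U5 _]]]]] f.
assert (b0 := cb_derive P); assert (b1 := cb1_derive P).
assert (c0 := cc_derive P); assert (c1 := cc1_derive P).
assert (m0 := cm_derive P); assert (m1 := cm1_derive P).
set (L := S * S - 1).
assert (D2 : forall x, lo P <= x <= hi P -> is_derive d x (f x)) by exact U2.
set (f1 := fun x => cb1 P x * d x + cb P x * f x + (cc1 P x - L * cm1 P x) * u x
  + (cc P x - L * cm P x) * d x).
assert (Df : forall x, lo P <= x <= hi P -> is_derive f x (f1 x)).
{ intros x Hx; unfold f, potential; der; unfold f1, L, f, potential; ring. }
set (f2 := fun x => cb2 P x * d x + cb1 P x * f x + (cb1 P x * f x + cb P x * f1 x)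
  + ((cc2 P x - L * cm2 P x) * u x + (cc1 P x - L * cm1 P x) * d x)
  + ((cc1 P x - L * cm1 P x) * d x + (cc P x - L * cm P x) * f x)).
assert (Df1 : forall x, lo P <= x <= hi P -> is_derive f1 x (f2 x)).
{ intros x Hx; unfold f1; der; unfold f2; ring. }
assert (S2 : 1 <= S * S) by (apply one_le_mult; lra).
assert (HL : Rabs L <= S * S) by (unfold L; apply Rabs_le; lra).
assert (Bu : forall x, lo P <= x <= hi P -> S * Rabs (u x) <= K) by (intros; apply U5; auto).
assert (Bd : forall x, lo P <= x <= hi P -> Rabs (d x) <= K) by (intros; apply U5; auto).
(* a coefficient of size [M * S ^ 2] times [u] is of size [S], as [S * u] is bounded *)
assert (Cu : forall x p q, lo P <= x <= hi P -> Rabs p <= M -> Rabs q <= M ->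
  Rabs ((p - L * q) * u x) <= 2 * M * K * S).
{ intros x p q Hx Hp Hq; specialize (Bu x Hx).
  assert (A := Rabs_pos (u x)).
  assert (E : Rabs (p - L * q) <= 2 * M * (S * S)).
  { eapply Rle_trans; [repeat abs_step|]. nra. }
  rewrite Rabs_mult; apply Rle_trans with (2 * M * (S * S) * Rabs (u x)).
  - apply Rmult_le_compat_r; auto.
  - replace (2 * M * (S * S) * Rabs (u x)) with (2 * M * S * (S * Rabs (u x))) by ring.
    replace (2 * M * K * S) with (2 * M * S * K) by ring.
    apply Rmult_le_compat_l; [repeat apply Rmult_le_pos; lra | auto]. }
assert (Cd : forall p q, Rabs p <= M -> Rabs q <= M -> Rabs (p - L * q) <= 2 * M * (S * S)).
{ intros p q Hp Hq; eapply Rle_trans; [repeat abs_step|]. nra. }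
destruct (le_sqr_le_cube M HM) as [M2 M3]. destruct (le_sqr_le_cube S HS) as [Sq Sc].
set (Z := M * M * M * K).
assert (Z1 : M * K <= Z) by (apply Rmult_le_compat_r; lra).
assert (Z2 : M * M * K <= Z) by (apply Rmult_le_compat_r; lra).
assert (Z0 : 1 <= M * K) by (apply one_le_mult; lra).
assert (Z3 : M * K <= M * M * K) by (apply Rmult_le_compat_r; lra).
assert (Bf : forall x, lo P <= x <= hi P -> Rabs (f x) <= 3 * (M * K) * S).
{ intros x Hx; destruct (HB x Hx) as [[B1 [B2 B3]] [[B4 [B5 B6]] [B7 [B8 B9]]]].
  assert (B10 := Bd x Hx).
  unfold f, potential; fold L; eapply Rle_trans;
    [apply Rabs_plus_le; [repeat abs_step | apply Cu; eassumption]|]. nra. }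
assert (Bf1 : forall x, lo P <= x <= hi P -> Rabs (f1 x) <= 8 * (M * M * K) * (S * S)).
{ intros x Hx; destruct (HB x Hx) as [[B1 [B2 B3]] [[B4 [B5 B6]] [B7 [B8 B9]]]].
  assert (B10 := Bd x Hx). assert (B11 := Bf x Hx).
  assert (B12 := Cu x _ _ Hx B5 B8). assert (B13 := Cd _ _ B4 B7).
  unfold f1; clear HB Cu Cd Bf Bd Bu U5; eapply Rle_trans; [repeat abs_step|].
  assert (E1 : 1 * (M * K) <= (S * S) * (M * K)) by (apply Rmult_le_compat_r; lra).
  assert (E2 : S * (M * M * K) <= S * S * (M * M * K)) by (apply Rmult_le_compat_r; lra).
  assert (E3 : S * (M * K) <= S * S * (M * K)) by (apply Rmult_le_compat_r; lra).
  assert (E4 : (S * S) * (M * K) <= (S * S) * (M * M * K)).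
  { apply Rmult_le_compat_l; [lra|]. apply Rmult_le_compat_r; lra. }
  lra. }
exists f1, f2; split; [exact Df | split; [exact Df1 | split]].
- intros x Hx; eapply Rle_trans; [apply Bf1; auto|].
  apply Rmult_le_compat_r; lra.
- intros x Hx; destruct (HB x Hx) as [[B1 [B2 B3]] [[B4 [B5 B6]] [B7 [B8 B9]]]].
  assert (B10 := Bd x Hx). assert (B11 := Bf x Hx). assert (B14 := Bf1 x Hx).
  assert (B12 := Cu x _ _ Hx B6 B9). assert (B13 := Cd _ _ B4 B7). assert (B15 := Cd _ _ B5 B8).
  unfold f2; clear HB Cu Cd Bf Bd Bu U5 Bf1; eapply Rle_trans; [repeat abs_step|].
  assert (PS : 0 <= S * S * S) by lra.
  assert (E1 : 1 * (M * K) <= (S * S * S) * Z) by (apply Rmult_le_compat; lra).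
  assert (E2 : S * (M * M * K) <= S * S * S * Z) by (apply Rmult_le_compat; lra).
  assert (E3 : S * (M * K) <= S * S * S * Z) by (apply Rmult_le_compat; lra).
  assert (E4 : (S * S) * Z <= S * S * S * Z) by (apply Rmult_le_compat_r; lra).
  assert (E5 : (S * S) * (M * K) <= S * S * S * Z) by (apply Rmult_le_compat; lra).
  assert (E6 : (S * S * S) * (M * M * K) <= S * S * S * Z) by (apply Rmult_le_compat; lra).
  replace (M * (8 * (M * M * K) * (S * S))) with (8 * ((S * S) * Z)) by (unfold Z; ring).
  lra.
Qed.

(** The order of the error of the initial slope. *)
Definition start_error (s : scheme) (h : R) : R :=
  match s with Scheme1 => h | Scheme2 => 0 end.

Section Convergence.
Variables (P : normal_form) (M k K : R).
Hypothesis HM : 1 <= M.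
Hypothesis Hk : 1 <= k.
Hypothesis HK : 1 <= K.
Hypothesis HB : forall y, lo P <= y <= hi P ->
    (Rabs (cb P y) <= M /\ Rabs (cb1 P y) <= M /\ Rabs (cb2 P y) <= M) /\
    (Rabs (cc P y) <= M /\ Rabs (cc1 P y) <= M /\ Rabs (cc2 P y) <= M) /\
    (Rabs (cm P y) <= M /\ Rabs (cm1 P y) <= M /\ Rabs (cm2 P y) <= M) /\
    1 <= k * k * cm P y.
Variables (s : scheme) (x : nat -> R) (n : nat) (h : R).
Hypothesis Hh : 16 * (M * M * M * (k * k)) * (1 + bc P) * h <= 1.
Hypothesis Hx0 : x 0%nat = lo P.
Hypothesis Hx1 : x (S n) = hi P.
Hypothesis Hx : forall i, (i <= S n)%nat -> lo P <= x i <= hi P.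
Hypothesis Hstep : forall i, (i <= n)%nat -> 0 < x (S i) - x i <= h.
Variables (Sp t : R) (u d : R -> R).
Hypothesis HS : 1 <= Sp.
Hypothesis HSh : Sp * Sp * Sp * (h * h) <= 1.
Hypothesis Hu : shooting_solution P K Sp t u d.

Let lambda := Sp * Sp - 1.
Let eg (i : nat) : R := u (lo P) * fst (leapfrog P s x lambda i) - u (x i).
Let ed (i : nat) : R := u (lo P) * snd (leapfrog P s x lambda i) - d (x i).
Let A := 8 * M * M * M * k * k.
Let F := 30 * (M * M * M * K).

Lemma small_step : M * (1 + bc P) * h <= 1 /\ A * h <= 1 / 2 /\ 0 < h.
Proof.
assert (Hb := bc_pos P); assert (H0 := Hstep 0%nat ltac:(lia)).
destruct (le_sqr_le_cube M HM) as [M2 M3]; destruct (le_sqr_le_cube k Hk) as [k2 _].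
assert (MM : 1 * M <= 16 * (M * M * M * (k * k))).
{ replace (16 * (M * M * M * (k * k))) with ((k * k) * (16 * (M * M * M))) by ring.
  apply Rmult_le_compat; lra. }
split; [|split; [|lra]].
- eapply Rle_trans; [|exact Hh]; rewrite <- (Rmult_1_l M).
  apply Rmult_le_compat_r; [lra|]; apply Rmult_le_compat_r; lra.
- assert (E : 16 * (M * M * M * (k * k)) * h * 1 <= 16 * (M * M * M * (k * k)) * h * (1 + bc P)).
  { apply Rmult_le_compat_l; [apply Rmult_le_pos|]; lra. }
  unfold A; lra.
Qed.

(** The error obeys the linear recursion with the local errors as perturbations;
    these are [O(S ^ 3 h ^ 3)] once the drift error is weighted with [S]. *)
Lemma error_step (i : nat) : (i <= n)%nat ->
  energy Sp (cm P (x (S i))) (eg (S i)) (ed (S i)) - energy Sp (cm P (x i)) (eg i) (ed i) <=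
  A * (x (S i) - x i) * (energy Sp (cm P (x i)) (eg i) (ed i) + energy Sp (cm P (x (S i))) (eg (S i)) (ed (S i)))
  + A * (2 * F * (Sp * Sp * Sp * (h * h))) * (x (S i) - x i).
Proof.
intros Hi; destruct small_step as [Q1 [Q2 Q3]].
assert (Xi := Hx i ltac:(lia)); assert (Xi' := Hx (S i) ltac:(lia)); assert (St := Hstep i Hi).
set (e := x (S i) - x i) in *.
destruct (shooting_derivatives P M K Sp t u d HM HK HS) as [f1 [f2 [D1 [D2 [BF1 BF2]]]]]; auto.
{ intros y Hy; destruct (HB y Hy) as [B1 [B2 [B3 _]]]; auto. }
fold F in BF1, BF2.
set (f := fun y => cb P y * d y + potential P (Sp * Sp - 1) y * u y) in *.
destruct Hu as [U1 [U2 _]].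
assert (R1 := drift_residual u d f f1 (x i) (x (S i)) (F * (Sp * Sp)) ltac:(unfold e in St; lra)
  ltac:(intros; apply U1; lra) ltac:(intros; apply U2; lra) ltac:(intros; apply D1; lra)
  ltac:(intros; apply BF1; lra)).
assert (R2 := kick_residual d f f1 f2 (x i) (x (S i)) (F * (Sp * Sp * Sp)) ltac:(unfold e in St; lra)
  ltac:(intros; apply U2; lra) ltac:(intros; apply D1; lra) ltac:(intros; apply D2; lra)
  ltac:(intros; apply BF2; lra)).
fold e in R1, R2.
set (r1 := u (x (S i)) - u (x i) - e * (d (x i) + e / 2 * f (x i))) in *.
set (r2 := d (x (S i)) - d (x i) - e / 2 * (f (x i) + f (x (S i)))) in *.
destruct (HB _ Xi) as [[B1 [B2 B3]] [[B4 [B5 B6]] [[B7 [B8 B9]] B10]]].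
destruct (HB _ Xi') as [[B1' [B2' B3']] [[B4' [B5' B6']] [[B7' [B8' B9']] B10']]].
assert (Pm := cm_pos P _ Xi); assert (Pm' := cm_pos P _ Xi').
assert (Dm : Rabs (cm P (x (S i)) - cm P (x i)) <= M * e).
{ apply (increment_bound (cm P) (cm1 P)); [unfold e in St; lra | |]; intros.
  - apply cm_derive; lra.
  - apply HB; lra. }
rewrite Rabs_right in B7, B7' by lra.
assert (See : Sp * Sp * Sp * (e * e) <= Sp * Sp * Sp * (h * h)).
{ apply Rmult_le_compat_l; [repeat apply Rmult_le_pos; lra | apply Rmult_le_compat; lra]. }
assert (L := leapfrog_d P s x n M h ltac:(intros; apply HB; auto) Q1 Hx Hstep lambda i Hi).
assert (E := energy_step M k Sp e (cb P (x i)) (cb P (x (S i))) (cc P (x i)) (cc P (x (S i)))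
  (cm P (x i)) (cm P (x (S i))) (eg i) (eg (S i)) (ed i) (ed (S i)) (- r1 / e) (- r2)
  HM Hk B10 B10' ltac:(lra) ltac:(lra) B1 B1' B4 B4' Dm HS ltac:(lra) ltac:(lra)).
cbv zeta in E; eapply Rle_trans; [apply E|].
- unfold eg, ed; rewrite leapfrog_g; fold e; unfold half_kick, r1, f, potential; unfold lambda.
  field; lra.
- unfold ed, eg; rewrite L at 1; fold e; unfold half_kick, r2, f, potential; unfold lambda.
  field.
- fold A. 
  assert (T1 : Sp * e * Rabs (- r1 / e) <= F * (Sp * Sp * Sp * (h * h)) * e).
  { unfold Rdiv; rewrite Rabs_mult, Rabs_Ropp, (Rabs_right (/ e)) by (apply Rle_ge; left; apply Rinv_0_lt_compat; lra).
    replace (Sp * e * (Rabs r1 * / e)) with (Sp * Rabs r1) by (field; lra).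
    apply Rle_trans with (Sp * (F * (Sp * Sp) * e * e * e)); [apply Rmult_le_compat_l; lra|].
    replace (Sp * (F * (Sp * Sp) * e * e * e)) with (F * (Sp * Sp * Sp * (e * e)) * e) by ring.
    apply Rmult_le_compat_r; [lra|]. apply Rmult_le_compat_l; auto.
    unfold F; repeat apply Rmult_le_pos; lra. }
  assert (T2 : Rabs (- r2) <= F * (Sp * Sp * Sp * (h * h)) * e).
  { rewrite Rabs_Ropp; eapply Rle_trans; [exact R2|].
    replace (F * (Sp * Sp * Sp) * e * e * e) with (F * (Sp * Sp * Sp * (e * e)) * e) by ring.
    apply Rmult_le_compat_r; [lra|]. apply Rmult_le_compat_l; auto.
    unfold F; repeat apply Rmult_le_pos; lra. }
  assert (PA : 0 <= A) by (unfold A; repeat apply Rmult_le_pos; lra).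
  assert (T3 := Rmult_le_compat_l A _ _ PA (Rplus_le_compat _ _ _ _ T1 T2)). lra.
Qed.

(** In Scheme 1 the slope is off by half a kick.  That kick is [O(h)] uniformly in
    [S], since [lambda * u lo] is bounded by the slope through the boundary
    condition. *)
Lemma error_start : energy Sp (cm P (x 0%nat)) (eg 0%nat) (ed 0%nat) <=
  M * K * (bc P + 1) * start_error s h.
Proof.
assert (lr := lo_hi P); assert (Hb := bc_pos P).
destruct small_step as [Q1 [Q2 Q3]].
assert (E0 : eg 0%nat = 0) by (unfold eg; simpl; rewrite Hx0; ring).
destruct Hu as [_ [_ [U3 [U4 [U5 _]]]]].
destruct (U5 (lo P) ltac:(lra)) as [U6 U7].
destruct (HB (lo P) ltac:(lra)) as [[B1 _] [_ [[B7 _] _]]].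
assert (E : Rabs (ed 0%nat) <= M * K * (bc P + 1) * start_error s h).
{ unfold ed; simpl snd; rewrite Hx0 at 2.
  assert (St := Hstep 0%nat ltac:(lia)).
  assert (Bf := small_friction_lo P x n M h ltac:(intros; apply HB; auto) Q1 Hx0 Hx Hstep).
  fold lambda in U3.
  assert (Ed : d (lo P) = (k0 P - lambda) * u (lo P) / bc P) by (rewrite <- U3; field; lra).
  set (e := x 1%nat - x 0%nat) in *.
  destruct s; unfold start_slope, start_error.
  - replace (_ - _) with (- (e / 2 * (cm P (lo P) * (bc P * d (lo P)) + cb P (lo P) * d (lo P)))
      / (1 + e / 2 * cb P (lo P))).
    2:{ rewrite U3; unfold potential; rewrite cc_lo.
        replace (d (lo P)) with ((k0 P - lambda) * u (lo P) / bc P) by (symmetry; exact Ed). field; lra. }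
    unfold Rdiv at 1; rewrite Rabs_mult, Rabs_Ropp.
    assert (V1 : Rabs (/ (1 + e / 2 * cb P (lo P))) <= 2).
    { rewrite Rabs_right; [|apply Rle_ge; left; apply Rinv_0_lt_compat; lra].
      replace 2 with (/ (1 / 2)) by field. apply Rinv_le_contravar; lra. }
    assert (V2 : Rabs (e / 2 * (cm P (lo P) * (bc P * d (lo P)) + cb P (lo P) * d (lo P)))
       <= h / 2 * (M * (bc P * K) + M * K)).
    { assert (Rabs (e / 2) <= h / 2) by (rewrite Rabs_right; lra).
      assert (Rabs (bc P) <= bc P) by (rewrite Rabs_right; lra).
      repeat abs_step. }
    apply Rle_trans with (h / 2 * (M * (bc P * K) + M * K) * 2).
    + apply Rmult_le_compat; auto; apply Rabs_pos.
    + right; field.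
  - rewrite Ed; replace (_ - _) with 0 by (field; lra). rewrite Rabs_R0; lra. }
rewrite E0; unfold energy; rewrite !Rmult_0_r, Rplus_0_l.
replace (sqrt (ed 0%nat * ed 0%nat)) with (Rabs (ed 0%nat)); [exact E|].
symmetry; apply sqrt_Rsqr_abs.
Qed.

Lemma error_final : energy Sp (cm P (hi P)) (eg (S n)) (ed (S n)) <=
  exp (3 * A * (hi P - lo P)) *
   (M * K * (bc P + 1) + 4 * A * F * (hi P - lo P)) * (start_error s h + Sp * Sp * Sp * (h * h)).
Proof.
assert (lr := lo_hi P); assert (Hb := bc_pos P).
destruct small_step as [Q1 [Q2 Q3]].
assert (PA : 0 <= A) by (unfold A; repeat apply Rmult_le_pos; lra).
assert (PF : 0 <= F) by (unfold F; repeat apply Rmult_le_pos; lra).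
assert (Ps : 0 <= start_error s h) by (destruct s; simpl; lra).
set (T := Sp * Sp * Sp * (h * h)) in *.
assert (PT : 0 <= T) by (unfold T; repeat apply Rmult_le_pos; lra).
destruct (discrete_gronwall (fun i => energy Sp (cm P (x i)) (eg i) (ed i)) x A (A * (2 * F * T)) n PA) with (i := S n)
 as [G _].
- apply Rmult_le_pos; auto; apply Rmult_le_pos; lra.
- intros; apply sqrt_pos.
- intros i Hi; assert (St := Hstep i Hi); split; [lra|].
  apply Rle_trans with (A * h); [apply Rmult_le_compat_l; lra | lra].
- intros i Hi; apply error_step; auto.
- lia.
- rewrite Hx1, Hx0 in G; cbv beta in G.
  eapply Rle_trans; [exact G|]; rewrite (Rmult_assoc (exp _)).
  apply Rmult_le_compat_l; [left; apply exp_pos|].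
  assert (E0 := error_start); rewrite Hx0 in E0.
  assert (P1 : 0 <= M * K * (bc P + 1) * T) by (repeat apply Rmult_le_pos; lra).
  assert (P2 : 0 <= 4 * A * F * (hi P - lo P) * start_error s h) by (repeat apply Rmult_le_pos; lra).
  lra.
Qed.

(** Division by the amplitude turns the error at the right end point into an error
    of directions. *)
Lemma leapfrog_angle : exists a1 a2, 0 < a1 /\ 0 < a2 /\
  let eta := K * (exp (3 * A * (hi P - lo P)) *
   (M * K * (bc P + 1) + 4 * A * F * (hi P - lo P)) * (start_error s h + Sp * Sp * Sp * (h * h))) in
  Rabs (a1 * fst (leapfrog P s x lambda (S n)) - sin t) <= eta /\
  Rabs (a2 * snd (leapfrog P s x lambda (S n)) - cos t) <= eta.
Proof.
assert (lr := lo_hi P).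
destruct Hu as [_ [_ [_ [U4 [_ [Amp [HA [U6 U7]]]]]]]].
assert (PK : 0 < / K) by (apply Rinv_0_lt_compat; lra).
assert (PAmp : 0 < Amp) by lra.
assert (IA : 0 < / Amp <= K).
{ split; [apply Rinv_0_lt_compat; lra|]. rewrite <- (Rinv_inv K); apply Rinv_le_contravar; lra. }
assert (Pm := cm_pos P (hi P) ltac:(lra)).
assert (Pq : 0 < sqrt (cm P (hi P))) by (apply sqrt_lt_R0; auto).
assert (Sq : sqrt (cm P (hi P)) * sqrt (cm P (hi P)) = cm P (hi P)) by (apply sqrt_sqrt; lra).
set (q := sqrt (cm P (hi P))) in *.
assert (EF := error_final).
set (B := exp _ * _ * _) in *.
assert (PB : 0 <= B) by (eapply Rle_trans; [apply sqrt_pos | exact EF]).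
exists (Sp * q * u (lo P) * / Amp), (u (lo P) * / Amp).
split; [repeat apply Rmult_lt_0_compat; lra|split; [repeat apply Rmult_lt_0_compat; lra|]].
cbv zeta; split.
- replace (Sp * q * u (lo P) * / Amp * fst (leapfrog P s x lambda (S n)) - sin t)
    with (/ Amp * (Sp * q * eg (S n))).
  + apply Rabs_mult_le; [rewrite Rabs_right; lra|].
    apply Rle_trans with (energy Sp (cm P (hi P)) (eg (S n)) (ed (S n))); [|exact EF].
    apply Rabs_le_of_sqr; [apply sqrt_pos|]; rewrite energy_sqr by lra; rewrite <- Sq.
    assert (0 <= ed (S n) * ed (S n)) by apply Rle_0_sqr. lra.
  + unfold eg; rewrite Hx1. replace (sin t) with (Sp * q * u (hi P) / Amp) by (rewrite U6; field; lra).
    field; lra.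
- replace (u (lo P) * / Amp * snd (leapfrog P s x lambda (S n)) - cos t)
    with (/ Amp * ed (S n)).
  + apply Rabs_mult_le; [rewrite Rabs_right; lra|].
    eapply Rle_trans; [apply (energy_d Sp (cm P (hi P)) (eg (S n))); lra | exact EF].
  + unfold ed; rewrite Hx1. replace (cos t) with (d (hi P) / Amp) by (rewrite U7; field; lra).
    field; lra.
Qed.

End Convergence.

(** * Matching the two spectra *)

Lemma derive_pos_right (f : R -> R) (c a b : R) :
  is_derive f c a -> 0 < a -> f c = 0 -> c < b -> exists x, c < x < b /\ 0 < f x.
Proof.
intros D Ha Hc Hb; apply is_derive_Reals in D.
destruct (D (a / 2) ltac:(lra)) as [al Hal].
assert (A1 := Rmin_l (al / 2) ((b - c) / 2)); assert (A2 := Rmin_r (al / 2) ((b - c) / 2)).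
assert (Pal := cond_pos al).
assert (A3 : 0 < Rmin (al / 2) ((b - c) / 2)) by (apply Rmin_pos; lra).
set (e := Rmin (al / 2) ((b - c) / 2)) in *.
specialize (Hal e ltac:(lra)); rewrite Hc, Rminus_0_r, (Rabs_right e) in Hal by lra.
specialize (Hal ltac:(lra)); apply Rabs_lt_between in Hal.
exists (c + e); split; [lra|].
assert (E : f (c + e) = f (c + e) / e * e) by (field; lra).
assert (0 < f (c + e) / e * e) by (apply Rmult_lt_0_compat; lra). lra.
Qed.

Lemma derive_pos_left (f : R -> R) (c a b : R) :
  is_derive f c a -> 0 < a -> f c = 0 -> b < c -> exists x, b < x < c /\ f x < 0.
Proof.
intros D Ha Hc Hb.
destruct (derive_pos_right (fun x => - f (- x)) (- c) a (- b)) as [x [Hx Hf]].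
- eapply is_derive_value;
   [apply is_derive_opp_R; apply (is_derive_comp_R f (fun t => - t));
     [rewrite Ropp_involutive; exact D | der; reflexivity]|]. ring.
- auto.
- rewrite Ropp_involutive, Hc; ring.
- lra.
- exists (- x); split; [lra|]. lra.
Qed.

(** [f] is negative somewhere to the left of [b].  At the last point before where
    [f] is nonnegative, [f] can neither be positive, by continuity, nor have a zero
    crossed upwards. *)
Lemma two_upward_crossings (f : R -> R) (a b : R) : a < b ->
  (forall x, continuous f x) -> f a = 0 -> f b = 0 ->
  (forall x, a <= x <= b -> f x = 0 -> exists c, is_derive f x c /\ 0 < c) -> False.
Proof.
intros ab Hc Ha Hb Hz.
destruct (Hz b ltac:(lra) Hb) as [cb [Db Pb]].
destruct (derive_pos_left f b cb a Db Pb Hb ab) as [x1 [Hx1 Fx1]].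
destruct (completeness (fun x => a <= x <= x1 /\ 0 <= f x)) as [c [Uc Lc]].
- exists x1; intros x [Hx _]; lra.
- exists a; lra.
- assert (ac : a <= c) by (apply Uc; lra).
  assert (cx : c <= x1) by (apply Lc; intros x [Hx _]; lra).
  assert (Fc : 0 <= f c).
  { apply Rnot_lt_le; intros N.
    destruct (continuous_eps_inv f c (- f c) (Hc c) ltac:(lra)) as [al [Pal Hal]].
    assert (c <= c - al / 2); [|lra].
    apply Lc; intros x [Hx Fx]; apply Rnot_lt_le; intros L.
    assert (x <= c) by (apply Uc; auto).
    specialize (Hal x ltac:(apply Rabs_lt_between; lra)); apply Rabs_lt_between in Hal; lra. }
  assert (cx1 : c < x1) by (destruct cx as [|E]; [auto | rewrite E in Fc; lra]).
  assert (Ex : exists x, c < x < x1 /\ 0 < f x).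
  { destruct Fc as [P|Z].
    - destruct (continuous_eps_inv f c (f c) (Hc c) P) as [al [Pal Hal]].
      assert (A1 := Rmin_l (al / 2) ((x1 - c) / 2)); assert (A2 := Rmin_r (al / 2) ((x1 - c) / 2)).
      assert (A3 : 0 < Rmin (al / 2) ((x1 - c) / 2)) by (apply Rmin_pos; lra).
      exists (c + Rmin (al / 2) ((x1 - c) / 2)); split; [lra|].
      specialize (Hal (c + Rmin (al / 2) ((x1 - c) / 2)) ltac:(apply Rabs_lt_between; lra)).
      apply Rabs_lt_between in Hal; lra.
    - destruct (Hz c ltac:(lra) (eq_sym Z)) as [dc [Dc Pc]].
      apply (derive_pos_right f c dc x1); auto. }
  destruct Ex as [x [Hx Fx]]. assert (x <= c) by (apply Uc; lra). lra.
Qed.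

Lemma cos_ge_half (x : R) : Rabs x <= 1 -> 1 / 2 <= cos x.
Proof.
intros H; rewrite <- cos_PI3.
assert (P := PI2_3_2). assert (P3 : 1 <= PI / 3) by lra.
assert (E : cos x = cos (Rabs x)).
{ unfold Rabs; destruct Rcase_abs; [rewrite cos_neg|]; reflexivity. }
rewrite E; apply cos_decr_1; try lra; apply Rabs_pos.
Qed.

Lemma sin_ge_half (x : R) : 0 <= x <= 1 -> x / 2 <= sin x.
Proof.
intros Hx.
assert (E : x / 2 - 0 / 2 <= sin x - sin 0).
{ apply (increment_le_of_derive_le (fun t => t / 2) (fun _ => / 2) sin cos); try lra.
  - intros; der; field.
  - intros; apply is_derive_sin.
  - intros t Ht; assert (C := cos_ge_half t ltac:(rewrite Rabs_right; lra)); lra. }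
rewrite sin_0 in E; lra.
Qed.

Lemma cos_int_PI (N : Z) : cos (IZR N * PI) = 1 \/ cos (IZR N * PI) = -1.
Proof.
assert (S0 : sin (IZR N * PI) = 0) by (apply sin_eq_0_1; exists N; reflexivity).
assert (E := sin2_cos2 (IZR N * PI)); rewrite S0 in E; unfold Rsqr in E.
assert (F : (cos (IZR N * PI) - 1) * (cos (IZR N * PI) + 1) = 0) by lra.
apply Rmult_integral in F; destruct F; [left | right]; lra.
Qed.

Lemma sin_shift_int (N : Z) (x : R) : sin (IZR N * PI + x) = cos (IZR N * PI) * sin x.
Proof.
assert (S0 : sin (IZR N * PI) = 0) by (apply sin_eq_0_1; exists N; reflexivity).
rewrite sin_plus, S0; ring.
Qed.

Lemma cos_shift_int (N : Z) (x : R) : cos (IZR N * PI + x) = cos (IZR N * PI) * cos x.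
Proof.
assert (S0 : sin (IZR N * PI) = 0) by (apply sin_eq_0_1; exists N; reflexivity).
rewrite cos_plus, S0; ring.
Qed.

(** The factor 2 would do by [sin y >= y / 2]; with 3 also [sin (3 * e) > e],
    which decides signs at distance [3 * e] from a multiple of [PI]. *)
Lemma near_multiple_of_PI (x e : R) : Rabs (sin x) <= e -> 3 * e <= 1 ->
  exists N : Z, Rabs (x - IZR N * PI) <= 3 * e.
Proof.
intros H He; assert (Hp := PI2_3_2).
set (N := (up (x / PI - 1 / 2))%Z). exists N.
assert (U := archimed (x / PI - 1 / 2)); fold N in U.
set (y := x - IZR N * PI).
assert (Hy : - (PI / 2) <= y <= PI / 2).
{ assert (E : x = x / PI * PI) by (field; lra). unfold y; nra. }
assert (Ey : Rabs (sin x) = Rabs (sin y)).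
{ replace x with (IZR N * PI + y) by (unfold y; ring). rewrite sin_shift_int, Rabs_mult.
  destruct (cos_int_PI N) as [C|C]; rewrite C; [rewrite Rabs_R1 | rewrite Rabs_left by lra]; ring. }
rewrite Ey in H.
assert (E2 : Rabs (sin y) = sin (Rabs y)).
{ unfold Rabs at 2; destruct (Rcase_abs y).
  - rewrite sin_neg, Rabs_left1; auto. assert (0 <= sin (- y)) by (apply sin_ge_0; lra).
    rewrite sin_neg in H0; lra.
  - rewrite Rabs_right; auto. apply Rle_ge, sin_ge_0; lra. }
rewrite E2 in H.
assert (Ay : 0 <= Rabs y <= PI / 2) by (split; [apply Rabs_pos | apply Rabs_le; lra]).
apply Rnot_lt_le; intros L.
assert (e0 : 0 <= e) by (assert (0 <= sin (Rabs y)) by (apply sin_ge_0; lra); lra).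
destruct (Rle_dec (Rabs y) 1) as [L1|L1].
- assert (A := sin_ge_half (Rabs y) ltac:(lra)); lra.
- assert (A := sin_ge_half 1 ltac:(lra)).
  assert (sin 1 <= sin (Rabs y)) by (apply sin_incr_1; lra). lra.
Qed.

(** [Theta] is the final angle of the differential problem; [D] and [Dd] are the
    last value and the last slope of the recursion as functions of the
    eigenparameter, of direction [Theta] up to [eta] for [S] up to [Smax].  The
    windows are the sets where [Theta] is within [3 * eta] of a multiple of
    [PI]. *)
Section Matching.
Variables (Theta : R -> R) (c0 Lp : R) (j0 : Z) (D Dd : R -> R) (eta Smax Sk : R) (k n : nat).
Variable lamn : nat -> R.
Hypothesis Hc0 : 0 < c0.
Hypothesis HLp : 0 < Lp.
Hypothesis HTheta : bi_lipschitz Theta c0 Lp.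
Hypothesis Dex : forall x, continuous D x.
Hypothesis Dcross : forall x, D x = 0 -> exists c, is_derive D x c /\ 0 < c * Dd x.
Hypothesis Dpos : forall x, x <= 0 -> 0 < D x.
Hypothesis Heta : 0 < eta.
Hypothesis Heta1 : 3 * eta <= 1 / 4.
Hypothesis Hlow : IZR j0 * PI + 2 * (3 * eta) <= Theta 1 <= (IZR j0 + 1) * PI - 3 * eta.
Hypothesis Hclose : forall s, 1 <= s <= Smax -> exists a1 a2, 0 < a1 /\ 0 < a2 /\
  Rabs (a1 * D (s * s - 1) - sin (Theta s)) <= eta /\ Rabs (a2 * Dd (s * s - 1) - cos (Theta s)) <= eta.
Hypothesis Hk : (1 <= k)%nat.
Hypothesis HSk : 1 <= Sk /\ Theta Sk = (IZR j0 + INR k) * PI /\ Sk + 3 * eta / c0 <= Smax.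
Hypothesis Linc : forall i, (1 <= i <= n)%nat -> lamn i < lamn (S i).
Hypothesis Lroot : forall x, D x = 0 <-> exists i, (1 <= i <= S n)%nat /\ x = lamn i.

Definition in_window (j : nat) (s : R) : Prop :=
  1 <= s /\ Rabs (Theta s - (IZR j0 + INR j) * PI) <= 3 * eta.

Lemma INR_IZR_plus (j : nat) : (IZR j0 + INR j) * PI = IZR (j0 + Z.of_nat j) * PI.
Proof. rewrite plus_IZR, <- INR_IZR_INZ; reflexivity. Qed.

Lemma window_order (i j : nat) (s t : R) :
  (i < j)%nat -> in_window i s -> in_window j t -> s < t.
Proof.
intros Hij [Hs Ws] [Ht Wt]; apply (bi_lipschitz_lt Theta c0 Lp); auto.
assert (P := PI2_3_2).
assert (Hn : INR i + 1 <= INR j) by (rewrite <- S_INR; apply le_INR; lia).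
apply Rabs_le_between in Ws; apply Rabs_le_between in Wt. nra.
Qed.

Lemma window_le_Smax (j : nat) (s : R) : (j <= k)%nat -> in_window j s -> s <= Smax.
Proof.
intros Hj [Hs Ws]; destruct HSk as [S1 [S2 S3]].
assert (P := PI2_3_2).
assert (Hn : INR j <= INR k) by (apply le_INR; lia).
apply Rabs_le_between in Ws.
destruct (Rle_dec s Sk) as [L|L].
- assert (0 <= 3 * eta / c0) by (apply Rdiv_le_0_compat; lra). lra.
- assert (E := HTheta Sk s S1 ltac:(lra)).
  assert (Q : c0 * (s - Sk) <= 3 * eta) by nra.
  assert (F : s - Sk <= 3 * eta / c0) by (apply Rle_div_r; lra). lra.
Qed.

(** In a window [cos Theta] is at least 1/2 in absolute value, so the last slope has
    its sign. *)
Lemma window_crossing (j : nat) (s : R) : (j <= k)%nat -> in_window j s -> D (s * s - 1) = 0 ->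
  exists c, is_derive D (s * s - 1) c /\ 0 < cos (IZR (j0 + Z.of_nat j) * PI) * c.
Proof.
intros Hj Hw Z; assert (Hs := window_le_Smax j s Hj Hw); destruct Hw as [H1 Hw].
rewrite INR_IZR_plus in Hw.
destruct (Dcross _ Z) as [c [Dc Pc]]; exists c; split; auto.
destruct (Hclose s ltac:(lra)) as [a1 [a2 [_ [Pa2 [_ H2]]]]].
set (N := (j0 + Z.of_nat j)%Z) in *.
replace (Theta s) with (IZR N * PI + (Theta s - IZR N * PI)) in H2 by ring.
rewrite cos_shift_int in H2.
assert (C := cos_ge_half (Theta s - IZR N * PI) ltac:(lra)).
apply Rabs_le_between in H2.
destruct (cos_int_PI N) as [E|E]; rewrite E in *.
- assert (0 < a2 * Dd (s * s - 1)) by lra. assert (0 < Dd (s * s - 1)) by nra. nra.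
- assert (a2 * Dd (s * s - 1) < 0) by lra. assert (Dd (s * s - 1) < 0) by nra. nra.
Qed.

Lemma window_unique (j : nat) (s t : R) : (j <= k)%nat -> in_window j s -> in_window j t ->
  D (s * s - 1) = 0 -> D (t * t - 1) = 0 -> s = t.
Proof.
assert (W : forall s t, (j <= k)%nat -> in_window j s -> in_window j t ->
  D (s * s - 1) = 0 -> D (t * t - 1) = 0 -> s < t -> False).
{ clear s t; intros s t Hj Ws Wt Zs Zt L.
  assert (Hs : 1 <= s) by apply Ws.
  set (sg := cos (IZR (j0 + Z.of_nat j) * PI)).
  apply (two_upward_crossings (fun x => sg * D x) (s * s - 1) (t * t - 1)).
  - nra.
  - intros x; cont.
  - rewrite Zs; ring.
  - rewrite Zt; ring.
  - intros x Hx Zx.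
    assert (Zx' : D x = 0).
    { apply Rmult_integral in Zx; destruct Zx as [Zx|]; auto.
      unfold sg in Zx; destruct (cos_int_PI (j0 + Z.of_nat j)); lra. }
    set (v := sqrt (x + 1)).
    assert (Ev : v * v = x + 1) by (apply sqrt_sqrt; nra).
    assert (Pv : 0 <= v) by apply sqrt_pos.
    assert (Hv : s <= v <= t) by (split; apply Rnot_lt_le; intros N; nra).
    assert (Wv : in_window j v).
    { split; [lra|]. destruct Ws as [_ Ws]; destruct Wt as [_ Wt].
      assert (E1 := bi_lipschitz_le Theta c0 Lp Hc0 HTheta s v Hs ltac:(lra)).
      assert (E2 := bi_lipschitz_le Theta c0 Lp Hc0 HTheta v t ltac:(lra) ltac:(lra)).
      apply Rabs_le_between in Ws; apply Rabs_le_between in Wt; apply Rabs_le; lra. }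
    replace x with (v * v - 1) in * by lra.
    destruct (window_crossing j v Hj Wv Zx') as [c [Dc Pc]].
    exists (sg * c); split; auto. der. ring. }
intros Hj Ws Wt Zs Zt; destruct (Rtotal_order s t) as [L|[E|L]]; auto; exfalso; eauto.
Qed.

Lemma window_root (j : nat) : (1 <= j <= k)%nat -> exists s, in_window j s /\ D (s * s - 1) = 0.
Proof.
intros Hj; assert (P := PI2_3_2).
assert (Hj1 : 1 <= INR j) by (change 1 with (INR 1); apply le_INR; lia).
destruct (bi_lipschitz_onto Theta c0 Lp Hc0 HLp HTheta ((IZR j0 + INR j) * PI - 3 * eta)) as [s1 [S1 E1]]; [nra|].
destruct (bi_lipschitz_onto Theta c0 Lp Hc0 HLp HTheta ((IZR j0 + INR j) * PI + 3 * eta)) as [s2 [S2 E2]]; [nra|].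
assert (W1 : in_window j s1) by (split; [auto|]; rewrite E1; apply Rabs_le; lra).
assert (W2 : in_window j s2) by (split; [auto|]; rewrite E2; apply Rabs_le; lra).
assert (M1 := window_le_Smax j s1 ltac:(lia) W1). assert (M2 := window_le_Smax j s2 ltac:(lia) W2).
assert (S12 : s1 < s2) by (apply (bi_lipschitz_lt Theta c0 Lp); auto; lra).
rewrite INR_IZR_plus in E1, E2.
set (N := (j0 + Z.of_nat j)%Z) in *.
destruct (Hclose s1 ltac:(lra)) as [a1 [_ [A1 [_ [H1 _]]]]].
destruct (Hclose s2 ltac:(lra)) as [a2 [_ [A2 [_ [H2 _]]]]].
rewrite E1 in H1; rewrite E2 in H2.
replace (IZR N * PI - 3 * eta) with (IZR N * PI + - (3 * eta)) in H1 by ring.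
rewrite sin_shift_int, sin_neg in H1; rewrite sin_shift_int in H2.
assert (Sn := sin_ge_half (3 * eta) ltac:(lra)).
apply Rabs_le_between in H1; apply Rabs_le_between in H2.
set (sg := cos (IZR N * PI)) in *.
set (f := fun x => sg * D x).
assert (F1 : f (s1 * s1 - 1) < 0).
{ unfold f; destruct (cos_int_PI N) as [E|E]; fold sg in E; rewrite E in *; nra. }
assert (F2 : 0 < f (s2 * s2 - 1)).
{ unfold f; destruct (cos_int_PI N) as [E|E]; fold sg in E; rewrite E in *; nra. }
destruct (IVT f (s1 * s1 - 1) (s2 * s2 - 1)) as [x [Hx Fx]]; auto.
- intros x; apply continuity_pt_filterlim; change (continuous (fun x => sg * D x) x); cont.
- nra.
- set (v := sqrt (x + 1)).
  assert (Ev : v * v = x + 1) by (apply sqrt_sqrt; nra).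
  assert (Pv : 0 <= v) by apply sqrt_pos.
  assert (Hv : s1 <= v <= s2) by (split; apply Rnot_lt_le; intros L; nra).
  exists v; split.
  + split; [lra|]. rewrite INR_IZR_plus; fold N.
    assert (G1 := bi_lipschitz_le Theta c0 Lp Hc0 HTheta s1 v S1 ltac:(lra)).
    assert (G2 := bi_lipschitz_le Theta c0 Lp Hc0 HTheta v s2 ltac:(lra) ltac:(lra)).
    rewrite E1 in G1; rewrite E2 in G2; apply Rabs_le; lra.
  + replace (v * v - 1) with x by lra. unfold f in Fx.
    apply Rmult_integral in Fx; destruct Fx as [Fx|]; auto.
    unfold sg in Fx; destruct (cos_int_PI N); lra.
Qed.

Lemma root_in_window (x : R) (t : R) : D x = 0 -> in_window k t -> x <= t * t - 1 ->
  exists j s, (1 <= j <= k)%nat /\ x = s * s - 1 /\ in_window j s.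
Proof.
intros Zx Wt Hx; assert (P := PI2_3_2).
assert (Px : 0 < x) by (apply Rnot_le_lt; intros L; specialize (Dpos x L); lra).
assert (Mt := window_le_Smax k t (Nat.le_refl _) Wt); destruct Wt as [Ht Wt].
set (v := sqrt (x + 1)).
assert (Ev : v * v = x + 1) by (apply sqrt_sqrt; lra).
assert (Pv : 0 <= v) by apply sqrt_pos.
assert (Hv : 1 <= v <= t) by (split; apply Rnot_lt_le; intros L; nra).
destruct (Hclose v ltac:(lra)) as [a1 [_ [_ [_ [H1 _]]]]].
replace (v * v - 1) with x in H1 by lra.
rewrite Zx, Rmult_0_r, Rminus_0_l, Rabs_Ropp in H1.
destruct (near_multiple_of_PI _ _ H1 ltac:(lra)) as [N HN].
assert (G1 := bi_lipschitz_le Theta c0 Lp Hc0 HTheta 1 v ltac:(lra) ltac:(lra)).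
assert (G2 := bi_lipschitz_le Theta c0 Lp Hc0 HTheta v t ltac:(lra) ltac:(lra)).
assert (HN' := HN); apply Rabs_le_between in HN'; apply Rabs_le_between in Wt.
assert (L1 : (j0 < N)%Z) by (apply lt_IZR; apply Rmult_lt_reg_r with PI; lra).
assert (L2 : (N < j0 + Z.of_nat k + 1)%Z).
{ apply lt_IZR; rewrite !plus_IZR, <- INR_IZR_INZ. apply Rmult_lt_reg_r with PI; lra. }
exists (Z.to_nat (N - j0)), v; split; [lia|split; [lra|split; [lra|]]].
rewrite INR_IZR_plus; replace (j0 + Z.of_nat (Z.to_nat (N - j0)))%Z with N by lia. exact HN.
Qed.

Lemma lamn_strict (i j : nat) : (1 <= i)%nat -> (i < j)%nat -> (j <= S n)%nat -> lamn i < lamn j.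
Proof.
intros Hi Hij; induction Hij as [|j Hij IH]; intros Hj.
- apply Linc; lia.
- apply Rlt_trans with (lamn j); [apply IH; lia | apply Linc; lia].
Qed.

(** Each of the first [k] windows contains exactly one discrete eigenvalue and there
    are no others below the last one, so the root in the [j]-th window cannot have
    an index [i <> j]: for [i < j] it would lie in an earlier window, and for
    [i > j] the eigenvalue [lamn j] would be left without a window. *)
Lemma lamn_in_window (j : nat) : (1 <= j <= k)%nat ->
  exists s, in_window j s /\ lamn j = s * s - 1 /\ (j <= S n)%nat.
Proof.
induction j as [j IH] using (well_founded_ind Nat.lt_wf_0); intros Hj.
destruct (window_root j Hj) as [s [Ws Zs]].
destruct (proj1 (Lroot _) Zs) as [i [Hi Ei]].
assert (Same : forall s t : R, 1 <= s -> 1 <= t -> s * s - 1 = t * t - 1 -> s = t).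
{ intros a b Ha Hb E; apply Rsqr_inj; [lra|lra|unfold Rsqr; lra]. }
destruct (Nat.lt_trichotomy i j) as [L|[E|L]].
- exfalso; destruct (IH i L ltac:(lia)) as [t [Wt [Et _]]].
  assert (s = t) by (apply Same; [apply Ws | apply Wt | lra]).
  assert (O := window_order i j t s L Wt Ws); lra.
- subst i; exists s; split; [|split]; auto; lia.
- exfalso.
  assert (Lt := lamn_strict j i ltac:(lia) L ltac:(lia)).
  assert (Zj : D (lamn j) = 0) by (apply Lroot; exists j; split; auto; lia).
  destruct (window_root k ltac:(lia)) as [t [Wt _]].
  assert (Top : exists t, in_window k t /\ s <= t).
  { destruct (Nat.eq_dec j k) as [->|Nk]; [exists s; split; auto; lra|].
    exists t; split; auto; left; apply (window_order j k); auto; lia. }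
  clear t Wt; destruct Top as [t [Wt Hst]].
  assert (Hs1 : 1 <= s) by apply Ws.
  destruct (root_in_window (lamn j) t Zj Wt) as [j' [s' [Hj' [Es' Ws']]]]; [nra|].
  assert (Hs1' : 1 <= s') by apply Ws'.
  assert (Lss : s' < s) by (apply Rnot_le_lt; intros Q; nra).
  rewrite Es' in Zj.
  destruct (Nat.lt_trichotomy j' j) as [L'|[E'|L']].
  + destruct (IH j' L' ltac:(lia)) as [u [Wu [Eu Hu]]].
    assert (Zu : D (u * u - 1) = 0) by (rewrite <- Eu; apply Lroot; exists j'; split; auto; lia).
    assert (Q := window_unique j' s' u ltac:(lia) Ws' Wu Zj Zu).
    assert (Lt2 := lamn_strict j' j ltac:(lia) L' ltac:(lia)). rewrite Q in Es'; lra.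
  + subst j'; assert (Q := window_unique j s' s ltac:(lia) Ws' Ws Zj Zs); lra.
  + assert (O := window_order j j' s s' L' Ws Ws'); lra.
Qed.

Lemma lamn_error : Rabs (lamn k - (Sk * Sk - 1)) <= 2 * Smax * (3 * eta / c0).
Proof.
destruct (lamn_in_window k ltac:(lia)) as [s [Ws [Es _]]].
assert (Ms := window_le_Smax k s (Nat.le_refl _) Ws).
destruct Ws as [H1 Ws]; destruct HSk as [S1 [S2 S3]].
assert (E := bi_lipschitz_dist Theta c0 Lp Hc0 HTheta Sk s S1 H1).
rewrite S2 in E.
assert (F : Rabs (s - Sk) <= 3 * eta / c0) by (apply Rle_div_r; [lra|]; lra).
assert (0 <= 3 * eta / c0) by (apply Rdiv_le_0_compat; lra).
rewrite Es; replace (s * s - 1 - (Sk * Sk - 1)) with ((s + Sk) * (s - Sk)) by ring.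
rewrite Rabs_mult, (Rabs_right (s + Sk)) by lra.
apply Rmult_le_compat; try lra; apply Rabs_pos.
Qed.

End Matching.

(** * The error bound *)

Lemma step_le_max_step (n : nat) (x : nat -> R) (i : nat) : (i <= n)%nat ->
  x (S i) - x i <= max_step n x.
Proof.
intros Hi; unfold max_step; apply MaxRlist_P1.
apply (in_map (delta_plus x)), in_seq; lia.
Qed.

Lemma grid_in_segment (l r : R) (n : nat) (x : nat -> R) : is_grid l r n x ->
  forall i, (i <= S n)%nat -> l <= x i <= r.
Proof.
intros [H0 [H1 H2]].
assert (Mono : forall j i, (i + j <= S n)%nat -> x i <= x (i + j)%nat).
{ induction j as [|j IH]; intros i Hij.
  - rewrite Nat.add_0_r; lra.
  - specialize (IH i ltac:(lia)); specialize (H2 (i + j)%nat ltac:(lia)).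
    rewrite Nat.add_succ_r; lra. }
intros i Hi; split.
- rewrite <- H0; apply (Mono i 0%nat); lia.
- rewrite <- H1; replace (S n) with (i + (S n - i))%nat by lia; apply Mono; lia.
Qed.

Lemma index_bound (k : nat) (h : R) : 0 < h -> INR k <= Rpower h (- (1 / 4)) -> INR k ^ 4 * h <= 1.
Proof.
intros Hh Hk.
assert (P : 0 < Rpower h (- (1 / 4))) by apply exp_pos.
assert (E : Rpower h (- (1 / 4)) ^ 4 = / h).
{ rewrite <- Rpower_pow by auto; rewrite Rpower_mult.
  replace (- (1 / 4) * INR 4) with (Ropp 1) by (simpl; field).
  rewrite Rpower_Ropp, Rpower_1; auto. }
assert (Q : INR k ^ 4 <= / h) by (rewrite <- E; apply pow_incr; split; auto; apply pos_INR).
replace 1 with (/ h * h) by (field; lra). apply Rmult_le_compat_r; lra.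
Qed.

Theorem proposition4p2
  (l r rho : R) (mu sigma kappa : R -> R)
  (x : nat -> nat -> R) (C0 : R)
  (lam : nat -> R) (lamn : nat -> nat -> R) (s : scheme)
  (h_lr : l < r) (h_rho : 0 < rho)
  (h_mu : C_on l r 3 mu)
  (h_sigma : C_on l r 4 (fun y => sigma y ^ 2))
  (h_sigma_pos : forall y, l <= y <= r -> 0 < sigma y ^ 2)
  (h_kappa : C_on l r 2 kappa)
  (h_kappa_nonneg : forall y, l <= y <= r -> 0 <= kappa y)
  (h_lam : sl_spectrum l r rho mu sigma kappa lam)
  (h_grid : forall n, is_grid l r n (x n))
  (h_mesh : Un_cv (fun n => max_step n (x n)) 0)
  (h_ratio : forall n, max_step n (x n) / min_step n (x n) <= C0) :
  exists delta0 C : R, 0 < delta0 /\ 0 < C /\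
    forall n, 0 < max_step n (x n) < delta0 ->
      discrete_spectrum s rho mu sigma kappa n (x n) (lamn n) ->
      forall k : nat, (1 <= k)%nat ->
        INR k <= Rpower (max_step n (x n)) (- (1 / 4)) ->
        Rabs (lamn n k - lam k)
          <= C * INR k ^ 4 * max_step n (x n) ^ convergence_order s.
Proof.
destruct (normal_form_exists l r rho mu sigma kappa h_lr h_rho h_mu h_sigma h_sigma_pos
  h_kappa h_kappa_nonneg) as [P HP].
assert (HP' : represents P (lo P) (hi P) (bc P) mu sigma kappa).
{ rewrite (rep_lo _ _ _ _ _ _ _ HP), (rep_hi _ _ _ _ _ _ _ HP), (rep_bc _ _ _ _ _ _ _ HP); exact HP. }
destruct (spectrum_by_angle P l r rho mu sigma kappa lam HP h_lam)
  as [Theta [c0 [Lp [K [j0 [sk [Hc0 [HLp [HK [HT [Hshoot [Hj0 Hsk]]]]]]]]]]]].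
destruct (coefficient_bounds P) as [M [k1 [HM [Hk1 HB]]]].
assert (lr := lo_hi P). assert (Hbc := bc_pos P). assert (Hpi := PI2_3_2).
set (A := 8 * M * M * M * k1 * k1). set (F := 30 * (M * M * M * K)).
set (Ceta := K * (exp (3 * A * (hi P - lo P)) * (M * K * (bc P + 1) + 4 * A * F * (hi P - lo P)))).
assert (PA : 0 <= A) by (unfold A; repeat apply Rmult_le_pos; lra).
assert (PF : 0 <= F) by (unfold F; repeat apply Rmult_le_pos; lra).
assert (PC : 0 < Ceta).
{ unfold Ceta; apply Rmult_lt_0_compat; [lra|]; apply Rmult_lt_0_compat; [apply exp_pos|].
  assert (0 < M * K * (bc P + 1)) by (repeat apply Rmult_lt_0_compat; lra).
  assert (0 <= 4 * A * F * (hi P - lo P)) by (repeat apply Rmult_le_pos; lra). lra. }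
(* [S_k <= 1 + k * PI / c0], and one more unit covers the window around [S_k] *)
set (B1 := 2 + PI / c0).
assert (HB1 : 2 <= B1) by (unfold B1; assert (0 < PI / c0) by (apply Rdiv_lt_0_compat; lra); lra).
set (B3 := B1 * B1 * B1).
assert (HB3 : 1 <= B3) by (unfold B3; assert (1 <= B1 * B1) by nra; nra).
(* windows this narrow are disjoint, avoid [Theta 1], and stay below [Smax] *)
set (e0 := Rmin (Rmin (1 / 4) c0) (Rmin ((Theta 1 - IZR j0 * PI) / 2) ((IZR j0 + 1) * PI - Theta 1))).
assert (He0 : 0 < e0) by (repeat apply Rmin_pos; lra).
assert (He1 : e0 <= 1 / 4) by (eapply Rle_trans; [apply Rmin_l | apply Rmin_l]).
assert (He2 : e0 <= c0) by (eapply Rle_trans; [apply Rmin_l | apply Rmin_r]).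
assert (He3 : e0 <= (Theta 1 - IZR j0 * PI) / 2) by (eapply Rle_trans; [apply Rmin_r | apply Rmin_l]).
assert (He4 : e0 <= (IZR j0 + 1) * PI - Theta 1) by (eapply Rle_trans; [apply Rmin_r | apply Rmin_r]).
set (Q := 16 * (M * M * M * (k1 * k1)) * (1 + bc P)).
assert (HQ : 0 < Q) by (unfold Q; repeat apply Rmult_lt_0_compat; lra).
set (E := 3 * (Ceta * (1 + B3))).
assert (HE0 : 0 < Ceta * (1 + B3)) by (apply Rmult_lt_0_compat; lra).
assert (HE : 0 < E) by (unfold E; lra).
assert (HBE : 0 < B1 * E) by (apply Rmult_lt_0_compat; lra).
exists (Rmin (Rmin 1 (/ B3)) (Rmin (/ Q) (e0 / E))), (2 * B1 * E / c0).
split; [repeat apply Rmin_pos; try lra; try (apply Rinv_0_lt_compat; lra); apply Rdiv_lt_0_compat; lra|].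
split; [apply Rdiv_lt_0_compat; lra|].
intros n [Hh Hhd] Hspec k Hk Hkh.
set (h := max_step n (x n)) in *.
assert (Hh1 : h < 1) by (eapply Rlt_le_trans; [exact Hhd|]; eapply Rle_trans; [apply Rmin_l | apply Rmin_l]).
assert (Hh2 : h < / B3) by (eapply Rlt_le_trans; [exact Hhd|]; eapply Rle_trans; [apply Rmin_l | apply Rmin_r]).
assert (Hh3 : h < / Q) by (eapply Rlt_le_trans; [exact Hhd|]; eapply Rle_trans; [apply Rmin_r | apply Rmin_l]).
assert (Hh4 : h < e0 / E) by (eapply Rlt_le_trans; [exact Hhd|]; eapply Rle_trans; [apply Rmin_r | apply Rmin_r]).
assert (Hh2' : B3 * h <= 1).
{ apply Rmult_lt_compat_l with (r := B3) in Hh2; [|lra]. rewrite Rinv_r in Hh2; lra. }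
assert (Hh3' : Q * h <= 1).
{ apply Rmult_lt_compat_l with (r := Q) in Hh3; [|lra]. rewrite Rinv_r in Hh3; lra. }
assert (Hh4' : E * h <= e0).
{ apply Rmult_lt_compat_l with (r := E) in Hh4; [|lra].
  replace (E * (e0 / E)) with e0 in Hh4 by (field; lra). lra. }
assert (Hk4 := index_bound k h Hh Hkh).
set (q := INR k) in *.
assert (Hq : 1 <= q) by (unfold q; change 1 with (INR 1); apply le_INR; auto).
destruct (le_sqr_le_cube q Hq) as [q2 q3].
assert (q4 : q * q * q <= q ^ 4).
{ replace (q ^ 4) with (q * q * q * q) by ring.
  rewrite <- (Rmult_1_r (q * q * q)) at 1; apply Rmult_le_compat_l; lra. }
assert (Hq3 : q * q * q * h <= 1).
{ eapply Rle_trans; [|exact Hk4]; apply Rmult_le_compat_r; lra. }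
assert (Hgrid := h_grid n).
assert (Hx0 : x n 0%nat = lo P) by (rewrite (rep_lo _ _ _ _ _ _ _ HP); apply Hgrid).
assert (Hx1 : x n (S n) = hi P) by (rewrite (rep_hi _ _ _ _ _ _ _ HP); apply Hgrid).
assert (Hx : forall i, (i <= S n)%nat -> lo P <= x n i <= hi P).
{ rewrite (rep_lo _ _ _ _ _ _ _ HP), (rep_hi _ _ _ _ _ _ _ HP); apply grid_in_segment, Hgrid. }
assert (Hst : forall i, (i <= n)%nat -> 0 < x n (S i) - x n i <= h).
{ intros i Hi; split; [|apply step_le_max_step; auto].
  destruct Hgrid as [_ [_ G]]; specialize (G i Hi); lra. }
assert (Hbb : forall y, lo P <= y <= hi P -> Rabs (cb P y) <= M) by (intros; apply HB; auto).
assert (Hmm : forall y, lo P <= y <= hi P -> cm P y <= M).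
{ intros y Hy; eapply Rle_trans; [apply Rle_abs | apply HB; auto]. }
assert (Hsm : M * (1 + bc P) * h <= 1).
{ eapply Rle_trans; [|exact Hh3']; apply Rmult_le_compat_r; [lra|].
  unfold Q; apply Rmult_le_compat_r; [lra|].
  destruct (le_sqr_le_cube M HM) as [M2 M3]; destruct (le_sqr_le_cube k1 Hk1) as [k2 _].
  replace (16 * (M * M * M * (k1 * k1))) with ((k1 * k1) * (16 * (M * M * M))) by ring.
  rewrite <- (Rmult_1_l M) at 1. apply Rmult_le_compat; lra. }
set (D := fun t => fst (leapfrog P s (x n) t (S n))).
set (Dd := fun t => snd (leapfrog P s (x n) t (S n))).
set (Smax := B1 * q).
assert (HSm : 1 <= Smax) by (apply one_le_mult; lra).
set (T := Smax * Smax * Smax * (h * h)).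
assert (ET : T = B3 * (q * q * q * h) * h) by (unfold T, Smax, B3; ring).
assert (PT : 0 < T) by (unfold T; repeat apply Rmult_lt_0_compat; lra).
assert (HT1 : T <= B3 * h).
{ rewrite ET; apply Rmult_le_compat_r; [lra|]. rewrite <- (Rmult_1_r B3) at 2.
  apply Rmult_le_compat_l; lra. }
assert (Hse : 0 <= start_error s h <= h) by (destruct s; simpl; lra).
set (eta := Ceta * (start_error s h + T)).
assert (Peta : 0 < eta) by (apply Rmult_lt_0_compat; lra).
assert (Heta : 3 * eta <= e0).
{ eapply Rle_trans; [|exact Hh4']. unfold eta, E.
  assert (Ceta * (start_error s h + T) <= Ceta * ((1 + B3) * h)) by (apply Rmult_le_compat_l; lra). lra. }
destruct (Hsk k Hk) as [Sk1 [Elam ESk]].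
assert (HSk : sk k + 3 * eta / c0 <= Smax).
{ assert (G := HT 1 (sk k) ltac:(lra) Sk1). rewrite ESk in G; fold q in G.
  assert (c0 * (sk k - 1) <= q * PI) by lra.
  assert (G2 : sk k - 1 <= q * PI / c0) by (apply Rle_div_r; lra).
  assert (G3 : 3 * eta / c0 <= 1) by (apply Rle_div_l; lra).
  unfold Smax, B1. replace ((2 + PI / c0) * q) with (2 * q + q * PI / c0) by (field; lra). lra. }
assert (Main : Rabs (lamn n k - (sk k * sk k - 1)) <= 2 * Smax * (3 * eta / c0)).
{ destruct Hspec as [Linc Liff].
  apply (lamn_error Theta c0 Lp j0 D Dd eta Smax (sk k) k n (lamn n)); auto.
  - intros t; destruct (leapfrog_wronskian P s (x n) n M h Hbb Hmm Hsm Hx0 Hx Hst t (S n) (Nat.le_refl _))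
      as [g' [d' [Dg _]]].
    exact (continuous_of_derive D t g' Dg).
  - intros t Zt; apply (leapfrog_crossing P s (x n) n M h Hbb Hmm Hsm Hx0 Hx Hst t Zt).
  - intros t Ht; apply (leapfrog_last_positive P s (x n) n M h Hbb Hsm Hx0 Hx Hst t mu sigma kappa HP' Ht).
  - lra.
  - lra.
  - intros S [HS1 HS2]; destruct (Hshoot S HS1) as [u [d Hu]].
    assert (HTS : S * S * S * (h * h) <= T).
    { unfold T; apply Rmult_le_compat_r; [apply Rle_0_sqr|].
      apply Rmult_le_compat; try lra; [apply Rle_0_sqr|]. apply Rmult_le_compat; lra. }
    destruct (leapfrog_angle P M k1 K HM Hk1 HK HB s (x n) n h Hh3' Hx0 Hx1 Hx Hst S (Theta S) u d HS1
      ltac:(lra) Hu) as [a1 [a2 [A1 [A2 [E1 E2]]]]].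
    fold A F in E1, E2.
    assert (Le : K * (exp (3 * A * (hi P - lo P)) * (M * K * (bc P + 1) + 4 * A * F * (hi P - lo P)) *
      (start_error s h + S * S * S * (h * h))) <= eta).
    { unfold eta. rewrite <- Rmult_assoc; fold Ceta. apply Rmult_le_compat_l; lra. }
    exists a1, a2; split; [auto|split; [auto|split]]; eapply Rle_trans; try exact Le; assumption.
  - intros t; rewrite <- Liff.
    rewrite <- (rep_bc _ _ _ _ _ _ _ HP). symmetry.
    apply (discrete_eigenvalue_iff P s (x n) n M h Hbb Hsm Hx0 Hx Hst t mu sigma kappa HP'). }
rewrite Elam; eapply Rle_trans; [exact Main|].
assert (Fin : q * (start_error s h + T) <= (1 + B3) * (q ^ 4 * h ^ convergence_order s)).
{ rewrite ET; destruct s; simpl start_error; simpl convergence_order.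
  - assert (X1 : q * h <= q ^ 4 * h) by (apply Rmult_le_compat_r; lra).
    assert (X2 : q * (B3 * (q * q * q * h) * h) <= B3 * (q ^ 4 * h)).
    { replace (q * (B3 * (q * q * q * h) * h)) with (B3 * (q ^ 4 * h) * h) by ring.
      rewrite <- (Rmult_1_r (B3 * (q ^ 4 * h))) at 2. apply Rmult_le_compat_l; [|lra].
      repeat apply Rmult_le_pos; try lra; apply pow_le; lra. }
    rewrite pow_1; lra.
  - replace (q * (0 + B3 * (q * q * q * h) * h)) with (B3 * (q ^ 4 * h ^ 2)) by ring.
    assert (0 <= q ^ 4 * h ^ 2) by (apply Rmult_le_pos; apply pow_le; lra). lra. }
replace (2 * Smax * (3 * eta / c0)) with (2 * B1 * 3 * Ceta / c0 * (q * (start_error s h + T)))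
  by (unfold Smax, eta; field; lra).
replace (2 * B1 * E / c0 * q ^ 4 * h ^ convergence_order s) with
  (2 * B1 * 3 * Ceta / c0 * ((1 + B3) * (q ^ 4 * h ^ convergence_order s))) by (unfold E; field; lra).
apply Rmult_le_compat_l; [|exact Fin].
assert (0 < B1 * Ceta) by (apply Rmult_lt_0_compat; lra).
apply Rdiv_le_0_compat; lra.
Qed.
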